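(* Let $m\in\mathbb{N}$. All of the following statements hold. 1. $\mathcal{H}_m$, $\mathcal{H}_m\cap\mathcal{B}_m$, $\mathcal{H}_m\cap\mathcal{D}_m$, and $\mathcal{H}_m\cap\mathcal{B}_m\cap\mathcal{D}_m$ are open in $(\mathrm{Poly}_{\deg\geq2})^m$. 2. Let $d_1,\ldots,d_m\in\mathbb{N}$ be such that $d_j\geq2$ for each $j=1,\ldots,m$. Then $\pi_1:\mathcal{H}_m\cap\mathcal{B}_m\cap(\mathcal{Y}_{d_1}\times\cdots\times\mathcal{Y}_{d_m})\to\mathcal{H}_1\cap\mathcal{B}_1\cap\mathcal{Y}_{d_1}$ is surjective. 3. Let $d_1,\ldots,d_m\in\mathbb{N}$ be such that $d_j\geq2$ for each $j=1,\ldots,m$ and such that $(d_1,\ldots,d_m)\neq(2,2,\ldots,2)$. Then $\pi_1:\mathcal{H}_m\cap\mathcal{B}_m\cap\mathcal{D}_m\cap(\mathcal{Y}_{d_1}\times\cdots\times\mathcal{Y}_{d_m})\to\mathcal{H}_1\cap\mathcal{B}_1\cap\mathcal{Y}_{d_1}$ is surjective.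
   Context: $\hat{\mathbb{C}}$ is the Riemann sphere. $\mathrm{Poly}_{\deg\geq2}$ is the set of polynomial maps $\hat{\mathbb{C}}\to\hat{\mathbb{C}}$ of degree at least two with the topology of uniform convergence on $\hat{\mathbb{C}}$ with respect to the spherical distance; $(\mathrm{Poly}_{\deg\geq2})^m$ has the product topology. For an integer $d\geq2$, $\mathcal{Y}_d$ is the set of polynomial maps of degree $d$, with the relative topology. A polynomial semigroup is a semigroup, under composition, generated by a non-empty family of non-constant polynomial maps; $\langle h_1,\ldots,h_m\rangle$ is the semigroup generated by $h_1,\ldots,h_m$. The Fatou set $F(G)$ is the set of $z\in\hat{\mathbb{C}}$ having a neighborhood on which $G$ is a normal family; the Julia set is $J(G)=\hat{\mathbb{C}}\setminus F(G)$. $CV(g)$ is the set of critical values of $g:\hat{\mathbb{C}}\to\hat{\mathbb{C}}$, $P(G)=\overline{\bigcup_{g\in G}CV(g)}$ (closure in $\hat{\mathbb{C}}$), and $P^{\ast}(G)=P(G)\setminus\{\infty\}$. $G$ is hyperbolic if $P(G)\subset F(G)$. $\mathcal{G}$ is the set of all polynomial semigroups $G$ such that each element of $G$ has degree at least two and $P^{\ast}(G)$ is bounded in $\mathbb{C}$. For $m\in\mathbb{N}$: $\mathcal{H}_m=\{(h_1,\ldots,h_m)\in(\mathrm{Poly}_{\deg\geq2})^m\mid\langle h_1,\ldots,h_m\rangle\text{ is hyperbolic}\}$, $\mathcal{B}_m=\{(h_1,\ldots,h_m)\in(\mathrm{Poly}_{\deg\geq2})^m\mid\langle h_1,\ldots,h_m\rangle\in\mathcal{G}\}$,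 $\mathcal{D}_m=\{(h_1,\ldots,h_m)\in(\mathrm{Poly}_{\deg\geq2})^m\mid J(\langle h_1,\ldots,h_m\rangle)\text{ is disconnected}\}$. $\pi_1:(\mathrm{Poly}_{\deg\geq2})^m\to\mathrm{Poly}_{\deg\geq2}$ is the projection $\pi_1(h_1,\ldots,h_m)=h_1$.
   Formalization: Statement 3 is proved for m ≥ 2 only: for m = 1 and d_1 ≥ 3 it is false, since bounded P*(⟨h⟩) forces J(⟨h⟩) connected, so H_1∩B_1∩D_1 is empty, while z^{d_1} lies in H_1∩B_1∩Y_{d_1}. *)

(* Defs.v *)
From HB Require Import structures.
From mathcomp Require Import all_boot all_order all_algebra.
From mathcomp Require Import ring lra.
From mathcomp.real_closed Require Import complex.
From mathcomp Require Import all_classical all_reals all_analysis.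

Set Implicit Arguments.
Unset Strict Implicit.
Unset Printing Implicit Defensive.

Import Order.TTheory GRing.Theory Num.Theory.
Import numFieldNormedType.Exports.

Local Open Scope classical_set_scope.
Local Open Scope ring_scope.
Local Open Scope complex_scope.

(* The Riemann sphere: [Some z] is the finite point z and [None] is infinity. *)
Definition sphere (R : realType) : Type := option R[i].

HB.instance Definition _ (R : realType) := Pointed.copy (sphere R) (option R[i]).

Section SphericalMetric.
Variable R : realType.
Implicit Types u v : R * R * R.

(* Inverse of the stereographic projection, onto the unit sphere of R^3. *)
Definition stereo (z : sphere R) : R * R * R :=
  match z with
  | Some (a +i* b) =>
      let s := 1 + a ^+ 2 + b ^+ 2 in
      (2 * a / s, 2 * b / s, (a ^+ 2 + b ^+ 2 - 1) / s)
  | None => (0, 0, 1)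
  end.

Definition dot u v : R := u.1.1 * v.1.1 + u.1.2 * v.1.2 + u.2 * v.2.

(* Length of the shortest great-circle arc, i.e. the geodesic distance of the
   metric 2|dz|/(1+|z|^2). *)
Definition sdist (z w : sphere R) : R := acos (dot (stereo z) (stereo w)).

Lemma stereo_den_gt0 (a b : R) : 0 < 1 + a ^+ 2 + b ^+ 2.
Proof. by have := sqr_ge0 a; have := sqr_ge0 b; lra. Qed.

Lemma dot_stereo z : dot (stereo z) (stereo z) = 1.
Proof.
case: z => [[a b]|]; rewrite /dot /=; last by ring.
by field; rewrite gt_eqF // stereo_den_gt0.
Qed.

Lemma stereo_inj : injective stereo.
Proof.
have none a b : stereo (Some (a +i* b)) <> stereo None.
  case=> _ _ /eqP; rewrite -subr_eq0 => /eqP.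
  set s := 1 + _ + _.
  have s0 : s != 0 by rewrite gt_eqF // stereo_den_gt0.
  move=> h; have : 2 = 0 :> R.
    have -> : 2 = - s * ((a ^+ 2 + b ^+ 2 - 1) / s - 1).
      by rewrite /s; field.
    by rewrite h mulr0.
  by lra.
case=> [[a b]|] [[c d]|] //; last by move=> /esym /none.
  case; set s := 1 + a ^+ 2 + b ^+ 2; set t := 1 + c ^+ 2 + d ^+ 2.
  have s0 : s != 0 by rewrite gt_eqF // stereo_den_gt0.
  have t0 : t != 0 by rewrite gt_eqF // stereo_den_gt0.
  move=> e1 e2 e3.
  have st : s = t.
    have hs : (a ^+ 2 + b ^+ 2 - 1) / s = 1 - 2 / s by rewrite /s; field.
    have ht : (c ^+ 2 + d ^+ 2 - 1) / t = 1 - 2 / t by rewrite /t; field.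
    have e : s^-1 = t^-1 by lra.
    by rewrite -[s]invrK e invrK.
  have n2 : (2 : R) != 0 by rewrite pnatr_eq0.
  move: e1 e2; rewrite st => /(mulIf (invr_neq0 t0)) /(mulfI n2) ->.
  by move=> /(mulIf (invr_neq0 t0)) /(mulfI n2) ->.
by move=> /none.
Qed.

Lemma dot_sym u v : dot u v = dot v u.
Proof. by rewrite /dot; ring. Qed.

Lemma dot_ge0 u : 0 <= dot u u.
Proof. by rewrite /dot -!expr2 !addr_ge0 ?sqr_ge0. Qed.

Lemma dot_CS u v : dot u v ^+ 2 <= dot u u * dot v v.
Proof.
rewrite -subr_ge0.
have -> : dot u u * dot v v - dot u v ^+ 2 =
    (u.1.1 * v.1.2 - u.1.2 * v.1.1) ^+ 2 +
    (u.1.2 * v.2 - u.2 * v.1.2) ^+ 2 + (u.2 * v.1.1 - u.1.1 * v.2) ^+ 2.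
  by rewrite /dot; ring.
by rewrite !addr_ge0 ?sqr_ge0.
Qed.

Lemma dot_itv z w : -1 <= dot (stereo z) (stereo w) <= 1.
Proof.
rewrite -ler_norml -(@ler_pXn2r _ 2) ?nnegrE ?normr_ge0 ?ler01 //.
by rewrite real_normK ?num_real // expr1n -[1]mulr1 -{1}(dot_stereo z)
  -(dot_stereo w) dot_CS.
Qed.

Lemma sdistxx z : sdist z z = 0.
Proof. by rewrite /sdist dot_stereo acos1. Qed.

Lemma sdist_sym z w : sdist z w = sdist w z.
Proof. by rewrite /sdist dot_sym. Qed.

Lemma sdist_eq0 z w : sdist z w = 0 -> z = w.
Proof.
move=> h; apply: stereo_inj.
have d1 : dot (stereo z) (stereo w) = 1.
  by rewrite -(acosK (x := dot _ _)) ?in_itv /= ?dot_itv // -/(sdist z w) h cos0.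
move: d1 (dot_stereo z) (dot_stereo w); move: (stereo z) (stereo w).
move=> [[x1 x2] x3] [[y1 y2] y3]; rewrite /dot /= => d1 d2 d3.
have s0 : (x1 - y1) ^+ 2 + (x2 - y2) ^+ 2 + (x3 - y3) ^+ 2 = 0.
  transitivity ((x1 * x1 + x2 * x2 + x3 * x3) + (y1 * y1 + y2 * y2 + y3 * y3)
    - 2 * (x1 * y1 + x2 * y2 + x3 * y3)); first by ring.
  by rewrite d1 d2 d3; ring.
move/eqP: s0; rewrite !paddr_eq0 ?addr_ge0 ?sqr_ge0 // !sqrf_eq0 !subr_eq0.
by case/andP=> /andP[/eqP -> /eqP ->] /eqP ->.
Qed.

Lemma sdist_triangle y x z : sdist x z <= sdist x y + sdist y z.
Proof.
rewrite /sdist.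
have hxy := dot_itv x y; have hyz := dot_itv y z; have hxz := dot_itv x z.
set a := acos (dot _ (stereo y)); set b := acos (dot (stereo y) _).
have a0 : 0 <= a by exact: acos_ge0.
have b0 : 0 <= b by exact: acos_ge0.
have [abpi|abpi] := leP (a + b) pi; last first.
  by apply: le_trans (ltW abpi); exact: acos_lepi.
rewrite leNgt; apply/negP => hlt.
have : cos (acos (dot (stereo x) (stereo z))) < cos (a + b).
  by rewrite ltr_cos // in_itv /= ?acos_ge0 ?acos_lepi // addr_ge0.
rewrite acosK ?in_itv //= cosD /a /b !acosK ?in_itv //= !sin_acos //.
move: hxy hyz; have := dot_stereo x; have := dot_stereo y; have := dot_stereo z.
move: (stereo x) (stereo y) (stereo z) => u v w ww vv uu hxy hyz.
apply/negP; rewrite -leNgt lerBlDr -lerBlDl.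
have key : (dot u v * dot v w - dot u w) ^+ 2 <=
    (1 - dot u v ^+ 2) * (1 - dot v w ^+ 2).
  pose p : R * R * R := (u.1.1 - dot u v * v.1.1,
    u.1.2 - dot u v * v.1.2, u.2 - dot u v * v.2).
  pose q : R * R * R := (w.1.1 - dot v w * v.1.1,
    w.1.2 - dot v w * v.1.2, w.2 - dot v w * v.2).
  have pp : dot p p = 1 - dot u v ^+ 2.
    transitivity (dot u u - 2 * dot u v ^+ 2 + dot u v ^+ 2 * dot v v);
      first by rewrite /p /dot /=; ring.
    by rewrite uu vv; ring.
  have qq : dot q q = 1 - dot v w ^+ 2.
    transitivity (dot w w - 2 * dot v w ^+ 2 + dot v w ^+ 2 * dot v v);
      first by rewrite /q /dot /=; ring.
    by rewrite ww vv; ring.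
  have pq : dot p q = - (dot u v * dot v w - dot u w).
    transitivity (dot u w - 2 * (dot u v * dot v w)
      + dot u v * dot v w * dot v v); first by rewrite /p /q /dot /=; ring.
    by rewrite vv; ring.
  by rewrite -pp -qq -sqrrN -pq; exact: dot_CS.
have h1 : 0 <= 1 - dot u v ^+ 2.
  by rewrite subr_ge0 -uu -[dot u u]mulr1 -vv dot_CS.
rewrite -sqrtrM //; apply: le_trans (ler_wsqrtr key).
by rewrite sqrtr_sqr ler_norm.
Qed.

End SphericalMetric.

HB.instance Definition _ (R : realType) := isMetric.Build R (sphere R)
  (@sdistxx R) (@sdist_eq0 R) (@sdist_sym R) (@sdist_triangle R).

Section Dynamics.
Variable R : realType.
Local Notation C := R[i].
Local Notation Chat := (sphere R).
Implicit Types (f g : Chat -> Chat) (G : set (Chat -> Chat)).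

(* [omap] fixes infinity, so this is the extension of p to the sphere only when
   d >= 1; it is never used with d = 0. *)
Definition polymap_of_degree (d : nat) f : Prop :=
  exists2 p : {poly C}, size p = d.+1 & f = omap (fun z => p.[z]).

Definition nonconstant_polymap f : Prop :=
  exists2 d, (1 <= d)%N & polymap_of_degree d f.

Definition polymap_deg_ge2 f : Prop :=
  exists2 d, (2 <= d)%N & polymap_of_degree d f.

Definition generated (S : set (Chat -> Chat)) : set (Chat -> Chat) :=
  smallest (fun A => forall f g, A f -> A g -> A (f \o g)) S.

Definition polynomial_semigroup G : Prop :=
  exists S : set (Chat -> Chat),
    [/\ S !=set0, S `<=` nonconstant_polymap & G = generated S].

Definition normal_on (U : set Chat) G : Prop :=
  forall f : nat -> Chat -> Chat, (forall n, G (f n)) ->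
    exists (k : nat -> nat) (g : Chat -> Chat),
      {homo k : i j / (i < j)%N} /\
      {family compactly_in U, (f \o k) @ \oo --> g}.

Definition Fatou G : set Chat :=
  [set z | exists U : set Chat, [/\ open U, U z & normal_on U G]].

Definition Julia G : set Chat := ~` Fatou G.

(* The chart of the sphere centered at a finite z is the identity, the one
   centered at infinity is 1/z.  The value of [to_chart a] at the point outside
   the domain of the chart is irrelevant. *)
Definition to_chart (a z : Chat) : C :=
  match a, z with
  | Some _, Some w => w
  | None, Some w => w^-1
  | _, None => 0
  end.

Definition of_chart (a : Chat) (t : C) : Chat :=
  if a is Some _ then Some t else if t == 0 then None else Some t^-1.

Definition critical_point g (a : Chat) : Prop :=
  is_derive (to_chart a a : C^o) (1 : C^o)
    (to_chart (g a) \o g \o of_chart a : C^o -> C^o) 0.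

Definition CV g : set Chat := g @` critical_point g.

Definition postcritical G : set Chat := closure (\bigcup_(g in G) CV g).

Definition finite_postcritical G : set Chat := postcritical G `\ None.

Definition hyperbolic G : Prop := postcritical G `<=` Fatou G.

Definition pcb_class : set (set (Chat -> Chat)) :=
  [set G | [/\ polynomial_semigroup G, G `<=` polymap_deg_ge2 &
    bounded_set (Some @^-1` finite_postcritical G : set C^o)]].

Definition PolyGe2 : Type :=
  set_type (polymap_deg_ge2 : set {uniform Chat -> Chat}).

HB.instance Definition _ := Topological.on PolyGe2.

Definition PolyGe2_tuple (m : nat) : Type := {ptws 'I_m -> PolyGe2}.

HB.instance Definition _ (m : nat) := Topological.on (PolyGe2_tuple m).

Definition semigroup_of (m : nat) (h : PolyGe2_tuple m) : set (Chat -> Chat) :=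
  generated (range (fun j => set_val (h j) : Chat -> Chat)).

Definition Hyp (m : nat) : set (PolyGe2_tuple m) :=
  [set h | hyperbolic (semigroup_of h)].

Definition Bdd (m : nat) : set (PolyGe2_tuple m) :=
  [set h | pcb_class (semigroup_of h)].

Definition Disc (m : nat) : set (PolyGe2_tuple m) :=
  [set h | ~ connected (Julia (semigroup_of h))].

Definition Ydeg (d : nat) : set PolyGe2 :=
  [set f | polymap_of_degree d (set_val f)].

Definition Yprod (m : nat) (d : 'I_m -> nat) : set (PolyGe2_tuple m) :=
  [set h | forall j, Ydeg (d j) (h j)].

Definition ord_first (m : nat) (m_gt0 : (0 < m)%N) : 'I_m := Ordinal m_gt0.

Definition pi1 (m : nat) (m_gt0 : (0 < m)%N) (h : PolyGe2_tuple m) : PolyGe2 :=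
  h (ord_first m_gt0).

Definition singleton_tuple (f : PolyGe2) : PolyGe2_tuple 1 := fun=> f.

End Dynamics.

Arguments Hyp : clear implicits.
Arguments Bdd : clear implicits.
Arguments Disc : clear implicits.
Arguments Ydeg : clear implicits.
Arguments PolyGe2_tuple : clear implicits.
Arguments Yprod R {m} d : rename.

Definition surjection (T U : Type) (A : set T) (B : set U) (f : T -> U) : Prop :=
  set_fun A B f /\ set_surj A B f.

(* Main.v *)
Require Import Defs.
From mathcomp Require Import all_boot all_order all_algebra.
From mathcomp Require Import ring lra.
From mathcomp.real_closed Require Import complex.
From mathcomp Require Import all_classical all_reals all_analysis.

(* Hyperbolicity and postcritical boundedness are detected by traps: open sets K
   containing a fixed neighborhood of h_j(K) and of the critical values of each h_j.
   A hyperbolic semigroup has a trap with nonempty complement containing a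
   neighborhood of infinity, a hyperbolic postcritically bounded one has a bounded
   trap, and the converses follow from the boundedness of 1 / (g - a) for a outside
   K. Traps survive perturbations, which gives the openness of H_m and of
   H_m cap B_m.

   A trap is found near the postcritical set P once long words contract there. If
   they did not, a compactness argument on the prefixes of long words would produce
   words s_n tending to the identity on some disc. The set of points near which
   s_n -> id is open; it is closed at points of P by equicontinuity and elsewhere by
   applying the three circles theorem to inverse branches of s_n, which exist on
   discs disjoint from P. So it would be the whole plane, whereas all words tend to
   infinity near infinity. The same argument shows that J is the set of points with
   arbitrarily long words mapping them outside K, so that J varies upper
   semicontinuously; a pigeonhole argument on the components of the complement of K
   shows that the perturbed Julia set still meets each part of a disconnected J.

   For surjectivity one adds to h_1 maps l (z - b)^d + b with b a critical value of
   h_1 and l small. Scaling those of degree at least 3 (at least 2 if deg h_1 is at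
   least 3) to fix a huge circle, a smaller circle around b is mapped into the trap
   by every generator, and it separates J. *)

Set Implicit Arguments.
Unset Strict Implicit.
Unset Printing Implicit Defensive.

Import Order.TTheory GRing.Theory Num.Theory.
Import numFieldNormedType.Exports.

Local Open Scope classical_set_scope.
Local Open Scope ring_scope.
Local Open Scope complex_scope.

(** * Modulus and compactness in the complex plane *)

(** Function theory is reduced to polynomials. The difference quotient of a polynomial is again a
    polynomial, so Cauchy estimates come from the maximum principle alone. A function g(t(w)) of an
    inverse branch t of f is not a polynomial, but on the image of t it becomes g(z), with w = f(z).
    This is why the maximum principle is stated for quotients s / q on compact sets that need not be
    discs.

    Equicontinuity is used only in a weak form: near p, a word that sends one point into the disc of
    radius rho sends all points into the disc of radius 2 rho. This is a bound on the words, hence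
    usable with the three circles theorem, and the doubling of moduli outside the disc of radius rho
    turns it into bounds on all prefixes.

    The set J itself is awkward to perturb. A trap K is a single set that serves P and all nearby
    P', and both hyperbolicity and the position of J can be read off from finitely many letters and
    K. The margin eta in its definition pays for each perturbation at the cost of one more
    letter. *)

Section Modulus.
Variable R : realType.
Local Notation C := R[i].
Implicit Types z w : C.

Definition cabs z : R := ComplexField.Normc.normc z.

Lemma cabsE z : `|z| = (cabs z)%:C.
Proof. by case: z. Qed.

Lemma cabs_ge0 z : 0 <= cabs z.
Proof. by rewrite -lecR -cabsE normr_ge0. Qed.

Lemma cabs0 : cabs 0 = 0.
Proof. exact: ComplexField.Normc.normc0. Qed.

Lemma cabs1 : cabs 1 = 1.
Proof. exact: ComplexField.Normc.normc1. Qed.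

Lemma cabsM z w : cabs (z * w) = cabs z * cabs w.
Proof. exact: ComplexField.Normc.normcM. Qed.

Lemma cabsN z : cabs (- z) = cabs z.
Proof. by apply: (@complexI R); rewrite -!cabsE normrN. Qed.

Lemma cabsV z : cabs z^-1 = (cabs z)^-1.
Proof. exact: ComplexField.Normc.normcV. Qed.

Lemma cabsX z n : cabs (z ^+ n) = cabs z ^+ n.
Proof. by elim: n => [|n IH]; rewrite ?expr0 ?cabs1 // !exprS cabsM IH. Qed.

Lemma cabs_eq0 z : (cabs z == 0) = (z == 0).
Proof.
apply/eqP/eqP => [/ComplexField.Normc.eq0_normc //|->]; exact: cabs0.
Qed.

Lemma cabs_gt0 z : (0 < cabs z) = (z != 0).
Proof. by rewrite lt_def cabs_ge0 andbT cabs_eq0. Qed.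

Lemma cabsD z w : cabs (z + w) <= cabs z + cabs w.
Proof. by rewrite -lecR rmorphD /= -!cabsE ler_normD. Qed.

Lemma cabsB z w : cabs (z - w) = cabs (w - z).
Proof. by rewrite -cabsN opprB. Qed.

Lemma cabs_tri x z w : cabs (z - w) <= cabs (z - x) + cabs (x - w).
Proof. by have := cabsD (z - x) (x - w); rewrite addrA subrK. Qed.

Lemma cabs_lb z w : cabs z - cabs w <= cabs (z - w).
Proof. by have := cabsD (z - w) w; rewrite subrK; lra. Qed.

Lemma cabs_ub z w : cabs z <= cabs w + cabs (z - w).
Proof. by have := cabs_lb z w; lra. Qed.

Lemma cabsR (x : R) : cabs x%:C = `|x|.
Proof. by rewrite /cabs /= expr0n addr0 sqrtr_sqr. Qed.

Lemma cabs_sqr a b : cabs (a +i* b) ^+ 2 = a ^+ 2 + b ^+ 2.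
Proof. by rewrite /cabs /= sqr_sqrtr // addr_ge0 ?sqr_ge0. Qed.

Lemma cabs_Re z : `|complex.Re z| <= cabs z.
Proof.
case: z => a b; rewrite -(@ler_pXn2r _ 2) ?nnegrE ?cabs_ge0 ?normr_ge0 //.
by rewrite cabs_sqr real_normK ?num_real //= lerDl sqr_ge0.
Qed.

Lemma cabs_Im z : `|complex.Im z| <= cabs z.
Proof.
case: z => a b; rewrite -(@ler_pXn2r _ 2) ?nnegrE ?cabs_ge0 ?normr_ge0 //.
by rewrite cabs_sqr real_normK ?num_real //= lerDr sqr_ge0.
Qed.

Lemma cabs_ReIm z : cabs z <= `|complex.Re z| + `|complex.Im z|.
Proof.
case: z => a b; rewrite -(@ler_pXn2r _ 2) ?nnegrE ?cabs_ge0 ?addr_ge0 //.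
rewrite cabs_sqr /= sqrrD !real_normK ?num_real //.
by have := mulr_ge0 (normr_ge0 a) (normr_ge0 b); lra.
Qed.

Lemma cabs_scal (t : R) z : 0 <= t -> cabs (t%:C * z) = t * cabs z.
Proof. by move=> t0; rewrite cabsM cabsR ger0_norm. Qed.

Lemma cabs_prod (I : Type) (r : seq I) (F : I -> C) :
  cabs (\prod_(i <- r) F i) = \prod_(i <- r) cabs (F i).
Proof. by elim/big_rec2: _ => [|i y x _ <-]; rewrite ?cabs1 ?cabsM. Qed.

End Modulus.

Section Compactness.
Variable R : realType.
Local Notation C := R[i].

Lemma cluster_pt (u : nat -> C) (B : R) : (forall n, cabs (u n) <= B) ->
  exists c, forall e, 0 < e -> forall N, exists2 n, (N <= n)%N & cabs (u n - c) < e.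
Proof.
move=> uB.
pose v n : R * R := (complex.Re (u n), complex.Im (u n)).
have cpt : compact (`[- B, B]%classic `*` `[- B, B]%classic : set (R * R)).
  by apply: compact_setX; apply: segment_compact.
have [] := cpt (v @ \oo) _ _.
  exists 0%N => // n _ /=; rewrite !in_itv /= -!ler_norml.
  by rewrite (le_trans (cabs_Re _)) // (le_trans (cabs_Im _)).
move=> [a b] [_ cl]; exists (a +i* b) => e e0 N.
have [||[x y] [[n Nn [<- <-]] [/= Ba Bb]]] :=
    cl [set v n | n in [set n | (N <= n)%N]] (ball a (e / 2) `*` ball b (e / 2)).
- by exists N => // n Nn; exists n.
- exists (ball a (e / 2), ball b (e / 2)) => //=.
  by split; apply: nbhsx_ballx; rewrite divr_gt0.
exists n => //; apply: (le_lt_trans (cabs_ReIm _)).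
move: Ba Bb; rewrite /ball /= /v.
case: (u n) => c d /=; rewrite distrC => h1; rewrite distrC => h2; lra.
Qed.

(** Connectedness of [0, 1] by real induction: the supremum T of the t such that P holds on [0, t]
    satisfies P by closedness, and openness at T forces T = 1. *)
Lemma segment_ind (P : R -> Prop) : P 0 ->
  (forall t, 0 <= t <= 1 -> P t ->
     exists2 e, 0 < e & forall s, 0 <= s <= 1 -> `|s - t| < e -> P s) ->
  (forall t, 0 <= t <= 1 ->
     (forall e, 0 < e -> exists s, [/\ 0 <= s <= 1, `|s - t| < e & P s]) -> P t) ->
  forall t, 0 <= t <= 1 -> P t.
Proof.
move=> P0 Popen Pclosed.
pose S := [set t | 0 <= t <= 1 /\ forall s, 0 <= s <= t -> P s].
have S0 : S 0.
  split; first by rewrite lexx ler01.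
  by move=> s /andP[s0 s0']; have -> : s = 0 by lra.
have ubS : ubound S 1 by move=> t [/andP[]].
have hs : has_sup S by split; [exists 0|exists 1].
set T := sup S.
have T1 : T <= 1 by apply: ge_sup => //; exists 0.
have T0 : 0 <= T by apply: (ub_le_sup _ S0); exists 1.
have T01 : 0 <= T <= 1 by rewrite T0 T1.
have below s : 0 <= s < T -> P s.
  move=> /andP[s0 sT]; have := @sup_adherent _ S (T - s) _ hs.
  rewrite subr_gt0 => /(_ sT) [t [t01 ht]]; rewrite -/T => h.
  by apply: ht; rewrite s0 /=; lra.
have PT : P T.
  apply: Pclosed => // e e0; have [TT|TT] := eqVneq T 0.
    by exists 0; rewrite TT lexx ler01 subrr normr0.
  pose s := Num.max 0 (T - e / 2).
  have sT : 0 <= s < T.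
    by rewrite le_max lexx /= gt_max lt_neqAle eq_sym TT T0 /=; lra.
  exists s; split; last exact: below.
    by case/andP: sT => -> sT; lra.
  case/andP: sT => s0 sT; rewrite ltr0_norm; last by lra.
  have : T - e / 2 <= s by rewrite le_max lexx orbT.
  by lra.
have [e e0 he] := Popen T T01 PT.
have TE : T = 1.
  apply/eqP; rewrite eq_le T1 /= leNgt; apply/negP => T1'.
  pose t := Num.min 1 (T + e / 2).
  have tT : T < t by rewrite lt_min T1' /=; lra.
  have te : t <= T + e / 2 by rewrite ge_min lexx orbT.
  have t1 : t <= 1 by rewrite ge_min lexx.
  have : S t.
    split; first by rewrite t1; lra.
    move=> s /andP[s0 st]; have [sT|sT] := ltP s T; first by apply: below; rewrite s0.
    by apply: he; rewrite ?s0 /= ?ger0_norm; lra.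
  by move=> /(ub_le_sup (ex_intro _ _ ubS)); rewrite -/T; lra.
move=> t /andP[t0 t1]; have [tT|tT] := ltP t T; first by apply: below; rewrite t0.
by have -> : t = T by lra.
Qed.

End Compactness.

(** * Polynomials: growth, roots, maximum principle *)

Section PolyBasics.
Variable R : realType.
Local Notation C := R[i].
Implicit Types (p q s f : {poly C}) (z w a : C).

Lemma poly_bound p (B : R) : exists2 M, 0 <= M & forall z, cabs z <= B -> cabs p.[z] <= M.
Proof.
elim/poly_ind: p => [|p c [M M0 IH]].
  by exists 0 => // z _; rewrite horner0 cabs0.
have [B0|B0] := ltP B 0.
  by exists 0 => // z zB; have := cabs_ge0 z; lra.
exists (M * B + cabs c); first by rewrite addr_ge0 ?mulr_ge0 ?cabs_ge0.
move=> z zB; rewrite hornerMXaddC (le_trans (cabsD _ _)) // lerD2r cabsM.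
by rewrite ler_pM ?cabs_ge0 ?IH.
Qed.

Lemma poly_lip p (B : R) : exists2 L, 0 < L &
  forall z w, cabs z <= B -> cabs w <= B -> cabs (p.[z] - p.[w]) <= L * cabs (z - w).
Proof.
elim/poly_ind: p => [|p c [L L0 IH]].
  by exists 1 => // z w _ _; rewrite !horner0 subrr cabs0 mul1r cabs_ge0.
have [B0|B0] := ltP B 0.
  by exists 1 => // z w zB; have := cabs_ge0 z; lra.
have [M M0 hM] := poly_bound p B.
exists (M + L * B + 1); first by rewrite ltr_wpDl // addr_ge0 // mulr_ge0 // ltW.
move=> z w zB wB; rewrite !hornerMXaddC.
have -> : p.[z] * z + c - (p.[w] * w + c) = p.[z] * (z - w) + (p.[z] - p.[w]) * w.
  by ring.
apply: (le_trans (cabsD _ _)); rewrite !cabsM.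
have h1 : cabs p.[z] * cabs (z - w) <= M * cabs (z - w).
  by rewrite ler_wpM2r ?cabs_ge0 // hM.
have h2 : cabs (p.[z] - p.[w]) * cabs w <= L * cabs (z - w) * B.
  by rewrite ler_pM ?cabs_ge0 // IH.
have h3 := cabs_ge0 (z - w); nra.
Qed.

Lemma poly_cont p a (e : R) : 0 < e -> exists2 d, 0 < d &
  forall z, cabs (z - a) < d -> cabs (p.[z] - p.[a]) < e.
Proof.
move=> e0; have [L L0 hL] := poly_lip p (cabs a + 1).
exists (Num.min 1 (e / L)); first by rewrite lt_min ltr01 divr_gt0.
move=> z; rewrite lt_min => /andP[z1 zL].
have za : cabs z <= cabs a + 1 by have := cabs_ub z a; lra.
apply: (le_lt_trans (hL _ _ za _)); first by lra.
by rewrite mulrC -ltr_pdivlMr.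
Qed.

Lemma poly_growth p n : size p = n.+1 -> exists2 c, 0 < c &
  exists2 T, 1 <= T & forall z, T <= cabs z -> c * cabs z ^+ n <= cabs p.[z].
Proof.
elim/poly_ind: p n => [|p c IH] n; first by rewrite size_poly0.
have [->|p0] := eqVneq p 0.
  rewrite mul0r add0r size_polyC; case: eqVneq => // c0 [<-].
  exists (cabs c); first by rewrite cabs_gt0.
  by exists 1 => // z _; rewrite expr0 mulr1 hornerC.
rewrite size_MXaddC (negbTE p0) /= => -[hp].
case: n hp => [|n] hp; first by move/eqP: hp; rewrite size_poly_eq0 (negbTE p0).
have [d d0 [T T1 hT]] := IH _ hp.
exists (d / 2); first by rewrite divr_gt0.
exists (Num.max T (2 * cabs c / d)); first by rewrite le_max T1.
move=> z; rewrite ge_max => /andP[zT]; rewrite ler_pdivrMr // => zc.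
have z1 : 1 <= cabs z by exact: le_trans zT.
rewrite hornerMXaddC.
have h1 : d * cabs z ^+ n * cabs z <= cabs (p.[z] * z).
  by rewrite cabsM ler_wpM2r ?cabs_ge0 // hT.
have h2 : cabs z <= cabs z ^+ n * cabs z.
  by rewrite ler_peMl ?cabs_ge0 // exprn_ege1.
have := cabs_lb (p.[z] * z) (- c); rewrite opprK cabsN => h3.
rewrite exprSr; have : d * cabs z <= d * (cabs z ^+ n * cabs z) by rewrite ler_pM2l.
lra.
Qed.

Lemma poly_roots p n : size p = n.+1 -> exists r : seq C,
  [/\ p = lead_coef p *: \prod_(z <- r) ('X - z%:P), size r = n &
   forall z, z \in r -> root p z].
Proof.
move=> hp; have [r hr] := closed_field_poly_normal p.
exists r; split=> //.
  have l0 : lead_coef p != 0 by rewrite lead_coef_eq0 -size_poly_eq0 hp.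
  by move: hp; rewrite hr size_scale // size_prod_XsubC => -[].
move=> z zr; rewrite hr rootE hornerZ.
have := root_prod_XsubC r z; rewrite zr => /rootP ->; by rewrite mulr0.
Qed.

(** If all n roots were at distance at least e from a, the factorization would give |p(a)| >=
    |lead_coef p| e ^ n. *)
Lemma near_root p n a (e : R) : size p = n.+1 -> 0 <= e ->
  cabs p.[a] < cabs (lead_coef p) * e ^+ n -> exists2 r, root p r & cabs (a - r) < e.
Proof.
move=> hp e0; have [r [-> sr hr]] := poly_roots hp.
have [/hasP[z zr hz] _|/hasPn no] := boolP (has (fun z => cabs (a - z) < e) r).
  by exists z => //; rewrite rootE hornerZ; have := root_prod_XsubC r z;
     rewrite zr => /rootP ->; rewrite mulr0.
rewrite lead_coefZ (monicP (monic_prod_XsubC _ _ _)) mulr1 hornerZ cabsM.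
rewrite horner_prod cabs_prod ltNge ler_wpM2l ?cabs_ge0 // -sr {sr hr}.
elim: r no => [|z r IH] no; first by rewrite big_nil expr0.
rewrite big_cons hornerXsubC /= exprS ler_pM ?exprn_ge0 //.
  by have := no z (mem_head _ _); rewrite -leNgt.
by apply: IH => y yr; apply: no; rewrite in_cons yr orbT.
Qed.

(** The logarithmic derivative p'(a) / p(a) is the sum of 1 / (a - z) over the n roots z, so roots
    all at distance at least mu would give mu |p'(a)| <= n |p(a)|. The induction on the list of
    roots proves this without dividing. *)
Lemma near_root_deriv p n a (mu : R) : size p = n.+1 ->
  n%:R * cabs p.[a] < mu * cabs p^`().[a] -> exists2 r, root p r & cabs (a - r) < mu.
Proof.
move=> hp; have [r [-> sr hr]] := poly_roots hp.
have [/hasP[z zr hz] _|/hasPn no] := boolP (has (fun z => cabs (a - z) < mu) r).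
  by exists z => //; rewrite rootE hornerZ; have := root_prod_XsubC r z;
     rewrite zr => /rootP ->; rewrite mulr0.
rewrite derivZ !hornerZ !cabsM mulrCA (mulrCA mu) ltNge ler_wpM2l ?cabs_ge0 //.
rewrite -sr {sr hr}.
elim: r no => [|z r IH] no.
  by rewrite big_nil derivC horner0 cabs0 mulr0 mul0r.
rewrite !big_cons derivM derivXsubC mul1r hornerD hornerM hornerM !hornerXsubC.
set P := \prod_(_ <- _) _; rewrite cabsM.
have h := no z (mem_head _ _); rewrite -leNgt in h.
have {}IH : mu * cabs P^`().[a] <= (size r)%:R * cabs P.[a].
  by apply: IH => y yr; apply: no; rewrite in_cons yr orbT.
have [m0|m0] := ltP mu 0.
  by rewrite (@le_trans _ _ 0) // ?mulr_ge0 ?cabs_ge0 // nmulr_rle0 // cabs_ge0.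
have := cabsD P.[a] ((a - z) * P^`().[a]); rewrite cabsM => h1.
rewrite /= -natr1.
have := cabs_ge0 P.[a]; have := cabs_ge0 (a - z) => h2 h3.
have h4 : mu * cabs P.[a] <= cabs (a - z) * cabs P.[a] by rewrite ler_wpM2r.
have h5 := ler_wpM2l h2 IH; have h6 := ler_wpM2l m0 h1; lra.
Qed.

(** Only discs about 0 are needed. If |z| < |c| for every root z, each term of c p'(c) / p(c) = sum
    of c / (c - z) has real part above 1 / 2, so p'(c) cannot vanish. *)
Lemma gauss_lucas p n (rho : R) : size p = n.+2 ->
  (forall z, root p z -> cabs z < rho) -> forall c, root p^`() c -> cabs c < rho.
Proof.
move=> hp hroot c; have [r [hr sr rr]] := poly_roots hp.
have l0 : lead_coef p != 0 by rewrite lead_coef_eq0 -size_poly_eq0 hp.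
rewrite ltNge; apply: contraL => rhoc.
have {}rr z : z \in r -> cabs z < cabs c.
  by move=> /rr /hroot h; exact: lt_le_trans rhoc.
rewrite rootE hr derivZ hornerZ mulf_eq0 (negbTE l0) /=.
pose P := \prod_(z <- r) ('X - z%:P).
(* The strict inequality fails for the empty product only, which is where the induction starts. *)
suff : P.[c] != 0 /\ n.+1%:R / 2 < complex.Re (c * P^`().[c] / P.[c]) \/ r = [::].
  case=> [[P0 h]|r0]; last by rewrite r0 in sr.
  apply/eqP => h0; move: h; rewrite -/P in h0; rewrite h0 mulr0 mul0r /=.
  have : (0 : R) <= n.+1%:R by rewrite ler0n.
  lra.
rewrite -sr /P {P sr hr}; elim: r rr => [|z r IH] rr; [by right|left].
rewrite !big_cons derivM derivXsubC mul1r hornerD hornerM hornerM !hornerXsubC.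
set P := \prod_(_ <- _) _ in IH *.
have hz := rr z (mem_head _ _).
have cz0 : c - z != 0.
  by rewrite subr_eq0; apply: contraTneq hz => ->; rewrite ltxx.
have half : 1 / 2 < complex.Re (c / (c - z)).
  have hc2 : cabs z ^+ 2 < cabs c ^+ 2 by rewrite ltr_pXn2r ?nnegrE ?cabs_ge0.
  have : 0 < cabs (c - z) ^+ 2 by rewrite exprn_gt0 // cabs_gt0.
  move: hc2; case: (c) (z) => [c1 c2] [z1 z2] /=; rewrite !cabs_sqr => hc2 hp0.
  set D := _ + _ in hp0.
  rewrite -/D; have -> : c1 * ((c1 - z1) / D) - c2 * - ((c2 - z2) / D) =
     (c1 * (c1 - z1) + c2 * (c2 - z2)) / D by field; rewrite gt_eqF.
  by rewrite ltr_pdivlMr // /D; lra.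
case: IH => [y yr||r0]; first by apply: rr; rewrite in_cons yr orbT.
  move=> [P0 h]; split; first by rewrite mulf_neq0.
  have -> : c * (P.[c] + (c - z) * P^`().[c]) / ((c - z) * P.[c]) =
     c / (c - z) + c * P^`().[c] / P.[c] by field; rewrite cz0 P0.
  rewrite raddfD /= -natr1; lra.
subst r; rewrite /P big_nil derivC !hornerC ?horner0 ?(mulr0, addr0, mulr1, mul0r, oner_neq0); split=> //.
Qed.

(** The maximum principle for this difference quotient replaces the Cauchy integral formula
    below. *)
Lemma poly_quot f a : exists2 q, f = q * ('X - a%:P) + f.[a]%:P & q.[a] = f^`().[a].
Proof.
have : root (f - f.[a]%:P) a by rewrite rootE hornerD hornerN hornerC subrr.
move=> /factor_theorem[q hq]; exists q.
  by rewrite -hq subrK.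
have -> : f = q * ('X - a%:P) + f.[a]%:P by rewrite -hq subrK.
rewrite derivD derivM derivC derivXsubC mulr1 addr0 hornerD hornerM.
by rewrite hornerXsubC subrr mulr0 add0r.
Qed.

End PolyBasics.

(** * Maximum modulus principle for quotients of polynomials *)

Section MaxModulus.
Variable R : realType.
Local Notation C := R[i].
Implicit Types (p q s f v : {poly C}) (z w a x : C) (X Bd : C -> Prop).

Definition eclosed X := forall z,
  (forall e : R, 0 < e -> exists2 x, X x & cabs (x - z) < e) -> X z.

Definition eopen X := forall z, X z ->
  exists2 e : R, 0 < e & forall w, cabs (w - z) < e -> X w.

Lemma compact_seq X (B : R) (u : nat -> C) : eclosed X ->
  (forall x, X x -> cabs x <= B) -> (forall n, X (u n)) ->
  exists2 c, X c & forall e, 0 < e -> forall N, exists2 n, (N <= n)%N & cabs (u n - c) < e.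
Proof.
move=> Xc XB Xu; have [c hc] := @cluster_pt R u B (fun n => XB _ (Xu n)).
by exists c => //; apply: Xc => e e0; have [n _ h] := hc e e0 0%N; exists (u n).
Qed.

Lemma inv_natS_lt (e : R) : 0 < e -> exists N, forall n, (N <= n)%N -> n.+1%:R^-1 < e.
Proof.
move=> e0; exists (Num.truncn e^-1) => n hn.
rewrite invf_plt ?posrE ?ltr0Sn //.
by apply: (lt_le_trans (truncnS_gt _)); rewrite ler_nat.
Qed.

Lemma compact_max X (B : R) (phi : C -> R) x0 : eclosed X ->
  (forall x, X x -> cabs x <= B) -> X x0 ->
  (forall x, X x -> forall e, 0 < e -> exists2 d, 0 < d &
     forall y, X y -> cabs (y - x) < d -> `|phi y - phi x| < e) ->
  exists2 x, X x & forall y, X y -> phi y <= phi x.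
Proof.
move=> Xc XB Xx0 cont; pose S := [set phi x | x in [set x | X x]].
have hub : has_ubound S.
  apply: contrapT => /forallNP h.
  have {}h n : exists2 x, X x & n%:R < phi x.
    apply: contrapT => hn; apply: (h n%:R) => _ [x Xx <-].
    by rewrite leNgt; apply/negP => hx; apply: hn; exists x.
  pose u n := sval (cid2 (h n)).
  have Xu n : X (u n) by rewrite /u; case: cid2.
  have uu n : n%:R < phi (u n) by rewrite /u; case: cid2.
  have [c Xc' hc] := compact_seq Xc XB Xu.
  have [d d0 hd] := cont c Xc' 1 ltr01.
  have [n nN hn] := hc d d0 (Num.truncn (phi c + 1)).+1.
  have := hd _ (Xu n) hn; rewrite ltr_norml => /andP[_].
  have := uu n; have : phi c + 1 < n%:R.
    by apply: (lt_le_trans (truncnS_gt _)); rewrite ler_nat.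
  lra.
have hs : has_sup S by split=> //; exists (phi x0); exists x0.
have h n : exists2 x, X x & sup S - n.+1%:R^-1 < phi x.
  have [|_ [x Xx <-] h] := @sup_adherent _ S n.+1%:R^-1 _ hs.
    by rewrite invr_gt0 ltr0Sn.
  by exists x.
pose u n := sval (cid2 (h n)).
have Xu n : X (u n) by rewrite /u; case: cid2.
have uu n : sup S - n.+1%:R^-1 < phi (u n) by rewrite /u; case: cid2.
have [c Xc' hc] := compact_seq Xc XB Xu.
exists c => // y Xy; apply: le_trans (_ : sup S <= _).
  by apply: ub_le_sup => //; exists y.
rewrite leNgt; apply/negP => lt; pose e := (sup S - phi c) / 2.
have e0 : 0 < e by rewrite divr_gt0 // subr_gt0.
have [d d0 hd] := cont c Xc' e e0.
have [N hN] := inv_natS_lt e0.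
have [n nN hn] := hc d d0 N.
have := hd _ (Xu n) hn; rewrite ltr_norml => /andP[_].
have := uu n; have := hN n nN; rewrite /e; move: (n.+1%:R^-1) => i; lra.
Qed.

(* Near x write s = c q + (z - x)^k v; moving in a direction where the second
   term is a positive multiple of the first increases |s / q|. *)
Lemma local_max s q x (e : R) : 0 < e -> q.[x] != 0 ->
  (forall z, cabs (z - x) < e -> cabs s.[z] <= cabs q.[z]) ->
  cabs s.[x] = cabs q.[x] -> exists2 c, cabs c = 1 & s = c *: q.
Proof.
move=> e0 qx0 hsq hx; pose c := s.[x] / q.[x].
have c1 : cabs c = 1 by rewrite cabsM cabsV hx divff // cabs_eq0.
exists c => //; apply/eqP; rewrite -subr_eq0; apply: contraT => u0.
have [k [v]] := multiplicity_XsubC (s - c *: q) x.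
rewrite u0 /= => vx0 hu.
have k0 : (0 < k)%N.
  rewrite lt0n; apply: contra vx0 => /eqP hk; move: hu; rewrite hk expr0 mulr1 => <-.
  by rewrite rootE hornerD hornerN hornerZ /c divfK // subrr.
rewrite rootE in vx0; clearbody c.
pose zeta := k.-root (c * q.[x] / v.[x]).
have hz : zeta ^+ k = c * q.[x] / v.[x] by rewrite rootCK.
(* These tolerances put A = q(z) / q(x) and E = v(z) / v(x) within 1 / 4 of 1, so that |E / A - 1| <
   1 and E / A has positive real part. *)
have nq : 0 < cabs q.[x] / 4 by rewrite divr_gt0 // cabs_gt0.
have nv : 0 < cabs v.[x] / 4 by rewrite divr_gt0 // cabs_gt0.
have [d1 d10 hd1] := poly_cont q x nq.
have [d2 d20 hd2] := poly_cont v x nv.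
have zp : 0 < cabs zeta + 1 by rewrite ltr_wpDl ?cabs_ge0.
pose t := Num.min e (Num.min d1 d2) / (cabs zeta + 1).
have t0 : 0 < t by rewrite divr_gt0 // !lt_min e0 d10.
pose z := x + t%:C * zeta.
have zxE : z - x = t%:C * zeta by rewrite /z [x + _]addrC addrK.
have zx : cabs (z - x) < Num.min e (Num.min d1 d2).
  rewrite zxE cabs_scal ?ltW // /t -mulrA gtr_pMr; last first.
    by rewrite !lt_min e0 d10.
  by rewrite mulrC ltr_pdivrMr // mul1r; lra.
move: zx; rewrite !lt_min => /and3P[ze /hd1 zd1 /hd2 zd2].
set A := q.[z] / q.[x]; set E := v.[z] / v.[x].
have hA : cabs (A - 1) <= 1 / 4.
  rewrite /A -[1](divff qx0) -mulrBl cabsM cabsV ler_pdivrMr ?cabs_gt0 //; lra.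
have hE : cabs (E - 1) <= 1 / 4.
  rewrite /E -[1](divff vx0) -mulrBl cabsM cabsV ler_pdivrMr ?cabs_gt0 //; lra.
have hs : s.[z] = c * q.[x] * (A + (t ^+ k)%:C * E).
  have -> : s = c *: q + v * ('X - x%:P) ^+ k by rewrite -hu addrC subrK.
  rewrite hornerD hornerZ hornerM horner_exp hornerXsubC zxE.
  rewrite exprMn hz rmorphXn /= /A /E; field; by rewrite qx0 vx0.
have hq : q.[z] = q.[x] * A by rewrite /A mulrC divfK.
clearbody A E.
have := hsq z ze; rewrite hs {1}hq !cabsM c1 mul1r ler_pM2l ?cabs_gt0 //.
have cA : 3 / 4 <= cabs A.
  have := cabs_ub 1 A; rewrite cabs1 (cabsB 1); lra.
have A0 : A != 0 by rewrite -cabs_gt0; lra.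
have -> : A + (t ^+ k)%:C * E = A * (1 + (t ^+ k)%:C * (E / A)) by field.
rewrite cabsM -[leRHS]mulr1 ler_pM2l ?cabs_gt0 //.
have := cabs_Re (1 + (t ^+ k)%:C * (E / A)).
have hEA : cabs (E / A - 1) < 1.
  rewrite -[1](divff A0) -mulrBl cabsM cabsV ltr_pdivrMr ?cabs_gt0 // mul1r.
  have := cabs_tri 1 E A; rewrite (cabsB 1); lra.
have hre : 0 < complex.Re (E / A).
  have := le_lt_trans (cabs_Re _) hEA; rewrite raddfB /= ltr_norml => /andP[]; lra.
have -> : complex.Re (1 + (t ^+ k)%:C * (E / A)) = 1 + t ^+ k * complex.Re (E / A).
  by case: (E / A) => a b /=; rewrite mul0r subr0.
have : 0 < t ^+ k * complex.Re (E / A) by rewrite mulr_gt0 ?exprn_gt0.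
by move=> h; rewrite ger0_norm; lra.
Qed.

(** [Bd] need not be the topological boundary, which suits the sheets of inverse branches. If the
    maximum M1 of |s / q| exceeded M, a rightmost point where it is attained would be interior;
    there [local_max] makes s / q constant, so the maximum would also be attained further to the
    right. *)
Lemma max_modulus X Bd (B M : R) s q : eclosed X ->
  (forall x, X x -> cabs x <= B) ->
  (forall x, X x -> Bd x \/ exists2 e, 0 < e & forall z, cabs (z - x) < e -> X z) ->
  (forall x, X x -> q.[x] != 0) -> 0 <= M ->
  (forall x, X x -> Bd x -> cabs s.[x] <= M * cabs q.[x]) ->
  forall x, X x -> cabs s.[x] <= M * cabs q.[x].
Proof.
move=> Xc XB Xint q0 M0 hBd x0 Xx0; rewrite leNgt; apply/negP => hx0.
pose phi x := cabs s.[x] / cabs q.[x].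
have cont x : X x -> forall e, 0 < e -> exists2 d, 0 < d &
     forall y, X y -> cabs (y - x) < d -> `|phi y - phi x| < e.
  move=> Xx e e0; have Q0 : 0 < cabs q.[x] by rewrite cabs_gt0 q0.
  pose Q := cabs q.[x]; pose S := cabs s.[x].
  have S0 : 0 <= S by exact: cabs_ge0.
  (* The numerator of phi y - phi x is then below e Q ^ 2 / 4, while its denominator exceeds Q ^ 2 /
     2. *)
  pose e1 := e * Q / 8; pose e2 := e * Q * Q / (8 * (S + 1)).
  have e10 : 0 < e1 by rewrite divr_gt0 // mulr_gt0.
  have e20 : 0 < e2.
    by rewrite divr_gt0 ?mulr_gt0 // ltr_wpDl.
  have Q20 : 0 < Q / 2 by rewrite divr_gt0.
  have [d1 d10 hd1] := poly_cont s x e10.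
  have [d2 d20 hd2] := poly_cont q x e20.
  have [d3 d30 hd3] := poly_cont q x Q20.
  exists (Num.min d1 (Num.min d2 d3)); first by rewrite !lt_min d10 d20.
  move=> y Xy; rewrite !lt_min => /and3P[/hd1 h1 /hd2 h2 /hd3 h3].
  have Qy : Q / 2 < cabs q.[y].
    by have := cabs_ub q.[x] q.[y]; rewrite (cabsB q.[x]) /Q in h3 *; lra.
  have hS : `|cabs s.[y] - S| < e1.
    have := cabs_ub s.[y] s.[x]; have := cabs_ub s.[x] s.[y].
    rewrite (cabsB s.[x]) ltr_norml /S => *; apply/andP; split; lra.
  have hQ : `|cabs q.[y] - Q| < e2.
    have := cabs_ub q.[y] q.[x]; have := cabs_ub q.[x] q.[y].
    rewrite (cabsB q.[x]) ltr_norml /Q => *; apply/andP; split; lra.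
  have -> : phi y - phi x = ((cabs s.[y] - S) * Q - S * (cabs q.[y] - Q)) / (cabs q.[y] * Q).
    by rewrite /phi -/S -/Q; field; rewrite !gt_eqF // (lt_trans _ Qy).
  have Qy0 : 0 < cabs q.[y] by rewrite (lt_trans _ Qy).
  rewrite normrM normfV [`|_ * Q|]gtr0_norm ?mulr_gt0 // ltr_pdivrMr ?mulr_gt0 //.
  apply: (le_lt_trans (ler_normB _ _)); rewrite !normrM (ger0_norm S0) [`|Q|]gtr0_norm //.
  have h4 : `|cabs s.[y] - S| * Q < e1 * Q by rewrite ltr_pM2r.
  have h5 : S * `|cabs q.[y] - Q| <= (S + 1) * e2.
    by rewrite ler_pM // ?ltW // ltrDl.
  have h6 : e * (Q / 2 * Q) < e * (cabs q.[y] * Q) by rewrite ltr_pM2l // ltr_pM2r.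
  have h7 : (S + 1) * e2 = e * Q * Q / 8 by rewrite /e2; field; rewrite gt_eqF // ltr_wpDl.
  have h8 : 0 < e * Q * Q by rewrite !mulr_gt0.
  rewrite h7 in h5; move: h4; rewrite /e1; lra.
have [x1 Xx1 hx1] := compact_max Xc XB Xx0 cont.
pose M1 := phi x1.
have MM1 : M < M1.
  by apply: lt_le_trans (hx1 _ Xx0); rewrite ltr_pdivlMr // cabs_gt0 q0.
pose Y x := X x /\ phi x = M1.
have Yc : eclosed Y.
  move=> z hz; have Xz : X z by apply: Xc => e /hz[x [Xx _] h]; exists x.
  split=> //; apply/eqP; rewrite -subr_eq0 -normr_eq0; apply: contraT => h.
  have e0 : 0 < `|phi z - M1| by rewrite lt_def h normr_ge0.
  have [d d0 hd] := cont z Xz _ e0.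
  have [y [Xy yM] yd] := hz d d0.
  by have := hd y Xy yd; rewrite yM distrC ltxx.
have YB x : Y x -> cabs x <= B by case=> /XB.
have contRe x : Y x -> forall e : R, 0 < e -> exists2 d, 0 < d &
     forall y, Y y -> cabs (y - x) < d -> `|complex.Re y - complex.Re x| < e.
  move=> _ e e0; exists e => // y _; rewrite -raddfB; apply: le_lt_trans.
  exact: cabs_Re.
have [x [Xx xM] hx] := compact_max Yc YB (conj Xx1 erefl : Y x1) contRe.
have sxM : cabs s.[x] = M1 * cabs q.[x].
  by rewrite -xM /phi divfK // cabs_eq0 q0.
have M10 : 0 < M1 by exact: le_lt_trans MM1.
case: (Xint x Xx) => [Bx|[e e0 he]].
  have := hBd x Xx Bx; rewrite sxM ler_pM2r ?cabs_gt0 ?q0 //; lra.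
pose q1 := M1%:C *: q.
have q1E z : cabs q1.[z] = M1 * cabs q.[z].
  by rewrite hornerZ cabs_scal // ltW.
have [|z zx||c c1 hs] := @local_max s q1 x e e0.
- by rewrite -cabs_eq0 q1E mulf_neq0 ?cabs_eq0 ?q0 // gt_eqF.
- rewrite q1E -ler_pdivrMr ?cabs_gt0 ?q0 //; first exact: (hx1 _ (he z zx)).
  exact: he.
- by rewrite sxM q1E.
pose y := x + (e / 2)%:C.
have Xy : X y.
  apply: he; rewrite /y [x + _]addrC addrK cabsR ger0_norm; lra.
have : complex.Re y <= complex.Re x.
  apply: hx; split=> //; rewrite /phi hs hornerZ cabsM c1 mul1r q1E mulfK //.
  by rewrite cabs_eq0 q0.
by rewrite /y raddfD /=; lra.
Qed.

End MaxModulus.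

(** * Cauchy estimates, three circles theorem, quantitative open mapping *)

Section DiscEstimates.
Variable R : realType.
Local Notation C := R[i].
Implicit Types (p q s f : {poly C}) (z w a x : C) (r rho M m c e d : R).

Lemma eclosed_disc a r : eclosed (fun z => cabs (z - a) <= r).
Proof.
move=> z hz; rewrite leNgt; apply/negP => lt.
have [x xr xz] := hz (cabs (z - a) - r) ltac:(by rewrite subr_gt0).
by have := cabs_tri x z a; rewrite (cabsB z x); lra.
Qed.

Lemma max_disc_rat s q a r M : 0 <= M ->
  (forall z, cabs (z - a) <= r -> q.[z] != 0) ->
  (forall z, cabs (z - a) = r -> cabs s.[z] <= M * cabs q.[z]) ->
  forall z, cabs (z - a) <= r -> cabs s.[z] <= M * cabs q.[z].
Proof.
move=> M0 q0 hb; pose Bd z := cabs (z - a) = r.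
apply: (@max_modulus _ _ Bd (cabs a + r)) => //; first exact: eclosed_disc.
- by move=> x xr; have := cabs_ub x a; lra.
- move=> x; rewrite le_eqVlt => /orP[/eqP xr|xr]; [by left|right].
  exists (r - cabs (x - a)); first by rewrite subr_gt0.
  by move=> z hz; have := cabs_tri x z a; lra.
- by move=> x _; exact: hb.
Qed.

Lemma max_disc f a r M : 0 <= M ->
  (forall z, cabs (z - a) = r -> cabs f.[z] <= M) ->
  forall z, cabs (z - a) <= r -> cabs f.[z] <= M.
Proof.
move=> M0 hb z zr; have := @max_disc_rat f 1 a r M M0 _ _ z zr.
rewrite !hornerC cabs1 mulr1; apply => [w _|w wr].
  by rewrite hornerC oner_neq0.
by rewrite hornerC cabs1 mulr1 hb.
Qed.

Lemma quot_bound f q a r M : 0 < r -> f = q * ('X - a%:P) + f.[a]%:P ->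
  (forall z, cabs (z - a) <= r -> cabs f.[z] <= M) ->
  forall z, cabs (z - a) <= r -> cabs q.[z] <= 2 * M / r.
Proof.
move=> r0 hq hM.
have M0 : 0 <= M by apply: le_trans (hM a _); rewrite ?cabs_ge0 // subrr cabs0 ltW.
apply: max_disc => [|z zr]; first by rewrite divr_ge0 ?mulr_ge0 // ltW.
have -> : cabs q.[z] = cabs (f.[z] - f.[a]) / r.
  rewrite {1}hq hornerD hornerM hornerXsubC hornerC addrK cabsM zr mulfK //.
  by rewrite gt_eqF.
rewrite ler_pM2r ?invr_gt0 //.
have := cabsD f.[z] (- f.[a]); rewrite cabsN => h.
have := hM z _; have := hM a _; rewrite subrr cabs0 zr lexx ltW // => /(_ isT) h1 /(_ isT) h2.
lra.
Qed.

Lemma cauchy_lip f a r M z : 0 < r ->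
  (forall z, cabs (z - a) <= r -> cabs f.[z] <= M) -> cabs (z - a) <= r ->
  cabs (f.[z] - f.[a]) <= 2 * M / r * cabs (z - a).
Proof.
move=> r0 hM zr; have [q hq _] := poly_quot f a.
rewrite {1}hq hornerD hornerM hornerXsubC hornerC addrK cabsM.
by rewrite ler_wpM2r ?cabs_ge0 // (quot_bound r0 hq hM).
Qed.

Lemma cauchy_deriv f a r M : 0 < r ->
  (forall z, cabs (z - a) <= r -> cabs f.[z] <= M) -> cabs f^`().[a] <= 2 * M / r.
Proof.
move=> r0 hM; have [q hq <-] := poly_quot f a.
by apply: (quot_bound r0 hq hM); rewrite subrr cabs0 ltW.
Qed.

Lemma cauchy_taylor f a r M z : 0 < r ->
  (forall z, cabs (z - a) <= r -> cabs f.[z] <= M) -> cabs (z - a) <= r ->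
  cabs (f.[z] - f.[a] - f^`().[a] * (z - a)) <= 4 * M / r ^+ 2 * cabs (z - a) ^+ 2.
Proof.
move=> r0 hM zr; have [q hq qa] := poly_quot f a.
have := cauchy_lip r0 (quot_bound r0 hq hM) zr.
have -> : f.[z] - f.[a] - f^`().[a] * (z - a) = (q.[z] - q.[a]) * (z - a).
  rewrite -qa {1}hq hornerD hornerM hornerXsubC hornerC; ring.
move=> h; rewrite cabsM expr2 mulrA ler_wpM2r ?cabs_ge0 //.
by apply: (le_trans h); rewrite le_eqVlt; apply/orP; left; apply/eqP; field; rewrite gt_eqF.
Qed.

Lemma lip_disc f a r M z w : 0 < r ->
  (forall z, cabs (z - a) <= r -> cabs f.[z] <= M) ->
  cabs (z - a) <= r / 4 -> cabs (w - a) <= r / 4 ->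
  cabs (f.[z] - f.[w]) <= 4 * M / r * cabs (z - w).
Proof.
move=> r0 hM za wa.
have -> : 4 * M / r = 2 * M / (r / 2) by field; rewrite gt_eqF.
apply: cauchy_lip; first by rewrite divr_gt0.
  by move=> y yw; apply: hM; have := cabs_tri w y a; lra.
by have := cabs_tri a z w; rewrite (cabsB a); lra.
Qed.

(** Without a root in the disc, the maximum principle for 1 / f would give |f(a)| >= m. *)
Lemma min_modulus f a r m : 0 < r ->
  (forall z, cabs (z - a) = r -> m <= cabs f.[z]) -> cabs f.[a] < m ->
  exists2 z, root f z & cabs (z - a) < r.
Proof.
move=> r0 hm fa; have m0 : 0 < m by apply: le_lt_trans fa; exact: cabs_ge0.
apply: contrapT => no.
have f0 z : cabs (z - a) <= r -> f.[z] != 0.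
  rewrite le_eqVlt => /orP[/eqP zr|zr].
    by rewrite -cabs_gt0 (lt_le_trans m0) // hm.
  by apply/negP => fz; apply: no; exists z.
have := @max_disc_rat 1 f a r m^-1 _ f0 _ a.
rewrite subrr cabs0 hornerC cabs1 invr_ge0 => /(_ (ltW m0)).
move=> /(_ _ (ltW r0)) h; have {h} : 1 <= m^-1 * cabs f.[a].
  apply: h => z zr; rewrite hornerC cabs1 mulrC ler_pdivlMr // mul1r.
  exact: hm.
by rewrite mulrC ler_pdivlMr // mul1r => h; lra.
Qed.

(* With an integral exponent k the comparison function (z - a)^k is a polynomial. *)
Lemma three_circles f a r r' (d M : R) k : 0 < r -> 0 <= d -> 0 <= M ->
  (forall z, cabs (z - a) = r -> cabs f.[z] <= d) ->
  (forall z, cabs (z - a) = r' -> cabs f.[z] <= M) ->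
  forall z, r <= cabs (z - a) <= r' ->
    cabs f.[z] <= (d / r ^+ k + M / r' ^+ k) * cabs (z - a) ^+ k.
Proof.
move=> r0 d0 M0 hr hr'; have [rr'|rr'] := leP r r'; last first.
  by move=> z /andP[h1 h2]; lra.
have r'0 : 0 < r' by lra.
pose X z := r <= cabs (z - a) <= r'.
pose q : {poly C} := ('X - a%:P) ^+ k.
have qE z : cabs q.[z] = cabs (z - a) ^+ k by rewrite horner_exp hornerXsubC cabsX.
have D0 : 0 <= d / r ^+ k by rewrite divr_ge0 // exprn_ge0 // ltW.
have D0' : 0 <= M / r' ^+ k by rewrite divr_ge0 // exprn_ge0 // ltW.
have main : forall z, X z -> cabs f.[z] <= (d / r ^+ k + M / r' ^+ k) * cabs q.[z].
  apply: (@max_modulus _ _ (fun z => cabs (z - a) = r \/ cabs (z - a) = r') (cabs a + r')).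
  - move=> z hz; apply/andP; split; last first.
      by apply: (@eclosed_disc a r' z) => e /hz[x /andP[_ h] h']; exists x.
    rewrite leNgt; apply/negP => lt.
    have [x /andP[xr _] xz] := hz (r - cabs (z - a)) ltac:(by rewrite subr_gt0).
    by have := cabs_tri z x a; lra.
  - by move=> x /andP[_]; have := cabs_ub x a; lra.
  - move=> x /andP[]; rewrite [r <= _]le_eqVlt => /orP[/eqP rx _|rx]; first by left; left.
    rewrite le_eqVlt => /orP[/eqP xr|xr]; first by left; right.
    right; exists (Num.min (cabs (x - a) - r) (r' - cabs (x - a))).
      by rewrite lt_min !subr_gt0 rx.
    move=> z; rewrite lt_min => /andP[h1 h2]; have h3 := cabs_tri x z a.
    have := cabs_tri z x a; rewrite (cabsB x z) => h4; apply/andP; split; lra.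
  - move=> x /andP[rx _]; rewrite -cabs_eq0 qE expf_neq0 // gt_eqF //; lra.
  - by rewrite addr_ge0.
  move=> x _ [xr|xr]; rewrite qE xr mulrDl.
    rewrite (le_trans (hr x xr)) // divfK ?expf_neq0 ?gt_eqF // lerDl.
    by rewrite mulr_ge0 // exprn_ge0 // ltW.
  rewrite (le_trans (hr' x xr)) // divfK ?expf_neq0 ?gt_eqF // lerDr.
  by rewrite mulr_ge0 // exprn_ge0 // ltW.
by move=> z hz; rewrite -qE main.
Qed.

Lemma small_pow (x e : R) : 0 <= x < 1 -> 0 < e -> exists k, x ^+ k < e.
Proof.
move=> /andP[x0 x1] e0.
have : (fun n => x ^+ n) @ \oo --> (0 : R).
  by apply: cvg_expr; rewrite ger0_norm.
move/cvgrPdist_lt => /(_ e e0) [N _ /(_ N (leqnn N))] /=.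
by rewrite sub0r normrN ger0_norm ?exprn_ge0 // => h; exists N.
Qed.

(** The order of choice matters: k first, making the outer term small because rho < r', and then d,
    making the inner term small in spite of the factor (rho / r) ^ k. *)
Lemma two_constants (r r' rho M e : R) : 0 < r -> 0 < rho < r' -> 0 <= M -> 0 < e ->
  exists k, exists2 d, 0 < d & forall t, 0 <= t <= rho ->
    (d / r ^+ k + M / r' ^+ k) * t ^+ k <= e.
Proof.
move=> r0 /andP[rho0 rhor'] M0 e0; have r'0 : 0 < r' by lra.
have M1 : 0 < M + 1 by lra.
have [||k hk] := @small_pow (rho / r') (e / 2 / (M + 1)) _ _.
- by rewrite divr_ge0 ?ltW //= ltr_pdivrMr // mul1r.
- by rewrite !divr_gt0.
exists k, (e / 2 * (r / rho) ^+ k); first by rewrite mulr_gt0 ?exprn_gt0 ?divr_gt0.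
move=> t /andP[t0 trho]; have tk : t ^+ k <= rho ^+ k by rewrite lerXn2r ?nnegrE // ltW.
apply: (@le_trans _ _ ((e / 2 * (r / rho) ^+ k / r ^+ k + M / r' ^+ k) * rho ^+ k)).
  rewrite ler_wpM2l // addr_ge0 ?divr_ge0 ?mulr_ge0 ?exprn_ge0 ?divr_ge0 //; lra.
rewrite mulrDl.
have -> : e / 2 * (r / rho) ^+ k / r ^+ k * rho ^+ k = e / 2.
  by rewrite expr_div_n; field; rewrite !expf_neq0 // gt_eqF.
have : M / r' ^+ k * rho ^+ k <= e / 2; last by lra.
have -> : M / r' ^+ k * rho ^+ k = M * (rho / r') ^+ k.
  by rewrite expr_div_n; field; rewrite !expf_neq0 // gt_eqF.
have h : (rho / r') ^+ k * (M + 1) < e / 2 by rewrite -ltr_pdivlMr.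
have : 0 <= (rho / r') ^+ k by rewrite exprn_ge0 // divr_ge0 // ltW.
lra.
Qed.

(** The radii depend on the bounds only, not on f or a, so they serve infinitely many words at
    once. *)
Lemma open_image (M r c rho : R) : 0 < r -> 0 < c -> 0 < M -> 0 < rho ->
  exists r1 r2, [/\ 0 < r1, r1 <= rho, r1 <= r, 0 < r2 & forall f a,
    (forall z, cabs (z - a) <= r -> cabs f.[z] <= M) -> c <= cabs f^`().[a] ->
    forall w, cabs (w - f.[a]) < r2 -> exists2 z, f.[z] = w & cabs (z - a) < r1].
Proof.
(* The last bound makes the Taylor remainder on the circle of radius r1 at most half of the linear
   term. Hence |f - f(a)| >= c r1 / 2 there, and w may use up half of that. *)
move=> r0 c0 M0 rho0; pose r1 := Num.min rho (Num.min r (c * r ^+ 2 / (8 * M))).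
have r10 : 0 < r1 by rewrite !lt_min rho0 r0 divr_gt0 ?mulr_gt0 ?exprn_gt0.
have r1r : r1 <= r by rewrite !ge_min lexx orbT.
exists r1, (c * r1 / 4); split=> //; first by rewrite ge_min lexx.
  by rewrite divr_gt0 // mulr_gt0.
move=> f a fM hc w hw.
have [||z] := @min_modulus (f - w%:P) a r1 (c * r1 / 4) r10.
- move=> z zr; have zr' : cabs (z - a) <= r by rewrite zr.
  have := cauchy_taylor r0 fM zr'; rewrite zr => h.
  have h1 : 4 * M / r ^+ 2 * r1 ^+ 2 <= c * r1 / 2.
    have : r1 <= c * r ^+ 2 / (8 * M) by rewrite !ge_min lexx !orbT.
    rewrite ler_pdivlMr ?mulr_gt0 // => h1.
    rewrite mulrAC ler_pdivrMr ?exprn_gt0 //.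
    have := ler_wpM2l (ltW r10) h1; rewrite expr2; lra.
  have h2 : c * r1 <= cabs (f^`().[a] * (z - a)) by rewrite cabsM zr ler_pM2r.
  have := cabs_ub (f^`().[a] * (z - a)) (f.[z] - f.[a]); rewrite [cabs (_ - (_ - _))]cabsB => h3.
  have := cabs_ub (f.[z] - f.[a]) (f.[z] - w).
  have -> : f.[z] - f.[a] - (f.[z] - w) = w - f.[a] by ring.
  by rewrite hornerD hornerN hornerC; lra.
- by rewrite hornerD hornerN hornerC (cabsB _ w).
rewrite rootE hornerD hornerN hornerC subr_eq0 => /eqP zw za.
by exists z.
Qed.

End DiscEstimates.

(** * Inverse branches of polynomials *)

Section Lifting.
Variable R : realType.
Local Notation C := R[i].
Implicit Types (p q s f : {poly C}) (z w a x : C) (r rho M m c e d : R).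

Lemma preimage_bounded f n r : size f = n.+2 ->
  exists B, forall z, cabs f.[z] <= r -> cabs z <= B.
Proof.
move=> hf; have [c c0 [T T1 hT]] := poly_growth hf.
exists (T + `|r| / c) => z hz; rewrite leNgt; apply/negP => lt.
have rc : 0 <= `|r| / c by rewrite divr_ge0 // ltW.
have zT : T <= cabs z by lra.
have := hT z zT; have : cabs z <= cabs z ^+ n.+1.
  by rewrite exprS ler_peMr ?cabs_ge0 // exprn_ege1 //; lra.
have := ler_norm r; have : `|r| < c * cabs z.
  by rewrite mulrC -ltr_pdivrMr //; lra.
move=> h1 h2 h3; have := ler_wpM2l (ltW c0) h3; lra.
Qed.

Lemma size_subC f n w : size f = n.+2 -> size (f - w%:P) = n.+2.
Proof.
move=> hf; rewrite size_polyDl ?hf // size_polyN size_polyC; by case: (w != 0).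
Qed.

(* The last condition says that the image of t is open. *)
Definition disc_section f x r (t : C -> C) :=
  [/\ forall w, cabs (w - x) <= r -> f.[t w] = w,
   exists2 L, 0 < L & exists2 e, 0 < e & forall w w', cabs (w - x) <= r ->
     cabs (w' - x) <= r -> cabs (w - w') < e -> cabs (t w - t w') <= L * cabs (w - w') &
   exists2 e, 0 < e & forall w z, cabs (w - x) <= r -> cabs (f.[z] - x) <= r ->
     cabs (z - t w) < e -> t f.[z] = z].

(** Path lifting along all radii of the disc at once, in N.+1 equal steps: step i lifts the map w
    |-> x + i / (N + 1) (w - x), starting from the constant a. [near_root_deriv] moves each lift to
    the next one, and local injectivity of f at scale eta makes the new lift Lipschitz. *)
Lemma section_exists f n a rr r : size f = n.+2 -> 0 < r < rr ->
  (forall z, f^`().[z] = 0 -> rr <= cabs (f.[z] - f.[a])) ->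
  exists2 t, t f.[a] = a & disc_section f f.[a] r t.
Proof.
move=> hf /andP[r0 rrr] ncv; set x := f.[a].
pose Z z := cabs (f.[z] - x) <= r.
have Za : Z a by rewrite /Z subrr cabs0 ltW.
have [B hB] := preimage_bounded (cabs x + r) hf.
have ZB z : Z z -> cabs z <= B.
  by move=> Zz; apply: hB; have := cabs_ub f.[z] x; rewrite /Z in Zz; lra.
have Zc : eclosed Z.
  move=> z hz; rewrite /Z leNgt; apply/negP => lt.
  have [d d0 hd] := poly_cont f z (ltac:(by rewrite subr_gt0) : 0 < cabs (f.[z] - x) - r).
  have [y Zy yz] := hz d d0; have := hd y yz.
  have := cabs_tri f.[y] f.[z] x; rewrite (cabsB f.[z] f.[y]) /Z in Zy *; lra.
(* A minimum on the compact set Z; it is not 0 because critical values are at distance at least rr >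
   r from x. *)
have [c c0 hc] : exists2 c, 0 < c & forall z, Z z -> c <= cabs f^`().[z].
  have [|z Zz hz] := compact_max Zc ZB Za (_ : forall x, Z x -> forall e, 0 < e ->
      exists2 d, 0 < d & forall y, Z y -> cabs (y - x) < d ->
        `|- cabs f^`().[y] - - cabs f^`().[x]| < e).
  - move=> y _ e e0; have [d d0 hd] := poly_cont f^`() y e0; exists d => // z _ /hd h.
    have := cabs_ub f^`().[z] f^`().[y]; have := cabs_ub f^`().[y] f^`().[z].
    rewrite (cabsB f^`().[y] f^`().[z]) ltr_norml => *; apply/andP; split; lra.
  exists (cabs f^`().[z]); last by move=> y /hz; lra.
  rewrite cabs_gt0; apply/eqP => /ncv; rewrite -/x; move: Zz; rewrite /Z; lra.
have [M M0 hM] := poly_bound f (B + 1).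
(* If f(u) = f(v), Taylor's estimate gives c |u - v| <= 4 M |u - v| ^ 2, which is impossible for 0 <
   |u - v| < eta. *)
pose eta := Num.min 1 (c / (4 * (M + 1))).
have eta0 : 0 < eta by rewrite lt_min ltr01 divr_gt0 // mulr_gt0 // ltr_wpDl.
have uniq u v : Z v -> f.[u] = f.[v] -> cabs (u - v) < eta -> u = v.
  move=> Zv fuv; rewrite lt_min => /andP[uv1 uv2].
  apply/eqP; rewrite -subr_eq0 -cabs_eq0; apply: contraT => uv.
  have uv0 : 0 < cabs (u - v) by rewrite lt_def uv cabs_ge0.
  have := @cauchy_taylor _ f v 1 M u ltr01 _ (ltW uv1).
  rewrite fuv subrr sub0r cabsN cabsM expr1n divr1 expr2 => h.
  have {}h : cabs f^`().[v] * cabs (u - v) <= 4 * M * (cabs (u - v) * cabs (u - v)).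
    by apply: h => z zv; apply: hM; have := cabs_ub z v; have := ZB v Zv; lra.
  move: h; rewrite mulrA ler_pM2r // => h.
  move: uv2; rewrite ltr_pdivlMr ?mulr_gt0 // ?ltr_wpDl // => h2.
  by have := hc v Zv; nra.
have root z w mu : Z z -> n.+1%:R * cabs (w - f.[z]) < mu * c ->
    exists2 z', f.[z'] = w & cabs (z - z') < mu.
  move=> Zz h; have mu0 : 0 < mu.
    rewrite -(pmulr_lgt0 _ c0); apply: le_lt_trans h.
    by rewrite mulr_ge0 // cabs_ge0.
  have [|z'] := @near_root_deriv _ (f - w%:P) n.+1 z mu (size_subC w hf).
    rewrite derivB derivC subr0 hornerD hornerN hornerC cabsB.
    by apply: (lt_le_trans h); rewrite ler_pM2l // hc.
  rewrite rootE hornerD hornerN hornerC subr_eq0 => /eqP h1 h2.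
  by exists z'.
(* [near_root_deriv] has the constant n.+1 and a strict hypothesis; n.+2 provides the strictness. *)
pose L : R := n.+2%:R / c.
have L0 : 0 < L by rewrite divr_gt0 // ltr0Sn.
pose e0 := eta / 4 / L.
have e00 : 0 < e0 by rewrite !divr_gt0.
have [N hN] : exists N : nat, n.+1%:R * r < eta / 4 * c * N.+1%:R.
  exists (Num.truncn (n.+1%:R * r / (eta / 4 * c))).
  by rewrite [ltRHS]mulrC -ltr_pdivrMr ?truncnS_gt ?mulr_gt0 // divr_gt0.
pose th (i : nat) : C := (i%:R / N.+1%:R : R)%:C.
have thE i : (i <= N.+1)%N -> 0 <= (i%:R / N.+1%:R : R) <= 1.
  by move=> iN; rewrite divr_ge0 //= ler_pdivrMr ?ltr0Sn // mul1r ler_nat.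
pose pt i w := x + th i * (w - x).
have ptE i w : (i <= N.+1)%N -> cabs (w - x) <= r -> cabs (pt i w - x) <= r.
  move=> /thE /andP[h1 h2] wr.
  rewrite /pt [x + _]addrC addrK cabs_scal //; apply: le_trans wr.
  by rewrite ler_piMl ?cabs_ge0.
have step i : (i <= N.+1)%N -> exists t, [/\ t x = a,
    forall w, cabs (w - x) <= r -> f.[t w] = pt i w &
    forall w w', cabs (w - x) <= r -> cabs (w' - x) <= r -> cabs (w - w') < e0 ->
      cabs (t w - t w') <= L * cabs (w - w')].
  elim: i => [_|i IH iN].
    exists (fun=> a); split=> // [w _|w w' _ _ _].
      by rewrite /pt /th mul0r raddf0 mul0r addr0.
    by rewrite subrr cabs0 mulr_ge0 ?cabs_ge0 // ltW.
  have [t [tx ft tl]] := IH (ltnW iN).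
  have Zt w : cabs (w - x) <= r -> Z (t w).
    by move=> wr; rewrite /Z ft // ptE // ltnW.
  have h w : exists z, cabs (w - x) <= r ->
      f.[z] = pt i.+1 w /\ cabs (t w - z) < eta / 4.
    have [wr|wr] := leP (cabs (w - x)) r; last by exists 0.
    have [|z h1 h2] := root (t w) (pt i.+1 w) (eta / 4) (Zt w wr); last by exists z.
    rewrite ft // /pt opprD addrACA subrr add0r -mulrBl /th -raddfB /= -mulrBl.
    rewrite -natrB // subSnn div1r cabs_scal ?invr_ge0 // mulrCA mulrC.
    rewrite ltr_pdivrMr ?ltr0Sn //; apply: le_lt_trans hN.
    by rewrite ler_wpM2l.
  have [t' ht'] := choice h.
  have ft' w : cabs (w - x) <= r -> f.[t' w] = pt i.+1 w by move=> /ht' [].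
  have dt' w : cabs (w - x) <= r -> cabs (t w - t' w) < eta / 4 by move=> /ht' [].
  have Zt' w : cabs (w - x) <= r -> Z (t' w).
    by move=> wr; rewrite /Z ft' // ptE.
  have xr : cabs (x - x) <= r by rewrite subrr cabs0 ltW.
  exists t'; split=> //.
    apply: uniq; [exact: Za|by rewrite ft' // /pt subrr mulr0 addr0|].
    by have := dt' x xr; rewrite tx cabsB; lra.
  move=> w w' wr w'r; have [->|ww] := eqVneq w w'.
    by rewrite !subrr cabs0 mulr0.
  have ww0 : 0 < cabs (w - w') by rewrite cabs_gt0 subr_eq0.
  move=> ww'; have tl' := tl w w' wr w'r ww'.
  have [|z'' hz'' dz''] := root (t' w) (pt i.+1 w') (L * cabs (w - w')) (Zt' w wr).
    rewrite ft' // /pt opprD addrACA subrr add0r -mulrBr opprD addrACA subrr addr0.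
    have /andP[h1 h2] := thE _ iN.
    rewrite /th cabs_scal // (cabsB w') /L [_ / c * _]mulrAC divfK ?gt_eqF //.
    apply: (@le_lt_trans _ _ (n.+1%:R * cabs (w - w'))).
      by rewrite ler_wpM2l // ler_piMl ?cabs_ge0.
    by rewrite ltr_pM2r // ltr_nat.
  (* Both are lifts of the same point, and the four moves through t w' and t w are each at most eta
     / 4, at least one strictly, so [uniq] identifies them. *)
  have -> : t' w' = z''.
    apply: esym; apply: uniq; [exact: Zt'|by rewrite ft'|].
    have : L * cabs (w - w') < eta / 4 by rewrite mulrC -ltr_pdivlMr.
    have := dt' w wr; have := dt' w' w'r.
    have := cabs_tri (t' w) z'' (t' w'); have := cabs_tri (t w) (t' w) (t' w').
    have := cabs_tri (t w') (t w) (t' w').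
    rewrite (cabsB (t' w) (t w)) (cabsB z'' (t' w)); lra.
  exact: ltW.
have [t [tx ft tl]] := step N.+1 (leqnn _).
have {}ft w : cabs (w - x) <= r -> f.[t w] = w.
  move=> wr; rewrite ft // /pt /th divff ?pnatr_eq0 // mul1r.
  by rewrite addrC subrK.
exists t => //; split=> //; first by exists L => //; exists e0.
have [Lf Lf0 hLf] := poly_lip f (B + 1).
exists (Num.min (Num.min 1 (e0 / Lf)) (eta / 4 / (1 + L * Lf))).
  by rewrite !lt_min ltr01 !divr_gt0 // addr_gt0 // mulr_gt0.
move=> w z wr fzr; rewrite !lt_min => /andP[/andP[h1 h2] h3].
have Zz : Z z by [].
have Zt v : cabs (v - x) <= r -> Z (t v) by move=> vr; rewrite /Z ft.
have hf1 : cabs (f.[z] - w) <= Lf * cabs (z - t w).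
  rewrite -{1}(ft w wr); apply: hLf.
    by have := ZB z Zz; lra.
  by have := ZB _ (Zt w wr); lra.
have h4 : cabs (f.[z] - w) < e0.
  by apply: (le_lt_trans hf1); rewrite mulrC -ltr_pdivlMr.
have := tl f.[z] w fzr wr h4 => h5.
apply: uniq => //; first by rewrite ft.
have := cabs_tri (t w) (t f.[z]) z; rewrite (cabsB (t w) z).
have hp : 0 < 1 + L * Lf by rewrite addr_gt0 // mulr_gt0.
move: h3; rewrite ltr_pdivlMr // => h3.
have : L * cabs (f.[z] - w) <= L * (Lf * cabs (z - t w)) by rewrite ler_pM2l.
lra.
Qed.

End Lifting.

(** * Propagation of smallness across discs *)

Section Propagation.
Variable R : realType.
Local Notation C := R[i].
Implicit Types (p q s f g : {poly C}) (z w a x y : C) (r rho M m c e d : R).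

Definition seg a z (t : R) : C := a + t%:C * (z - a).

Lemma seg_convex a z x r t : 0 <= t <= 1 -> cabs (a - x) <= r -> cabs (z - x) <= r ->
  cabs (seg a z t - x) <= r.
Proof.
move=> /andP[t0 t1] ar zr.
have -> : seg a z t - x = (1 - t)%:C * (a - x) + t%:C * (z - x).
  by rewrite /seg raddfB /=; ring.
apply: (le_trans (cabsD _ _)); rewrite !cabs_scal ?subr_ge0 //.
have h1 : (1 - t) * cabs (a - x) <= (1 - t) * r by rewrite ler_wpM2l // subr_ge0.
have h2 : t * cabs (z - x) <= t * r by rewrite ler_wpM2l.
lra.
Qed.

Lemma seg_connect (S Y : C -> Prop) a z :
  (forall t, 0 <= t <= 1 -> S (seg a z t)) -> Y a ->
  (forall y, S y -> Y y -> exists2 e, 0 < e & forall y', S y' -> cabs (y' - y) < e -> Y y') ->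
  (forall y, S y -> (forall e, 0 < e -> exists2 y', S y' /\ Y y' & cabs (y' - y) < e) -> Y y) ->
  Y z.
Proof.
move=> hS Ya Yo Yc.
have dist (t s : R) : cabs (seg a z t - seg a z s) = `|t - s| * cabs (z - a).
  rewrite /seg opprD addrACA subrr add0r -mulrBl -raddfB cabsM cabsR //.
have D0 : 0 < cabs (z - a) + 1 by rewrite ltr_wpDl ?cabs_ge0.
have small (t s e : R) : `|t - s| < e / (cabs (z - a) + 1) ->
    cabs (seg a z t - seg a z s) < e.
  rewrite dist ltr_pdivlMr // => h; apply: le_lt_trans h.
  by rewrite ler_wpM2l // lerDl.
have <- : seg a z 1 = z by rewrite /seg mul1r addrC subrK.
apply: (@segment_ind _ (fun t => Y (seg a z t))); last by rewrite lexx ler01.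
- by rewrite /seg mul0r addr0.
- move=> t t01 Yt; have [e e0 he] := Yo _ (hS t t01) Yt.
  exists (e / (cabs (z - a) + 1)); first by rewrite divr_gt0.
  by move=> s s01 st; apply: he; [exact: hS|exact: small].
- move=> t t01 h; apply: Yc; first exact: hS.
  move=> e e0; have [s [s01 st Ys]] := h (e / (cabs (z - a) + 1)) (divr_gt0 e0 D0).
  exists (seg a z s); [by split; [exact: hS|]|exact: small].
Qed.

Section Sheets.
Variables (f : {poly C}) (x : C) (r : R) (t : C -> C).
Hypothesis ht : disc_section f x r t.

(** The image under t of a closed annulus about x, described by the variable z = t(w), in which the
    functions to be estimated are polynomials. *)
Definition sheet r1 r2 z := r1 <= cabs (f.[z] - x) <= r2 /\ t f.[z] = z.

Lemma sheet_image r1 r2 w : r2 <= r -> r1 <= cabs (w - x) <= r2 -> sheet r1 r2 (t w).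
Proof.
case: ht => ft _ _ r2r /andP[h1 h2].
by rewrite /sheet ft ?h1 // (le_trans h2).
Qed.

Lemma sheet_closed r1 r2 : r2 <= r -> eclosed (sheet r1 r2).
Proof.
move=> r2r z hz; case: ht => ft [L L0 [e1 e10 tl]] _.
have near e : 0 < e -> exists2 y, sheet r1 r2 y & cabs (y - z) < e /\ cabs (f.[y] - f.[z]) < e.
  move=> e0; have [d d0 hd] := poly_cont f z e0.
  have [y Yy] := hz (Num.min d e) (ltac:(by rewrite lt_min d0)).
  by rewrite lt_min => /andP[/hd h1 h2]; exists y.
have r12 : r1 <= cabs (f.[z] - x) <= r2.
  apply/andP; split; rewrite leNgt; apply/negP => lt.
    have [y [/andP[h1 h2] _] [_ h]] := near _ (ltac:(by rewrite subr_gt0) : 0 < r1 - cabs (f.[z] - x)).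
    by have := cabs_tri f.[z] f.[y] x; lra.
  have [y [/andP[h1 h2] _] [_ h]] := near _ (ltac:(by rewrite subr_gt0) : 0 < cabs (f.[z] - x) - r2).
  by have := cabs_tri f.[y] f.[z] x; rewrite (cabsB f.[z] f.[y]); lra.
split=> //; apply/eqP; rewrite -subr_eq0 -cabs_eq0; apply: contraT => ne.
have ne0 : 0 < cabs (t f.[z] - z) by rewrite lt_def ne cabs_ge0.
set D := cabs _ in ne0.
have e20 : 0 < Num.min e1 (D / (L + 1)) by rewrite lt_min e10 divr_gt0 // addr_gt0.
have [y [/andP[h1 h2] ty] []] := near _ e20.
rewrite !lt_min => /andP[_ yz] /andP[fyz1 fyz2].
have := tl f.[z] f.[y]; rewrite (cabsB f.[z] f.[y]) ty => h.
have {}h : cabs (t f.[z] - y) <= L * cabs (f.[y] - f.[z]).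
  by apply: h => //; [case/andP: r12 => _ /le_trans; apply|exact: le_trans r2r].
move: yz fyz2; rewrite !ltr_pdivlMr ?addr_gt0 // => yz fyz2.
have := cabs_tri y (t f.[z]) z; rewrite -/D.
have := cabs_ge0 (f.[y] - f.[z]); have := cabs_ge0 (y - z); nra.
Qed.

Lemma sheet_interior r1 r2 z : r2 <= r -> sheet r1 r2 z -> r1 < cabs (f.[z] - x) < r2 ->
  exists2 e, 0 < e & forall y, cabs (y - z) < e -> sheet r1 r2 y.
Proof.
move=> r2r [_ tz] /andP[h1 h2]; case: ht => ft _ [e1 e10 he1].
have e20 : 0 < Num.min (cabs (f.[z] - x) - r1) (r2 - cabs (f.[z] - x)).
  by rewrite lt_min !subr_gt0 h1.
have [d d0 hd] := poly_cont f z e20.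
exists (Num.min d e1); first by rewrite lt_min d0.
move=> y; rewrite lt_min => /andP[/hd]; rewrite lt_min => /andP[h3 h4] ye.
have := cabs_tri f.[y] f.[z] x; have := cabs_tri f.[z] f.[y] x.
rewrite (cabsB f.[z] f.[y]) => h5 h6.
have r12 : r1 <= cabs (f.[y] - x) <= r2 by apply/andP; split; lra.
split=> //; apply: (he1 f.[z]); rewrite ?tz //; last first.
  by case/andP: r12 => _ /le_trans; apply.
by rewrite (le_trans (ltW h2)).
Qed.

End Sheets.

(* The Cauchy estimate for a branch of the inverse of f, written upstairs. *)
Lemma inverse_cauchy f n a rr B : size f = n.+2 -> 0 < rr ->
  (forall z, f^`().[z] = 0 -> rr <= cabs (f.[z] - f.[a])) ->
  (forall z, cabs (f.[z] - f.[a]) < rr -> cabs (z - a) <= B) ->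
  rr <= 2 * B * cabs f^`().[a].
Proof.
move=> hf rr0 ncv hB; pose r := rr / 2.
have r0 : 0 < r by rewrite divr_gt0.
have rrr : 0 < r < rr by rewrite r0 /r; lra.
have [t ta ht] := section_exists hf rrr ncv; set x := f.[a] in ta ht hB ncv.
have B0 : 0 <= B by apply: le_trans (hB a _); rewrite ?cabs_ge0 // subrr cabs0.
have [q hq qa] := poly_quot f a.
have fE z : f.[z] - x = q.[z] * (z - a).
  by rewrite {1}hq hornerD hornerM hornerXsubC hornerC addrK.
(* The inner radius -1 makes the lower bound vacuous: X lies over a full disc. *)
pose X := sheet f x t (-1) r.
have Xr z : X z -> cabs (f.[z] - x) <= r by case=> /andP[].
have Xa : X a.
  by split=> //; rewrite subrr cabs0 lerN10 ltW.
(* The quotient is 1 / q = (z - a) / (f(z) - x), of modulus at most B / r over the boundary circle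
   and equal to 1 / f'(a) at a. *)
have := @max_modulus _ X (fun z => cabs (f.[z] - x) = r) (cabs a + B) (B / r) 1 q.
move=> /(_ (sheet_closed ht (lexx _))) h.
have {}h : cabs (1 : {poly C}).[a] <= B / r * cabs q.[a].
  apply: h => //.
  - move=> z /Xr h; have := hB z _; have := cabs_ub z a => h1 h2.
    by have := h2 (ltac:(rewrite /r in h; lra)); lra.
  - move=> z Xz; have := Xr z Xz; rewrite le_eqVlt => /orP[/eqP h|h]; [by left|right].
    apply: (sheet_interior ht (lexx _) Xz); rewrite h andbT.
    by rewrite (lt_le_trans _ (cabs_ge0 _)) // ltrN10.
  - move=> z [_ tz]; apply/eqP => q0; have := fE z; rewrite q0 mul0r => /eqP.
    rewrite subr_eq0 => /eqP fz; have za : z = a by rewrite -tz fz ta.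
    move: q0; rewrite za qa => /ncv; rewrite -/x subrr cabs0; lra.
  - by rewrite divr_ge0 // ltW.
  move=> z Xz zr; rewrite hornerC cabs1 mulrAC ler_pdivlMr // mul1r -zr fE cabsM mulrC.
  rewrite ler_wpM2r ?cabs_ge0 // hB //; have := Xr z Xz; rewrite /r; lra.
move: h; rewrite hornerC cabs1 qa mulrAC ler_pdivlMr // mul1r /r; lra.
Qed.

(** The number d is chosen before g and x, so that one d serves a whole sequence of words. *)
Lemma propagate_bounded r r' rho M e : 0 < r -> 0 < rho < r' -> 0 <= M -> 0 < e ->
  exists2 d, 0 < d & forall g x, (forall z, cabs (z - x) <= r' -> cabs g.[z] <= M) ->
    (forall z, cabs (z - x) <= r -> cabs g.[z] <= d) ->
    forall z, cabs (z - x) <= rho -> cabs g.[z] <= e.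
Proof.
move=> r0 rhor' M0 e0; have [k [d d0 hd]] := two_constants r0 rhor' M0 e0.
exists (Num.min d e); first by rewrite lt_min d0.
move=> g x gM gd z zrho; have [zr|zr] := leP (cabs (z - x)) r.
  by apply: (le_trans (gd z zr)); rewrite ge_min lexx orbT.
apply: le_trans (hd (cabs (z - x)) _); last by rewrite cabs_ge0.
apply: (@three_circles _ g x r r' d M k) => //; first exact: ltW.
- by move=> y yr; apply: (le_trans (gd y _)); rewrite ?yr // ge_min lexx.
- by move=> y yr; apply: gM; rewrite yr.
- by rewrite ltW //; case/andP: rhor' => _ h; lra.
Qed.

(* The three circles theorem is applied to the inverse branch of f. *)
Lemma propagate_inverse r rr rho M e : 0 < r -> r < rho -> rho < rr -> 0 <= M -> 0 < e ->
  2 * e < rho ->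
  exists2 d, 0 < d & forall f n x, size f = n.+2 ->
    (forall z, f^`().[z] = 0 -> rr <= cabs (f.[z] - x)) ->
    (forall z, cabs (f.[z] - x) < rr -> cabs (z - f.[z]) <= M) ->
    (forall z, cabs (z - x) <= r -> cabs (z - f.[z]) <= d) ->
    forall z, cabs (z - x) < rho - e -> cabs (z - f.[z]) <= e.
Proof.
move=> r0 rrho rhorr M0 e0 erho; pose r' := (rho + rr) / 2; pose r1 := r / 8.
have r10 : 0 < r1 by rewrite divr_gt0.
have rho0 : 0 < rho by lra.
have rhor' : 0 < rho < r' by rewrite rho0 /r'; lra.
have [k [d d0 hd]] := two_constants r10 rhor' M0 e0.
exists (Num.min (Num.min d e) (r / 16)); first by rewrite !lt_min d0 e0 divr_gt0.
move=> f n x hf ncv fM fd.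
have {}fd z : cabs (z - x) <= r -> [/\ cabs (z - f.[z]) <= d, cabs (z - f.[z]) <= e &
    cabs (z - f.[z]) <= r / 16].
  by move=> /fd; rewrite !le_min => /andP[/andP[]].
(* A starting point for the branch: f is within r / 16 of the identity, so |f - x| is at least 3 r /
   16 on the circle of radius r / 4 and at most r / 16 at its center. *)
have [||a] := @min_modulus _ (f - x%:P) x (r / 4) (3 * r / 16) (ltac:(by rewrite divr_gt0)).
- move=> z zr; rewrite hornerD hornerN hornerC; have [_ _ h] := fd z (ltac:(rewrite zr; lra)).
  by have := cabs_tri f.[z] z x; lra.
- rewrite hornerD hornerN hornerC cabsB; have [_ _ h] := fd x (ltac:(rewrite subrr cabs0; lra)).
  lra.
rewrite rootE hornerD hornerN hornerC subr_eq0 => /eqP fa ax.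
have rr' : 0 < r' < rr by rewrite /r'; lra.
rewrite -fa in ncv; have [t ta ht] := section_exists hf rr' ncv; rewrite fa in ncv ta ht.
have r'rr : r' < rr by case/andP: rr'.
have r'rho : rho < r' by case/andP: rhor'.
have ft w : cabs (w - x) <= r' -> f.[t w] = w by case: ht => h _ _; exact: h.
(* The branch cannot cross the circle of radius r / 4: there |y - t y| <= r / 16 and |y - x| <= r /
   8, which add up to less than r / 4. *)
have small w : cabs (w - x) <= r1 -> cabs (t w - x) < r / 4.
  move=> wr.
  pose S y := cabs (y - x) <= r1; pose Y y := cabs (t y - x) < r / 4.
  have Sr' y : S y -> cabs (y - x) <= r' by rewrite /S /r1; lra.
  have [_ [L L0 [e1 e10 tl]] _] := ht.
  apply: (@seg_connect S Y x w).
  - by move=> u u01; apply: seg_convex => //; rewrite subrr cabs0 ltW.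
  - by rewrite /Y ta.
  - move=> y Sy Yy; pose g := r / 4 - cabs (t y - x).
    have g0 : 0 < g by rewrite subr_gt0.
    exists (Num.min e1 (g / L)); first by rewrite lt_min e10 divr_gt0.
    move=> y' Sy'; rewrite lt_min => /andP[h1]; rewrite ltr_pdivlMr // => h2.
    have := tl y' y (Sr' _ Sy') (Sr' _ Sy) h1.
    have := cabs_tri (t y) (t y') x; rewrite /Y /g in h2 *; lra.
  - move=> y Sy hy; rewrite /Y.
    have le : cabs (t y - x) <= r / 4.
      rewrite leNgt; apply/negP; rewrite -subr_gt0; set g := _ - _ => g0.
      have [y' [Sy' Yy']] := hy (Num.min e1 (g / L)) (ltac:(by rewrite lt_min e10 divr_gt0)).
      rewrite lt_min => /andP[h1]; rewrite ltr_pdivlMr // => h2.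
      have := tl y' y (Sr' _ Sy') (Sr' _ Sy) h1.
      have := cabs_tri (t y') (t y) x; rewrite (cabsB (t y) (t y')) /Y /g in Yy' h2 *; lra.
    rewrite lt_def le andbT; apply/eqP => eq4.
    have [_ _] := fd (t y) (ltac:(rewrite -eq4; lra)); rewrite ft ?Sr' //.
    have := cabs_tri y (t y) x; rewrite /S /r1 in Sy; lra.
(* Three circles for w |-> t w - w between the radii r1 and r'; on the sheet the comparison function
   (w - x) ^ k reads (f - x) ^ k. *)
have close w : cabs (w - x) <= rho -> cabs (t w - w) <= e.
  move=> wrho; have wr' : cabs (w - x) <= r' by lra.
  have [wr|wr] := leP (cabs (w - x)) r1.
    have [_ h _] := fd (t w) (ltac:(have := small w wr; lra)).
    by rewrite ft // in h.
  apply: le_trans (hd (cabs (w - x)) _); last by rewrite cabs_ge0.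
  pose q := (f - x%:P) ^+ k.
  have qE z : cabs q.[z] = cabs (f.[z] - x) ^+ k.
    by rewrite /q horner_exp hornerD hornerN hornerC cabsX.
  have sE z : cabs ('X - f).[z] = cabs (z - f.[z]) by rewrite hornerD hornerN hornerX.
  have := @max_modulus _ (sheet f x t r1 r')
    (fun z => cabs (f.[z] - x) = r1 \/ cabs (f.[z] - x) = r') _ (d / r1 ^+ k + M / r' ^+ k)
    ('X - f) q (sheet_closed ht (lexx _)).
  have [B hB] := preimage_bounded (cabs x + r') hf.
  move=> /(_ B) h.
  have {}h : cabs ('X - f).[t w] <= (d / r1 ^+ k + M / r' ^+ k) * cabs q.[t w].
    have D1 : 0 <= d / r1 ^+ k by rewrite divr_ge0 ?exprn_ge0 // ltW.
    have D2 : 0 <= M / r' ^+ k by rewrite divr_ge0 ?exprn_ge0 //; lra.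
    have r'0 : 0 < r' by case/andP: rr'.
    apply: h.
    - by move=> z [/andP[_ h2] _]; apply: hB; have := cabs_ub f.[z] x; lra.
    - move=> z Xz; have [/andP[h1 h2] _] := Xz.
      move: h1; rewrite le_eqVlt => /orP[/eqP h1|h1]; first by left; left.
      move: h2; rewrite le_eqVlt => /orP[/eqP h2|h2]; first by left; right.
      by right; apply: (sheet_interior ht (lexx _) Xz); rewrite h1.
    - move=> z [/andP[h1 _] _]; rewrite -cabs_eq0 qE expf_neq0 // gt_eqF //; lra.
    - exact: addr_ge0.
    - move=> z [/andP[h1 h2] tz] [zr|zr]; rewrite qE sE zr mulrDl.
        rewrite divfK ?expf_neq0 ?gt_eqF // (@le_trans _ _ d) //.
          have zr1 : cabs (f.[z] - x) <= r1 by rewrite zr.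
          have := small _ zr1; rewrite tz => zx.
          by have [] := fd z (ltac:(lra)).
        by rewrite lerDl mulr_ge0 // exprn_ge0 // ltW.
      rewrite divfK ?expf_neq0 ?gt_eqF // (@le_trans _ _ M) //.
        by apply: fM; rewrite zr.
      by rewrite lerDr mulr_ge0 // exprn_ge0 // ltW.
    - by apply: (sheet_image ht (lexx _)); rewrite (ltW wr).
  by move: h; rewrite sE qE ft.
(* It remains to see that z is on the sheet. The segment from a to z stays at distance at most b <
   rho - e from x, so a point of the sheet on it is mapped within rho of x, strictly inside the
   domain of the branch. *)
move=> z zx; pose b := Num.max (cabs (a - x)) (cabs (z - x)).
have xx : cabs (x - x) <= rho by rewrite subrr cabs0 ltW.
have ae : cabs (a - x) <= e by rewrite -ta close.
have bl : b < rho - e by rewrite gt_max zx andbT; lra.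
pose S y := cabs (y - x) <= b.
have [/andP[_ fz] tz] : sheet f x t (-1) rho z; last by have := close _ fz; rewrite tz.
apply: (@seg_connect S (sheet f x t (-1) rho) a z).
- by move=> u u01; apply: seg_convex => //; rewrite le_max lexx ?orbT.
- by split; rewrite fa // subrr cabs0 lerN10 ltW.
- move=> y Sy Yy; have [/andP[_ fy] ty] := Yy.
  have [|u u0 hu] := sheet_interior ht (ltW r'rho) Yy; last by exists u => // y' _; exact: hu.
  have := close _ fy; rewrite ty => h; have := cabs_tri y f.[y] x; rewrite (cabsB f.[y] y).
  rewrite /S in Sy => h'; rewrite (lt_le_trans _ (cabs_ge0 _)) ?ltrN10 //=; lra.
- move=> y _ hy; apply: (sheet_closed ht (ltW r'rho)) => u /hy[y' [_ h1] h2].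
  by exists y'.
Qed.

End Propagation.

(** * Words in finitely many polynomials *)

Section Pigeonhole.
Variable R : realType.
Local Notation C := R[i].

(** A grid of mesh e / 2 in both coordinates. *)
Lemma finite_code (B e : R) : 0 < e -> exists (T : finType) (code : C -> T),
  forall z w, cabs z <= B -> cabs w <= B -> code z = code w -> cabs (z - w) < e.
Proof.
move=> e0; pose mu := e / 2; have mu0 : 0 < mu by rewrite divr_gt0.
pose H := Num.truncn (2 * B / mu).
pose cd (x : R) : 'I_H.+1 := inord (Num.truncn ((x + B) / mu)).
have cdP x y : `|x| <= B -> `|y| <= B -> cd x = cd y -> `|x - y| < mu.
  move=> xB yB /(congr1 (@nat_of_ord _)).
  have itv u : `|u| <= B -> 0 <= (u + B) / mu <= 2 * B / mu.
    rewrite ler_norml => /andP[h1 h2].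
    by rewrite divr_ge0 ?ler_pM2r ?invr_gt0 //=; lra.
  have inH u : `|u| <= B -> (Num.truncn ((u + B) / mu) < H.+1)%N.
    by move=> /itv /andP[h1 h2]; rewrite ltnS le_truncn.
  rewrite !inordK ?inH //.
  have /truncn_itv : 0 <= (x + B) / mu by case/andP: (itv x xB).
  have /truncn_itv : 0 <= (y + B) / mu by case/andP: (itv y yB).
  move=> /andP[h1 h2] /andP[h3 h4] h5; rewrite h5 in h3 h4.
  move: h1 h2 h3 h4; rewrite !ler_pdivlMr // !ltr_pdivrMr // -natr1.
  by rewrite ltr_norml => *; apply/andP; split; lra.
exists ('I_H.+1 * 'I_H.+1)%type, (fun z => (cd (complex.Re z), cd (complex.Im z))).
move=> z w zB wB [h1 h2]; apply: (le_lt_trans (cabs_ReIm _)); rewrite !raddfB.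
have := cdP _ _ (le_trans (cabs_Re _) zB) (le_trans (cabs_Re _) wB) h1.
have := cdP _ _ (le_trans (cabs_Im _) zB) (le_trans (cabs_Im _) wB) h2.
by rewrite /mu; lra.
Qed.

Lemma code_collision (T : finType) (code : nat -> T) :
  exists k l, (k < l <= #|T|)%N /\ code k = code l.
Proof.
have : ~~ injectiveb (fun i : 'I_#|T|.+1 => code i).
  by apply/injectiveP => /leq_card; rewrite card_ord ltnn.
case/injectivePn => i [j] ij eij; have [lt|gt|/val_inj eq] := ltngtP i j.
- by exists i, j; split => //; rewrite lt -ltnS /=.
- by exists j, i; split => //; rewrite gt -ltnS /=.
- by rewrite eq eqxx in ij.
Qed.

(* Total boundedness, encoded by a map to a finite type. *)
Lemma function_code (r B L e : R) : 0 <= r -> 0 <= L -> 0 < e ->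
  exists (T : finType) (code : (C -> C) -> T), forall f g,
    (forall z, cabs z <= r -> cabs (f z) <= B) ->
    (forall z, cabs z <= r -> cabs (g z) <= B) ->
    (forall z w, cabs z <= r -> cabs w <= r -> cabs (f z - f w) <= L * cabs (z - w)) ->
    (forall z w, cabs z <= r -> cabs w <= r -> cabs (g z - g w) <= L * cabs (z - w)) ->
    code f = code g -> forall z, cabs z <= r -> cabs (f z - g z) <= e.
Proof.
move=> r0 L0 e0.
have mu0 : 0 < e / 4 / (L + 1) by rewrite !divr_gt0 // ltr_wpDl.
have [T [code codeP]] := finite_code r mu0.
have e20 : 0 < e / 2 by rewrite divr_gt0.
have [U [code' codeP']] := finite_code B e20.
(* A sample point for each cell, with the dummy value 0 if the cell does not meet the disc. The code
   of a function lists the cells of its values at the samples. *)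
have hc : forall i : T, exists c : C, cabs c <= r /\
    ((exists2 z, cabs z <= r & code z = i) -> code c = i).
  move=> i; have [[z zr zi]|no] := pselect (exists2 z, cabs z <= r & code z = i).
    by exists z.
  by exists 0; split=> //; rewrite cabs0.
have [c cP] := choice hc.
exists {ffun T -> U}, (fun f => [ffun i : T => code' (f (c i))]).
move=> f g fB gB fL gL efg z zr; pose i := code z; have [ci1 ci2] := cP i.
have {}ci2 : code (c i) = code z by apply: ci2; exists z.
have d1 := codeP _ _ ci1 zr ci2; rewrite cabsB in d1.
have hL : L * cabs (z - c i) <= e / 4.
  move: d1; rewrite ltr_pdivlMr ?ltr_wpDl // => d1.
  by have := cabs_ge0 (z - c i); lra.
have := congr1 (fun g : {ffun T -> U} => g i) efg; rewrite !ffunE => efg'.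
have := codeP' _ _ (fB _ ci1) (gB _ ci1) efg'.
have := fL z (c i) zr ci1; have := gL z (c i) zr ci1; rewrite (cabsB (g z)) => h1 h2 h3.
have := cabs_tri (f (c i)) (f z) (g z); have := cabs_tri (g (c i)) (f (c i)) (g z).
lra.
Qed.

(** N is independent of a because recentering brings all discs to the same [function_code]. *)
Lemma pigeonhole_disc (r B e : R) : 0 < r -> 0 <= B -> 0 < e -> exists N : nat,
  forall (f : nat -> {poly C}) a,
    (forall k z, (k <= N)%N -> cabs (z - a) <= r -> cabs (f k).[z] <= B) ->
    exists k l, (k < l <= N)%N /\
      forall z, cabs (z - a) <= r / 4 -> cabs ((f k).[z] - (f l).[z]) <= e.
Proof.
move=> r0 B0 e0; have r40 : 0 <= r / 4 by rewrite divr_ge0 // ltW.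
have L0 : 0 <= 4 * B / r by rewrite divr_ge0 ?mulr_ge0 // ltW.
have [T [code codeP]] := function_code B r40 L0 e0.
exists #|T| => f a fB.
have [k [l [kl ekl]]] := code_collision (fun k => code (fun z => (f k).[a + z])).
exists k, l; split=> // z zr.
have aK y : a + y - a = y by rewrite [a + y]addrC addrK.
have bnd j : (j <= #|T|)%N -> forall y, cabs y <= r / 4 -> cabs (f j).[a + y] <= B.
  by move=> jN y yr; apply: fB => //; rewrite aK; lra.
have lip j : (j <= #|T|)%N -> forall y w, cabs y <= r / 4 -> cabs w <= r / 4 ->
    cabs ((f j).[a + y] - (f j).[a + w]) <= 4 * B / r * cabs (y - w).
  move=> jN y w yr wr; have -> : y - w = (a + y) - (a + w) by ring.
  by apply: (@lip_disc _ (f j) a r B) => //; rewrite ?aK // => u; exact: fB.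
have kN : (k <= #|T|)%N by case/andP: kl => /ltnW h1 /(leq_trans h1).
have lN : (l <= #|T|)%N by case/andP: kl.
have := codeP _ _ (bnd k kN) (bnd l lN) (lip k kN) (lip l lN) ekl (z - a) zr.
by rewrite [a + _]addrC subrK.
Qed.

Lemma increasing_choice (Q : nat -> nat -> Prop) :
  (forall i N, exists2 n, (N <= n)%N & Q i n) ->
  exists2 k : nat -> nat, {homo k : i j / (i < j)%N} & forall i, Q i (k i).
Proof.
move=> h; have /choice[F hF] : forall p : nat * nat, exists n, (p.2 <= n)%N /\ Q p.1 n.
  by move=> [i N]; have [n h1 h2] := h i N; exists n.
pose k := fix k i := if i is j.+1 then F (j.+1, (k j).+1) else F (0, 0)%N.
exists k; last by case=> [|i]; [case: (hF (0, 0)%N)|case: (hF (i.+1, (k i).+1))].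
by apply: homo_ltn => [x y z|i]; [exact: ltn_trans|case: (hF (i.+1, (k i).+1))].
Qed.

(** An ultrafilter replaces the diagonal extraction: at each precision it selects one class of
    indices with equal codes, and finitely many selected classes always have arbitrarily large
    common indices. *)
Lemma ascoli (f : nat -> C -> C) (r B L : R) : 0 <= r -> 0 <= L ->
  (forall n z, cabs z <= r -> cabs (f n z) <= B) ->
  (forall n z w, cabs z <= r -> cabs w <= r -> cabs (f n z - f n w) <= L * cabs (z - w)) ->
  exists2 k : nat -> nat, {homo k : i j / (i < j)%N} & exists v : C -> C,
    forall e, 0 < e -> exists N, forall n, (N <= n)%N ->
      forall z, cabs z <= r -> cabs (f (k n) z - v z) <= e.
Proof.
move=> r0 L0 fB fL.
have [U [UU sU]] := @ultraFilterLemma _ (\oo : set_system nat) _.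
pose eps (i : nat) : R := i.+1%:R^-1.
have eps0 i : 0 < eps i by rewrite invr_gt0 ltr0Sn.
have hS i : exists S, U S /\ forall a b, S a -> S b ->
    forall z, cabs z <= r -> cabs (f a z - f b z) <= eps i.
  have [T [code codeP]] := function_code B r0 L0 (eps0 i).
  have [t Ut] : exists t, U [set n | code (f n) = t].
    apply: contrapT => /forallNP no.
    have : U [set n | forall t, code (f n) <> t].
      apply: filter_forall => t; have [//|//] := in_ultra_setVsetC [set n | code (f n) = t] UU.
      by move/no.
    by move=> /filter_ex[n /(_ (code (f n)))].
  exists [set n | code (f n) = t]; split=> // a b ha hb.
  by apply: codeP; [exact: fB|exact: fB|exact: fL|exact: fL|rewrite ha hb].
have [S hS'] := choice hS.
have [|k kmono kS] := @increasing_choice (fun i n => forall j, (j <= i)%N -> S j n).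
  move=> i N.
  have h1 : U [set n | forall j : 'I_i.+1, S j n].
    by apply: filter_forall => j; have [] := hS' j.
  have h2 : U [set n | (N <= n)%N] by apply: sU; exists N.
  have [n [hn1 hn2]] := filter_ex (filterI h1 h2).
  by exists n => // j ji; exact: (hn1 (Ordinal (ji : (j < i.+1)%N))).
have cau i a b : (i <= a)%N -> (i <= b)%N -> forall z, cabs z <= r ->
    cabs (f (k a) z - f (k b) z) <= eps i.
  by move=> ia ib; have [_] := hS' i; apply; exact: kS.
have hv z : exists v, cabs z <= r -> forall i n, (i <= n)%N -> cabs (f (k n) z - v) <= eps i.
  have [zr|zr] := leP (cabs z) r; last by exists 0.
  have [v hv] := @cluster_pt R (fun n => f (k n) z) B (fun n => fB _ _ zr).
  exists v => _ i n iN; apply/ler_addgt0Pl => e e0.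
  have [n' n'i h] := hv e e0 i.
  have := cau i n n' iN n'i z zr; have := cabs_tri (f (k n') z) (f (k n) z) v; lra.
have [v hv'] := choice hv; exists k => //; exists v => e /inv_natS_lt[N hN].
exists N => n nN z zr; apply: le_trans (ltW (hN N (leqnn _))); exact: hv'.
Qed.

End Pigeonhole.

(** * Word maps, and why they cannot tend to the identity *)

Section Words.
Variable R : realType.
Local Notation C := R[i].
Variables (m : nat) (P : 'I_m -> {poly C}).
Implicit Types (u v w s : seq 'I_m) (z x p c : C).

(* The first letter of a word is applied first. *)
Definition we w z : C := foldl (fun z j => (P j).[z]) z w.
Definition wp w : {poly C} := foldl (fun q j => P j \Po q) 'X w.

Lemma we_cat u v z : we (u ++ v) z = we v (we u z).
Proof. by rewrite /we foldl_cat. Qed.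

Lemma wpE w z : (wp w).[z] = we w z.
Proof.
elim/last_ind: w => [|w j IH]; first by rewrite /wp /we /= hornerX.
by rewrite /wp /we -!cats1 !foldl_cat /= horner_comp IH.
Qed.

Lemma deriv_wp_rcons w j z :
  (wp (rcons w j))^`().[z] = (P j)^`().[we w z] * (wp w)^`().[z].
Proof.
rewrite /wp -cats1 foldl_cat /= -/(wp w) deriv_comp hornerM horner_comp wpE; ring.
Qed.

Lemma deriv_wp_cat u v z : (wp (u ++ v))^`().[z] = (wp v)^`().[we u z] * (wp u)^`().[z].
Proof.
elim/last_ind: v => [|v j IH]; first by rewrite cats0 /= derivX hornerC mul1r.
by rewrite -rcons_cat !deriv_wp_rcons IH we_cat mulrA.
Qed.

Hypothesis P2 : forall j, (2 < size (P j))%N.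

Lemma size_P j : exists n, size (P j) = n.+3.
Proof. by have := P2 j; case: (size _) => [|[|[|n]]] // _; exists n. Qed.

Lemma size_wp w : exists n, size (wp w) = n.+2.
Proof.
elim/last_ind: w => [|w j [n hn]]; first by exists 0%N; rewrite size_polyX.
have [k hk] := size_P j; rewrite /wp -cats1 foldl_cat /= -/(wp w).
have := size_comp_poly (P j) (wp w); rewrite hn hk /= mulSn addSn => h.
by exists (n + k.+1 * n.+1)%N; move: h; case: (size _) => // a /= ->.
Qed.

Lemma size_wp3 w : w != [::] -> exists n, size (wp w) = n.+3.
Proof.
case/lastP: w => // w j _; have [n hn] := size_wp w; have [k hk] := size_P j.
rewrite /wp -cats1 foldl_cat /= -/(wp w).
have := size_comp_poly (P j) (wp w); rewrite hn hk /= mulSn addSn => h.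
by exists (n + (n + k * n.+1))%N; move: h; case: (size _) => // a /= ->; rewrite mulSn addSn addnS.
Qed.

Definition escape_radius (rho : R) := 0 < rho /\
  forall j z, rho <= cabs z -> 2 * cabs z <= cabs (P j).[z].

Lemma escape_exists : exists2 T : R, 0 < T & forall rho, T <= rho -> escape_radius rho.
Proof.
have h j : exists T : R, 1 <= T /\ forall z, T <= cabs z -> 2 * cabs z <= cabs (P j).[z].
  have [n hn] := size_P j; have [c c0 [T T1 hT]] := poly_growth hn.
  exists (Num.max T (2 / c)); split; first by rewrite le_max T1.
  move=> z; rewrite ge_max => /andP[zT zc]; apply: le_trans (hT z zT).
  rewrite exprS mulrCA mulrC ler_wpM2l ?cabs_ge0 //.
  rewrite ler_pdivrMr // mulrC in zc; apply: (le_trans zc).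
  by rewrite exprS ler_pM2l // ler_peMr ?cabs_ge0 // exprn_ege1 // (le_trans T1).
have [T hT] := choice h.
exists (1 + \sum_j T j).
  by rewrite ltr_pwDl // sumr_ge0 // => j _; have [] := hT j; lra.
move=> rho hrho; split.
  apply: lt_le_trans hrho; rewrite ltr_pwDl // sumr_ge0 // => j _; have [] := hT j; lra.
move=> j z zr; have [T1 h'] := hT j; apply: h'; apply: le_trans zr; apply: le_trans hrho.
rewrite (bigD1 j) //= addrCA lerDl addr_ge0 // sumr_ge0 // => k _.
by have [] := hT k; lra.
Qed.

Section Escape.
Variable rho : R.
Hypothesis hrho : escape_radius rho.

Lemma we_escape w z : rho <= cabs z -> cabs z <= cabs (we w z).
Proof.
case: hrho => rho0 h; elim: w z => [|j w IH] z zr //=.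
have := h j z zr => h1; have h2 : cabs z <= cabs (P j).[z] by lra.
by apply: (le_trans h2); apply: IH; lra.
Qed.

Lemma we_escape2 w z : w != [::] -> rho <= cabs z -> 2 * cabs z <= cabs (we w z).
Proof.
case: hrho => rho0 h; case: w => // j w _ zr /=; apply: (le_trans (h j z zr)).
by apply: we_escape; have := h j z zr; lra.
Qed.

Lemma we_escape_size w z : rho <= cabs z -> 2 ^+ size w * cabs z <= cabs (we w z).
Proof.
case: hrho => rho0 h; elim: w z => [|j w IH] z zr /=; first by rewrite expr0 mul1r.
have h1 := h j z zr; apply: le_trans (IH (P j).[z] _); last by lra.
rewrite exprSr -mulrA ler_wpM2l // exprn_ge0 //.
Qed.

Lemma we_bounded w z : cabs (we w z) <= rho -> cabs z <= rho.
Proof.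
by move=> h; rewrite leNgt; apply/negP => lt; have := we_escape w (ltW lt); lra.
Qed.

(* A quantitative form of p being a point of equicontinuity of all word maps. *)
Definition stable_at p := exists2 d, 0 < d & forall w x z,
  cabs (x - p) < d -> cabs (z - p) < d -> cabs (we w x) <= rho -> cabs (we w z) <= 2 * rho.

(** Every word then has its inverse branches on one and the same disc about p. *)
Definition critical_free_at p := exists2 d, 0 < d & forall w c,
  (wp w)^`().[c] = 0 -> d <= cabs (we w c - p).

Hypothesis tame : forall p, stable_at p \/ critical_free_at p.

(* The set of points near which the s n tend to the identity is open and closed. *)
Lemma no_limit_id (s : nat -> seq 'I_m) x0 r0 : 0 < r0 -> (forall n, s n != [::]) ->
  (forall e, 0 < e -> exists N, forall n, (N <= n)%N ->
     forall z, cabs (z - x0) <= r0 -> cabs (z - we (s n) z) <= e) -> False.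
Proof.
move=> r00 sn hs; have [rho0 _] := hrho.
pose W x := exists2 r, 0 < r & forall e, 0 < e -> exists N, forall n, (N <= n)%N ->
     forall z, cabs (z - x) <= r -> cabs (z - we (s n) z) <= e.
have Wrho x : W x -> cabs x < rho.
  move=> [r r0' hr]; rewrite ltNge; apply/negP => rx.
  have [N hN] := hr (rho / 2) (ltac:(by rewrite divr_gt0)).
  have := hN N (leqnn _) x; rewrite subrr cabs0 => /(_ (ltW r0')).
  have := we_escape2 (sn N) rx; have := cabs_ub (we (s N) x) x.
  rewrite (cabsB (we _ _)); lra.
have Wclosed y : (forall e, 0 < e -> exists2 x, W x & cabs (x - y) < e) -> W y.
  (* At a stable point, s_n(x) has modulus at most rho for large n, so s_n is bounded on the disc of
     radius d about y and smallness spreads directly. *)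
  move=> hy; have [[d d0 st]|[d d0 cf]] := tame y.
    have [x Wx xy] := hy (d / 4) (ltac:(by rewrite divr_gt0)).
    have xrho := Wrho x Wx; have [r rr0 hr] := Wx.
    exists (d / 8); first by rewrite divr_gt0.
    move=> e e0.
    have [|||dl dl0 hdl] := @propagate_bounded _ r (d / 2) (3 * d / 8) (3 * rho + d / 2) e rr0.
    - by apply/andP; split; lra.
    - by lra.
    - exact: e0.
    have [N1 hN1] := hr dl dl0.
    have [N2 hN2] := hr (rho - cabs x) (ltac:(by rewrite subr_gt0)).
    exists (maxn N1 N2) => n; rewrite geq_max => /andP[n1 n2] z zy.
    have gE (v : C) : ('X - wp (s n)).[v] = v - we (s n) v by rewrite hornerD hornerN hornerX wpE.
    rewrite -gE; apply: (hdl _ x).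
    - move=> v vx; rewrite gE.
      have vy : cabs (v - y) < d by have := cabs_tri x v y; lra.
      have sx : cabs (we (s n) x) <= rho.
        have := hN2 n n2 x; rewrite subrr cabs0 => /(_ (ltW rr0)).
        by have := cabs_ub (we (s n) x) x; rewrite (cabsB (we _ _)); lra.
      have := st (s n) x v (ltac:(lra)) vy sx; have := cabs_ub v x.
      by have := cabsD v (- we (s n) v); rewrite cabsN; lra.
    - by move=> v vx; rewrite gE; apply: hN1.
    - by have := cabs_tri y z x; rewrite (cabsB y); lra.
  (* Here the words may be unbounded near y, but the preimages of a disc under them are bounded by
     escape, so smallness is spread along inverse branches. *)
  have [x Wx xy] := hy (d / 8) (ltac:(by rewrite divr_gt0)).
  have xrho := Wrho x Wx; have [r1 r10 hr1] := Wx.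
  pose r := Num.min r1 (d / 4).
  have rr0 : 0 < r by rewrite lt_min r10 divr_gt0.
  have rd : r <= d / 4 by rewrite ge_min lexx orbT.
  have rr1 : r <= r1 by rewrite ge_min lexx.
  exists (d / 8); first by rewrite divr_gt0.
  move=> e0 e00; pose e := Num.min e0 (d / 16).
  have e1 : 0 < e by rewrite lt_min e00 divr_gt0.
  have ed : e <= d / 16 by rewrite ge_min lexx orbT.
  have ee : e <= e0 by rewrite ge_min lexx.
  have [|||||dl dl0 hdl] := @propagate_inverse _ r (d / 2) (3 * d / 8) (3 * rho + d) e rr0.
  - lra.
  - lra.
  - lra.
  - exact: e1.
  - lra.
  have [N hN] := hr1 dl dl0; exists N => n nN z zy.
  have [k hk] := size_wp (s n).
  rewrite -wpE; apply: le_trans ee; apply: (hdl (wp (s n)) k x hk).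
  - move=> c /cf; rewrite wpE; have := cabs_tri x (we (s n) c) y; lra.
  - move=> v; rewrite wpE => vx.
    have wv : cabs (we (s n) v) < rho + d / 2 by have := cabs_ub (we (s n) v) x; lra.
    have [vr|vr] := leP rho (cabs v).
      by have := we_escape2 (sn n) vr; have := cabsD v (- we (s n) v); rewrite cabsN; lra.
    by have := cabsD v (- we (s n) v); rewrite cabsN; lra.
  - by move=> v vx; rewrite wpE; apply: hN => //; lra.
  - by have := cabs_tri y z x; rewrite (cabsB y); lra.
have : W rho%:C.
  apply: (@seg_connect _ (fun=> True) W x0) => //; first by exists r0.
    move=> y _ [r r0' hr]; exists (r / 2); first by rewrite divr_gt0.
    move=> y' _ y'y; exists (r / 2); first by rewrite divr_gt0.
    move=> e /hr[N hN]; exists N => n nN z zy; apply: hN => //.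
    by have := cabs_tri y' z y; lra.
  by move=> y _ hy; apply: Wclosed => e /hy[y' [_ h1] h2]; exists y'.
by move=> /Wrho; rewrite cabsR ger0_norm ?ltxx // ltW.
Qed.

(* Two prefixes of a long word nearly agree on a disc, so the word joining them is
   close to the identity on the image of that disc. *)
Lemma bounded_prefixes (B r c : R) : 0 < B -> 0 < r -> 0 < c -> exists N : nat,
  forall w a, (N <= size w)%N ->
    (forall k z, (k <= N)%N -> cabs (z - a) <= r -> cabs (we (take k w) z) <= B) ->
    (forall k, (k <= N)%N -> c <= cabs (wp (take k w))^`().[a]) -> False.
Proof.
move=> B0 r0 c0; apply: contrapT => /forallNP hno.
(* The constraint r1 <= r / 4 comes from [pigeonhole_disc], which compares prefixes only on a
   quarter of the disc. *)
have [r1 [r2 [r10 r1r _ r20 hop]]] := open_image r0 c0 B0 (ltac:(by rewrite divr_gt0) : 0 < r / 4).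
have h n : exists sq : seq 'I_m * C, [/\ sq.1 != [::], cabs sq.2 <= B &
    forall z, cabs (z - sq.2) < r2 -> cabs (z - we sq.1 z) <= n.+1%:R^-1].
  have [N hN] := @pigeonhole_disc _ r B n.+1%:R^-1 r0 (ltW B0) (ltac:(by rewrite invr_gt0 ltr0Sn)).
  have /existsNP[w /existsNP[a hwa]] := hno N.
  have {}hwa : [/\ (N <= size w)%N,
    (forall k z, (k <= N)%N -> cabs (z - a) <= r -> cabs (we (take k w) z) <= B) &
    (forall k, (k <= N)%N -> c <= cabs (wp (take k w))^`().[a])].
    by apply: contrapT => no; apply: hwa => h1 h2 h3; apply: no.
  have [Nw hB hc] := hwa.
  have [k z kN zr|k [l [/andP[kl lN] hkl]]] := hN (fun k => wp (take k w)) a.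
    by rewrite wpE hB.
  have kN : (k <= N)%N by exact: leq_trans (ltnW kl) lN.
  exists (drop k (take l w), we (take k w) a); split=> /=.
  - rewrite -size_eq0 size_drop size_takel ?(leq_trans lN) // subn_eq0 -ltnNge //.
  - by apply: hB => //; rewrite subrr cabs0 ltW.
  move=> z zq; rewrite -wpE in zq.
  have [|y fy ya] := hop (wp (take k w)) a _ (hc k kN) z zq.
    by move=> y yr; rewrite wpE hB.
  have e : take l w = take k w ++ drop k (take l w).
    by rewrite -[in RHS](take_takel w (ltnW kl)) cat_take_drop.
  have := hkl y (ltac:(lra)); rewrite fy wpE {1}e we_cat -[we (take k w) y]wpE fy.
  by [].
have [sq hsq] := choice h.
(* The discs have the common radius r2 but moving centers; near a cluster point of the centers, a
   subsequence of the words tends to the identity on a fixed disc of radius r2 / 2. *)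
have [q hq] := @cluster_pt R (fun n => (sq n).2) B (fun n => let: And3 _ h _ := hsq n in h).
have h2 j := hq (r2 / 2) (ltac:(by rewrite divr_gt0)) j.
pose n_ j := sval (cid2 (h2 j)).
have nj j : (j <= n_ j)%N by rewrite /n_; case: cid2.
have nq j : cabs ((sq (n_ j)).2 - q) < r2 / 2 by rewrite /n_; case: cid2.
apply: (@no_limit_id (fun j => (sq (n_ j)).1) q (r2 / 2)).
- by rewrite divr_gt0.
- by move=> j; have [] := hsq (n_ j).
move=> e /inv_natS_lt [N hN]; exists N => n nN z zq.
have [_ _ h3] := hsq (n_ n); apply: (le_trans (h3 z _)).
  by have := cabs_tri q z (sq (n_ n)).2; have := nq n; rewrite (cabsB q); lra.
by apply: ltW; apply: hN; exact: leq_trans (nj n).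
Qed.

End Escape.
End Words.

(** * Traps *)

Section Traps.
Variable R : realType.
Local Notation C := R[i].
Variables (m : nat) (P : 'I_m -> {poly C}).
Implicit Types (v w s : seq 'I_m) (z u x p c : C) (K : C -> Prop).

Lemma fin_uniform (T : finType) (Q : T -> R -> Prop) :
  (forall j e e', e' <= e -> Q j e -> Q j e') ->
  (forall j, exists2 e, 0 < e & Q j e) -> exists2 e, 0 < e & forall j, Q j e.
Proof.
move=> mono h; suff [e e0 he] : exists2 e, 0 < e & forall j, j \in enum T -> Q j e.
  by exists e => // j; apply: he; rewrite mem_enum.
elim: (enum T) => [|j s [e e0 he]]; first by exists 1.
have [e' e'0 he'] := h j; exists (Num.min e e'); first by rewrite lt_min e0.
move=> i; rewrite inE => /orP[/eqP ->|/he hi].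
  by apply: mono he'; rewrite ge_min lexx orbT.
by apply: mono hi; rewrite ge_min lexx.
Qed.

Lemma words_uniform N (Q : seq 'I_m -> R -> Prop) :
  (forall w e e', e' <= e -> Q w e -> Q w e') ->
  (forall w, exists2 e, 0 < e & Q w e) ->
  exists2 e, 0 < e & forall w, (size w <= N)%N -> Q w e.
Proof.
elim: N Q => [|N IH] Q mono h.
  by have [e e0 he] := h [::]; exists e => // w; rewrite leqn0 => /nilP ->.
have [e1 e10 he1] := h [::].
have [e2 e20 he2] : exists2 e, 0 < e & forall j, forall w, (size w <= N)%N -> Q (j :: w) e.
  apply: fin_uniform => [j e e' ee' hj w wN|j]; first exact: mono (hj w wN).
  by apply: IH => [w e e'|w]; [exact: mono|exact: h].
exists (Num.min e1 e2); first by rewrite lt_min e10.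
move=> [|j w] wN; first by apply: mono he1; rewrite ge_min lexx.
by apply: mono (he2 j w wN); rewrite ge_min lexx orbT.
Qed.

Lemma words_lip N (B e : R) : 0 < e -> exists2 d, 0 < d &
  forall w x y, (size w <= N)%N -> cabs x <= B -> cabs y <= B -> cabs (x - y) < d ->
    cabs (we P w x - we P w y) < e.
Proof.
move=> e0; suff [d d0 hd] : exists2 d, 0 < d & forall w, (size w <= N)%N ->
    forall x y, cabs x <= B -> cabs y <= B -> cabs (x - y) < d ->
    cabs (we P w x - we P w y) < e.
  by exists d => // w x y /hd; apply.
apply: words_uniform => [w d d' dd' hd x y xB yB xy|w].
  by apply: hd => //; exact: lt_le_trans dd'.
have [L L0 hL] := poly_lip (wp P w) B; exists (e / L); first by rewrite divr_gt0.
move=> x y xB yB; rewrite ltr_pdivlMr // mulrC -!wpE; apply: le_lt_trans.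
exact: hL.
Qed.

(* The finite part of the postcritical set. *)
Definition post p := forall e, 0 < e -> exists w c,
  [/\ w != [::], (wp P w)^`().[c] = 0 & cabs (we P w c - p) < e].

Lemma post_closed : eclosed post.
Proof.
move=> p hp e e0; have e20 : 0 < e / 2 by rewrite divr_gt0.
have [q hq qp] := hp _ e20; have [w [c [w0 wc wq]]] := hq _ e20.
by exists w, c; split=> //; have := cabs_tri q (we P w c) p; lra.
Qed.

Lemma post_forward j p : post p -> post (P j).[p].
Proof.
move=> hp e e0; have [d d0 hd] := poly_cont (P j) p e0.
have [w [c [w0 wc wp']]] := hp d d0.
exists (rcons w j), c; split; first by case: (w).
  by rewrite deriv_wp_rcons wc mulr0.
by rewrite -cats1 we_cat /=; apply: hd.
Qed.

Lemma post_critical j c : (P j)^`().[c] = 0 -> post (P j).[c].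
Proof.
move=> hc e e0; exists [:: j], c; split => //; last by rewrite subrr cabs0.
by rewrite -[[:: j]]/(rcons [::] j) deriv_wp_rcons /= hc mul0r.
Qed.

Lemma post_critical_free p : ~ post p -> critical_free_at P p.
Proof.
move=> /existsNP[e] /not_implyP[e0 he]; exists e => // w c wc.
rewrite leNgt; apply/negP => lt; apply: he; exists w, c; split=> //.
by apply: contra_eq_neq wc => ->; rewrite /= derivX hornerC oner_neq0.
Qed.

(* The margin eta makes the notion stable under perturbation of P. *)
Definition trap K (eta : R) := [/\ 0 < eta, eopen K,
  forall j z, K z -> forall u, cabs (u - (P j).[z]) < eta -> K u &
  forall j c, (P j)^`().[c] = 0 -> forall u, cabs (u - (P j).[c]) < eta -> K u].

Hypothesis P2 : forall j, (2 < size (P j))%N.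

(** * Contraction of long words near a closed forward invariant set *)

Section Contraction.
Variables (rho : R) (P0 : C -> Prop).
Hypothesis hrho : escape_radius P rho.
Hypothesis tame : forall p, stable_at P rho p \/ critical_free_at P p.
Hypothesis P0closed : eclosed P0.
Hypothesis P0forward : forall j p, P0 p -> P0 (P j).[p].
Hypothesis P0stable : forall p, P0 p -> stable_at P rho p.
Hypothesis P0outer : forall p, P0 p -> 2 * rho < cabs p -> forall z, 2 * rho <= cabs z -> P0 z.

Lemma P0_we w p : P0 p -> P0 (we P w p).
Proof. by elim: w p => //= j w IH p /(P0forward j) /IH. Qed.

Lemma uniform_stable : exists2 d, 0 < d & forall p, P0 p -> cabs p <= 2 * rho ->
  forall w x z, cabs (x - p) < d -> cabs (z - p) < d ->
    cabs (we P w x) <= rho -> cabs (we P w z) <= 2 * rho.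
Proof.
apply: contrapT => no.
have h n : exists p, [/\ P0 p, cabs p <= 2 * rho & ~ forall w x z,
    cabs (x - p) < n.+1%:R^-1 -> cabs (z - p) < n.+1%:R^-1 ->
    cabs (we P w x) <= rho -> cabs (we P w z) <= 2 * rho].
  apply: contrapT => /forallNP hn; apply: no; exists n.+1%:R^-1.
    by rewrite invr_gt0 ltr0Sn.
  by move=> p Pp pr; apply: contrapT => hp; apply: (hn p).
have [p hp] := choice h.
have [q hq] := @cluster_pt R p (2 * rho) (fun n => let: And3 _ h _ := hp n in h).
have P0q : P0 q.
  by apply: P0closed => e /hq /(_ 0%N)[n _ hn]; exists (p n); have [] := hp n.
have [d d0 st] := P0stable P0q; have d20 : 0 < d / 2 by rewrite divr_gt0.
have [N hN] := inv_natS_lt d20; have [n nN hn] := hq _ d20 N.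
have [_ _ ] := hp n; apply => w x z xp zp; apply: st.
  by have := cabs_tri (p n) x q; have := hN n nN; move: xp; move: (n.+1%:R^-1) => i; lra.
by have := cabs_tri (p n) z q; have := hN n nN; move: zp; move: (n.+1%:R^-1) => i; lra.
Qed.

(** [P0] is abstract because it will be either the postcritical set or its union with a neighborhood
    of infinity. As long as the orbit of p stays in the disc of radius rho, [bounded_prefixes] makes
    the derivative of a long word at p small. Otherwise the last two letters carry the image of z
    beyond 2 rho, where [P0outer] puts every point in [P0]. *)
Lemma contraction : exists N : nat, (2 <= N)%N /\ exists2 d1, 0 < d1 &
  forall d, d <= d1 -> forall p w z, P0 p -> size w = N -> cabs (z - p) <= d ->
    exists2 p', P0 p' & cabs (we P w z - p') <= d / 2.
Proof.
have [rho0 _] := hrho.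
have [d0 d00 st] := uniform_stable.
(* [words_uniform] yields small numbers rather than large ones, so it is applied to the inverse of a
   Lipschitz constant. *)
have [L L1 hL] : exists2 L : R, 1 <= L & forall w x y, (size w <= 2)%N -> cabs x <= 2 * rho ->
    cabs y <= 2 * rho -> cabs (we P w x - we P w y) <= L * cabs (x - y).
  have [|w|e e0 he] := @words_uniform 2 (fun w e => forall x y, cabs x <= 2 * rho ->
    cabs y <= 2 * rho -> e * cabs (we P w x - we P w y) <= cabs (x - y)).
  - move=> w e e' ee' hw x y xr yr; apply: le_trans (hw x y xr yr).
    by rewrite ler_wpM2r ?cabs_ge0.
  - have [L L0 hL] := poly_lip (wp P w) (2 * rho); exists L^-1; first by rewrite invr_gt0.
    by move=> x y xr yr; rewrite mulrC ler_pdivrMr // mulrC -!wpE hL.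
  exists (e^-1 + 1); first by rewrite lerDr invr_ge0 ltW.
  move=> w x y w2 xr yr; have := he w w2 x y xr yr.
  rewrite mulrC -ler_pdivlMr // => h; apply: (le_trans h).
  by rewrite mulrC ler_wpM2r ?cabs_ge0 // lerDl.
have L0 : 0 < L by lra.
pose r := d0 / 2; have r0 : 0 < r by rewrite divr_gt0.
(* The linear term and the Taylor remainder will each be at most c d, and the last two letters
   multiply their sum by L, which gives d / 2. The factor 4 rho / r between c and c' is the Cauchy
   bound for the derivatives of tails. *)
pose c := (4 * L)^-1; have c0 : 0 < c by rewrite invr_gt0 mulr_gt0.
pose c' := c * r / (4 * rho); have c'0 : 0 < c' by rewrite divr_gt0 ?mulr_gt0.
have rho20 : 0 < 2 * rho by rewrite mulr_gt0.
have [N1 hN1] := bounded_prefixes P2 hrho tame rho20 r0 c'0.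
exists N1.+2; split => //.
exists (Num.min (Num.min rho r) (c * r ^+ 2 / (8 * rho))).
  by rewrite !lt_min rho0 r0 divr_gt0 ?mulr_gt0 ?exprn_gt0.
move=> d; rewrite !le_min => /andP[/andP[drho dr] dc] p w z P0p wN zp.
have d'0 : 0 <= d by apply: le_trans zp; exact: cabs_ge0.
have exact_pt q : P0 q -> exists2 p', P0 p' & cabs (q - p') <= d / 2.
  by move=> P0q; exists q => //; rewrite subrr cabs0 divr_ge0.
have wE : w = take N1 w ++ drop N1 w by rewrite cat_take_drop.
have s1 : size (take N1 w) = N1 by rewrite size_takel // wN ltnW.
have : size (drop N1 w) = 2 by rewrite size_drop wN -addn2 addKn.
move: wE s1; case: (drop N1 w) => [|j1 [|j2 []]] //; move: (take N1 w) => w1 wE s1 _.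
rewrite {}wE {w wN}.
have [pr|pr] := leP (cabs p) (2 * rho); last first.
  apply: exact_pt; apply: (P0outer P0p pr).
  have zr : rho <= cabs z by have := cabs_ub p z; rewrite (cabsB p); lra.
  have : w1 ++ [:: j1; j2] != [::] by case: (w1).
  by move=> /(we_escape2 hrho) /(_ zr); lra.
have pz : cabs (z - p) < d0 by rewrite /r in dr; lra.
have pp : cabs (p - p) < d0 by rewrite subrr cabs0.
have [w1p|w1p] := leP (cabs (we P w1 p)) rho; last first.
  have up : 2 * rho < cabs (we P (w1 ++ [:: j1]) p).
    rewrite we_cat; have := we_escape2 hrho (isT : [:: j1] != [::]) (ltW w1p); lra.
  have uz : rho < cabs (we P (w1 ++ [:: j1]) z).
    rewrite ltNge; apply/negP => h; have := st p P0p pr _ _ _ pz pp h; lra.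
  apply: exact_pt; apply: (P0outer (P0_we _ P0p) up).
  rewrite -[[:: j1; j2]]/([:: j1] ++ [:: j2]) catA we_cat.
  have := we_escape2 hrho (isT : [:: j2] != [::]) (ltW uz); lra.
have prefix k : cabs (we P (take k w1) p) <= rho.
  have := w1p; rewrite -{1}(cat_take_drop k w1) we_cat; exact: we_bounded.
have bnd k y : cabs (y - p) <= r -> cabs (we P (take k w1) y) <= 2 * rho.
  by move=> yr; apply: (st p P0p pr _ p y) => //; rewrite /r in yr; lra.
(* By the chain rule and the bound on tails, a derivative of w1 of size at least c would force all
   prefixes to have derivatives of size at least c'. *)
have der : cabs (wp P w1)^`().[p] < c.
  rewrite ltNge; apply/negP => hc; apply: (hN1 w1 p); first by rewrite s1.
    by move=> k y _; exact: bnd.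
  move=> k _; have := hc; rewrite -(cat_take_drop k w1) deriv_wp_cat cabsM.
  rewrite cat_take_drop.
  have : cabs (wp P (drop k w1))^`().[we P (take k w1) p] <= 2 * (2 * rho) / r.
    apply: cauchy_deriv => // y yr; rewrite wpE.
    apply: (st _ (P0_we (take k w1) P0p) _ _ (we P (take k w1) p) y).
    - by have := prefix k; lra.
    - by rewrite subrr cabs0.
    - by rewrite /r in yr; lra.
    - by rewrite -we_cat cat_take_drop.
  set D := cabs _; set F := cabs _ => hD hDF.
  have F0 : 0 <= F by exact: cabs_ge0.
  rewrite /c' ler_pdivrMr ?mulr_gt0 // -ler_pdivlMr //.
  apply: (le_trans hDF); apply: (le_trans (ler_wpM2r F0 hD)).
  by rewrite le_eqVlt; apply/orP; left; apply/eqP; field; rewrite gt_eqF.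
exists (we P (w1 ++ [:: j1; j2]) p); first exact: P0_we.
have zr : cabs (z - p) <= r by lra.
rewrite !we_cat; apply: (le_trans (hL _ _ _ _ _ _)) => //.
- by have := bnd (size w1) z zr; rewrite take_size.
- by lra.
have := @cauchy_taylor _ (wp P w1) p r (2 * rho) z r0 _ zr.
rewrite !wpE => h; have {}h := h (fun y yr => ltac:(by have := bnd (size w1) y yr; rewrite take_size wpE)).
have h1 : cabs ((wp P w1)^`().[p] * (z - p)) <= c * d.
  by rewrite cabsM ler_pM ?cabs_ge0 // ltW.
have h2 : 4 * (2 * rho) / r ^+ 2 * cabs (z - p) ^+ 2 <= c * d.
  have hd2 : cabs (z - p) ^+ 2 <= d * d by rewrite expr2 ler_pM ?cabs_ge0.
  rewrite mulrAC ler_pdivrMr ?exprn_gt0 //.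
  rewrite ler_pdivlMr ?mulr_gt0 // in dc.
  have := ler_wpM2l d'0 dc; have := ler_wpM2l (ltW rho0) hd2; lra.
have h3 : cabs (we P w1 z - we P w1 p) <= 2 * c * d.
  have := cabs_ub (we P w1 z - we P w1 p) ((wp P w1)^`().[p] * (z - p)); lra.
apply: (le_trans (ler_wpM2l (ltW L0) h3)).
by rewrite le_eqVlt; apply/orP; left; apply/eqP; rewrite /c; field; rewrite gt_eqF.
Qed.

(** The distance to [P0] shrinks only after N letters, so K bounds it along all words shorter than
    N, with tolerances [dl k] that decrease by g from d to d / 2 + g. A first letter shifts each
    word by one and leaves the slack g for eta; at the last length [contraction] supplies d / 2. *)
Lemma trap_near (d0 : R) : 0 < d0 -> (forall p, post p -> P0 p) -> exists K eta,
  [/\ trap K eta, forall p, P0 p -> K p & forall z, K z -> exists2 p, P0 p & cabs (z - p) < d0].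
Proof.
move=> d00 postP0; have [rho0 _] := hrho.
have [N [N2 [d1 d10 contr]]] := contraction.
pose d := Num.min (Num.min d0 1) d1.
have d'0 : 0 < d by rewrite !lt_min d00 ltr01.
have dd0 : d <= d0 by rewrite /d ge_min ge_min lexx.
have d'1 : d <= 1 by rewrite /d !ge_min lexx orbT.
have dd1 : d <= d1 by rewrite /d ge_min lexx orbT.
pose g := d / (2 * N%:R).
have NR0 : (0 : R) < N%:R by rewrite ltr0n ltnW.
have g0 : 0 < g by rewrite divr_gt0 // mulr_gt0.
pose dl k := d - k%:R * g.
have gN : N%:R * g = d / 2 by rewrite /g; field; rewrite gt_eqF.
have dlS k : dl k.+1 = dl k - g by rewrite /dl -natr1; ring.
have dl0 k : (k < N)%N -> g <= dl k.
  move=> kN; have : k.+1%:R * g <= d / 2 by rewrite -gN ler_wpM2r ?ler_nat // ltW.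
  by rewrite /dl -natr1; lra.
have dll k : dl k <= d by rewrite /dl gerBl mulr_ge0 // ltW.
have dlast k : k.+1 = N -> dl k = d / 2 + g.
  move=> kN; have : k.+1%:R * g = d / 2 by rewrite kN.
  by rewrite /dl -natr1; lra.
pose K z := forall w, (size w < N)%N -> exists2 p, P0 p & cabs (we P w z - p) < dl (size w).
have [e e0 he] := words_lip N (2 * rho + 2) g0.
pose eta := Num.min 1 e; have eta0 : 0 < eta by rewrite lt_min ltr01.
(* No uniform continuity is available near infinity, but there [P0] contains everything as soon as
   it contains one point. *)
have far u : 2 * rho <= cabs u -> (exists2 p, P0 p & 2 * rho < cabs p) -> K u.
  move=> ur [p P0p pr] w wN; exists (we P w u).
    apply: (P0outer P0p pr); apply: (le_trans ur); apply: (we_escape hrho); lra.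
  by rewrite subrr cabs0 (lt_le_trans g0) // dl0.
have P0K p : P0 p -> forall u, cabs (u - p) < eta -> K u.
  move=> P0p u; rewrite lt_min => /andP[up1 upe].
  have [pr|pr] := leP (cabs p) (2 * rho + 1); last first.
    by apply: far; [have := cabs_ub p u; rewrite (cabsB p); lra|exists p => //; lra].
  move=> w wN; exists (we P w p); first exact: P0_we.
  apply: lt_le_trans (dl0 _ wN); apply: he => //; [exact: ltnW| |]; last lra.
  by have := cabs_ub u p; lra.
exists K, eta; split; last 2 first.
- by move=> p P0p; apply: (P0K p) => //; rewrite subrr cabs0.
- move=> z /(_ [::] (ltnW N2)) [p P0p h]; exists p => //.
  by apply: (lt_le_trans h); apply: le_trans dd0.
split=> //.
- move=> z Kz.
  have [e' e'0 h'] : exists2 e', 0 < e' & forall w, (size w <= N)%N -> (size w < N)%N ->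
      forall u, cabs (u - z) < e' -> exists2 p, P0 p & cabs (we P w u - p) < dl (size w).
    apply: words_uniform => [w e1 e2 e12 h wN u uz|w].
      by apply: h => //; exact: lt_le_trans e12.
    have [wN|wN] := ltnP (size w) N; last by exists 1.
    have [p P0p wp'] := Kz w wN.
    have [e1 e10 h1] := poly_cont (wp P w) z (ltac:(by rewrite subr_gt0) :
      0 < dl (size w) - cabs (we P w z - p)).
    exists e1 => // _ u /h1; rewrite !wpE => h; exists p => //.
    by have := cabs_tri (we P w z) (we P w u) p; lra.
  by exists e' => // u uz w wN; apply: h' => //; exact: ltnW.
- move=> j z Kz u; rewrite lt_min => /andP[up1 upe].
  have [pr|pr] := leP (cabs (P j).[z]) (2 * rho + 1); last first.
    apply: far; first by have := cabs_ub (P j).[z] u; rewrite (cabsB (P j).[z]); lra.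
    have [p P0p] := Kz [:: j] N2; rewrite [we _ _ _]/= => h; exists p => //.
    have := cabs_ub (P j).[z] p; have := dll (size [:: j]); lra.
  move=> w wN; have hwu : cabs (we P w u - we P w (P j).[z]) < g.
    apply: he => //; [exact: ltnW| |]; last lra.
    by have := cabs_ub u (P j).[z]; lra.
  have [wN'|] := ltnP (size w).+1 N.
    have [p P0p h] := Kz (j :: w) wN'; exists p => //.
    have := cabs_tri (we P w (P j).[z]) (we P w u) p.
    by rewrite /= dlS -/(we P w (P j).[z]) in h; lra.
  move=> hN; have {hN}wN' : (size w).+1 = N by apply/eqP; rewrite eqn_leq wN hN.
  have [q P0q zq] := Kz [::] (ltnW N2).
  have zd : cabs (z - q) <= d by apply: (le_trans (ltW zq)).
  have [p P0p h] := contr d dd1 q (j :: w) z P0q wN' zd.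
  exists p => //; rewrite (dlast _ wN').
  have := cabs_tri (we P w (P j).[z]) (we P w u) p.
  by rewrite [we _ (_ :: _) _]/= -/(we P w (P j).[z]) in h; lra.
- by move=> j c /post_critical /postP0 /P0K.
Qed.

End Contraction.

(** * Existence of traps *)

Section Consequences.
Variables (rho : R).
Hypothesis hrho : escape_radius P rho.
Hypothesis post_stable : forall p, post p -> stable_at P rho p.

Lemma post_tame p : stable_at P rho p \/ critical_free_at P p.
Proof.
by have [/post_stable|/post_critical_free] := pselect (post p); [left|right].
Qed.

(** Otherwise the set Y of points with bounded orbit under P j, which contains a fixed point, would
    be open and closed, hence the whole plane. *)
Lemma not_all_stable (j : 'I_m) : exists p, ~ stable_at P rho p.
Proof.
apply: contrapT => /forallNP h; have {}h p : stable_at P rho p by exact: contrapT (h p).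
have [rho0 hesc] := hrho.
pose Y z := forall n, cabs (we P (nseq n j) z) <= rho.
have weS n z : we P (nseq n.+1 j) z = (P j).[we P (nseq n j) z].
  by rewrite -addn1 nseqD we_cat.
have [a Ya] : exists a, Y a.
  have [n hn] := size_P P2 j.
  have hX : size (P j - 'X) = n.+3 by rewrite size_polyDl ?hn // size_polyN size_polyX.
  have /closed_rootP[a] : size (P j - 'X) != 1%N by rewrite hX.
  rewrite rootE hornerD hornerN hornerX subr_eq0 => /eqP fa.
  have wa k : we P (nseq k j) a = a.
    by elim: k => [//|k IH]; rewrite weS IH.
  exists a => k; rewrite wa leNgt; apply/negP => lt.
  by have := hesc j a (ltW lt); rewrite fa; lra.
have : Y (2 * rho)%:C.
  apply: (@seg_connect _ (fun=> True) Y a) => //.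
    (* Stability gives the bound 2 rho only, but an iterate beyond rho would exceed 2 rho one letter
       later. *)
    move=> y _ Yy; have [d d0 st] := h y; exists d => // y' _ y'y n.
    rewrite leNgt; apply/negP => lt.
    have := we_escape2 hrho (isT : [:: j] != [::]) (ltW lt).
    rewrite [we _ [:: j] _]/= -weS => h2.
    have := st (nseq n.+1 j) y y'; rewrite subrr cabs0 => /(_ d0 y'y (Yy _)); lra.
  move=> y _ hy n; rewrite leNgt; apply/negP => lt.
  have [d d0 hd] := poly_cont (wp P (nseq n j)) y (ltac:(by rewrite subr_gt0) :
    0 < cabs (we P (nseq n j) y) - rho).
  have [y' [_ Yy'] /hd] := hy d d0; rewrite !wpE.
  have := cabs_ub (we P (nseq n j) y) (we P (nseq n j) y').
  by rewrite (cabsB (we _ _ y) (we _ _ y')); have := Yy' n; lra.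
move=> /(_ 0%N) h2; have : cabs ((2 * rho)%:C : C) <= rho := h2.
have rho2 : 0 <= 2 * rho by rewrite mulr_ge0 // ltW.
by rewrite cabsR ger0_norm //; lra.
Qed.

(** Points of modulus at least 2 rho are stable vacuously, so they can be added to the postcritical
    set. A point that is not stable lies outside this closed union, and a trap close enough to the
    union misses it. *)
Lemma outer_trap (j : 'I_m) : exists K eta, [/\ trap K eta,
  exists r, forall z, r <= cabs z -> K z & exists a, ~ K a].
Proof.
have [rho0 _] := hrho.
pose P0 z := post z \/ 2 * rho <= cabs z.
have P0c : eclosed P0.
  move=> z hz; have [|/existsNP[e /not_implyP[e0 he]]] := pselect (post z); first by left.
  have [e' e'0 he'] : exists2 e', 0 < e' & forall x, post x -> e' <= cabs (x - z).
    apply: contrapT => no; apply: he; apply: post_closed => // e' e'0.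
    apply: contrapT => no'; apply: no; exists e' => // x px; rewrite leNgt; apply/negP => lt.
    by apply: no'; exists x.
  right; rewrite leNgt; apply/negP => lt.
  have [x Px] := hz (Num.min e' (2 * rho - cabs z)) (ltac:(by rewrite lt_min e'0 subr_gt0)).
  rewrite lt_min => /andP[h1 h2]; case: Px => [/he'|]; first lra.
  by have := cabs_ub x z; lra.
have P0s p : P0 p -> stable_at P rho p.
  case=> [/post_stable //|pr]; exists rho => // w x z xp _ wx.
  have xr : rho < cabs x by have := cabs_ub p x; rewrite (cabsB p x); lra.
  by have := we_escape hrho w (ltW xr); lra.
have P0f j' p : P0 p -> P0 (P j').[p].
  case=> [/(post_forward j')|pr]; [by left|right].
  have := we_escape2 hrho (isT : [:: j'] != [::]) (_ : rho <= cabs p).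
  by move=> /(_ (ltac:(lra))) /=; lra.
have P0o p : P0 p -> 2 * rho < cabs p -> forall z, 2 * rho <= cabs z -> P0 z.
  by right.
have [a na] := not_all_stable j.
have {}na : ~ P0 a by move=> /P0s.
have [d d0 hd] : exists2 d, 0 < d & forall p, P0 p -> d <= cabs (a - p).
  apply: contrapT => no; apply: na; apply: P0c => e e0.
  apply: contrapT => no'; apply: no; exists e => // x px; rewrite leNgt; apply/negP => lt.
  by apply: no'; exists x; rewrite // cabsB.
have [|K [eta [tK P0K KP0]]] := trap_near hrho post_tame P0c P0f P0s P0o d0.
  by left.
exists K, eta; split=> //; first by exists (2 * rho) => z zr; apply: P0K; right.
by exists a => /KP0[p /hd]; lra.
Qed.

(** A bounded forward invariant set lies in the disc of radius rho, since other orbits escape. Hence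
    [P0outer] holds vacuously for the postcritical set itself. *)
Lemma bounded_trap (j : 'I_m) B : (forall p, post p -> cabs p <= B) -> exists K eta,
  trap K eta /\ exists B', forall z, K z -> cabs z <= B'.
Proof.
move=> postB; have [rho0 _] := hrho.
have postrho p : post p -> cabs p <= rho.
  move=> pp; rewrite leNgt; apply/negP => lt.
  have pn n : post (we P (nseq n j) p).
    by elim: n p pp {lt} => //= n IH p /(post_forward j) /IH.
  pose n := Num.truncn (B / cabs p).
  have p0 : 0 < cabs p by lra.
  have := we_escape_size hrho (nseq n.+1 j) (ltW lt); rewrite size_nseq => h1.
  have := postB _ (pn n.+1); have : B < n.+1%:R * cabs p.
    by rewrite -ltr_pdivrMr // truncnS_gt.
  have : n.+1%:R * cabs p <= 2 ^+ n.+1 * cabs p.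
    by rewrite ler_pM2r // -natrX ler_nat ltnW // ltn_expl.
  lra.
have [|||||K [eta [tK _ KP0]]] := @trap_near rho post hrho post_tame _ _ _ _ 1 ltr01.
- exact: post_closed.
- exact: post_forward.
- exact: post_stable.
- by move=> p /postrho; lra.
- by [].
exists K, eta; split=> //; exists (rho + 1) => z /KP0[p /postrho pr zp].
by have := cabs_ub z p; lra.
Qed.

End Consequences.

(** * Consequences of a trap *)

Section Trap.
Variables (K : C -> Prop) (eta : R).
Hypothesis tK : trap K eta.

Lemma trap_word w z : w != [::] -> K z -> forall u, cabs (u - we P w z) < eta -> K u.
Proof.
have [eta0 _ ha _] := tK; elim: w z => // j [|j' w] IH z _ Kz; first exact: ha.
by apply: IH => //; apply: (ha j z Kz); rewrite subrr cabs0.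
Qed.

Lemma trap_we w z : K z -> K (we P w z).
Proof.
have [eta0 _ _ _] := tK; case: w => // j w Kz.
by apply: (trap_word (w := j :: w) isT Kz); rewrite subrr cabs0.
Qed.

Lemma trap_critical w c : (wp P w)^`().[c] = 0 -> forall u, cabs (u - we P w c) < eta -> K u.
Proof.
have [eta0 _ _ hb] := tK; elim/last_ind: w => [|w j IH].
  by rewrite /= derivX hornerC => /eqP; rewrite oner_eq0.
rewrite deriv_wp_rcons => /eqP; rewrite mulf_eq0 -cats1 => /orP[/eqP h|/eqP h].
  by rewrite we_cat /=; apply: hb.
move=> u; rewrite we_cat; apply: (@trap_word [:: j]) => //.
by apply: IH => //; rewrite subrr cabs0.
Qed.

Lemma trap_post p : post p -> K p.
Proof.
have [eta0 _ _ _] := tK; move=> /(_ eta eta0) [w [c [_ wc wp']]].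
by apply: (trap_critical wc); rewrite cabsB.
Qed.

Lemma trap_prefix w z k : ~ K (we P w z) -> ~ K (we P (take k w) z).
Proof.
by apply: contra_not => /(trap_we (drop k w)); rewrite -we_cat cat_take_drop.
Qed.

Variable rho : R.
Hypothesis hrho : escape_radius P rho.
Hypothesis Kouter : forall z, rho <= cabs z -> K z.
Hypothesis Kstable : forall z, K z -> stable_at P rho z.

Lemma trap_tame p : stable_at P rho p \/ critical_free_at P p.
Proof.
have [/Kstable|nK] := pselect (K p); [by left|right].
have [eta0 _ _ _] := tK; exists eta => // w c wc; rewrite leNgt; apply/negP => lt.
by apply: nK; apply: (trap_critical wc); rewrite cabsB.
Qed.

(** If a long word keeps z outside K, so do its prefixes, whose images of z are therefore at
    distance at least eta from their own critical values. [inverse_cauchy] then bounds the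
    derivatives of the prefixes from below, against [bounded_prefixes]. *)
Lemma stable_trapped z : stable_at P rho z -> exists n, forall w, size w = n -> K (we P w z).
Proof.
have [eta0 _ _ _] := tK; have [rho0 _] := hrho.
move=> [d d0 st]; apply: contrapT => /forallNP no.
pose B := 2 * rho + eta; have B0 : 0 < B by rewrite addr_gt0 ?mulr_gt0.
have [|||N hN] := @bounded_prefixes _ _ _ P2 _ hrho trap_tame (2 * rho) (d / 2) (eta / (2 * B)).
- by rewrite mulr_gt0.
- by rewrite divr_gt0.
- by rewrite divr_gt0 // mulr_gt0.
have /existsNP[w /not_implyP[wN nK]] := no N.
have nKk k := trap_prefix (k := k) nK.
have small k : cabs (we P (take k w) z) < rho.
  by rewrite ltNge; apply/negP => /Kouter /nKk.
apply: (hN w z); first by rewrite wN.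
  move=> k y _ yz; apply: (st _ z) => //; rewrite ?subrr ?cabs0 //; last exact: ltW.
  by lra.
move=> k _; have [n hn] := size_wp P2 (take k w).
rewrite ler_pdivrMr ?mulr_gt0 // mulrC.
apply: (@inverse_cauchy _ _ n _ _ _ hn) => //.
  move=> c wc; rewrite !wpE leNgt; apply/negP => lt; apply: (nKk k).
  by apply: (trap_critical wc); rewrite cabsB.
move=> y; rewrite !wpE => hy.
have zr : cabs z <= rho by apply: (we_bounded hrho (w := take k w)); exact: ltW.
have wy : cabs (we P (take k w) y) < rho + eta.
  by have := cabs_ub (we P (take k w) y) (we P (take k w) z); have := small k; lra.
have := cabsD y (- z); rewrite cabsN /B.
have [yr|yr] := leP rho (cabs y); last lra.
by have := we_escape hrho (take k w) yr; lra.
Qed.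

End Trap.
End Traps.

(** * The Riemann sphere *)

Section Sphere.
Variable R : realType.
Local Notation C := R[i].
Local Notation Chat := (sphere R).
Implicit Types (z u v w a : C) (e d r rho : R).

(** Half the squared chordal distance, a rational expression that replaces the arc length in all
    estimates. *)
Definition sq (z w : Chat) : R := 1 - dot (stereo z) (stereo w).

Lemma sqC (z w : Chat) : sq z w = sq w z.
Proof. by rewrite /sq dot_sym. Qed.

Lemma sq_fin z w : sq (Some z) (Some w) =
  2 * cabs (z - w) ^+ 2 / ((1 + cabs z ^+ 2) * (1 + cabs w ^+ 2)).
Proof.
case: z w => a b [c d]; rewrite /sq /dot /= !cabs_sqr /=.
have := stereo_den_gt0 a b; have := stereo_den_gt0 c d => h1 h2.
rewrite !addrA; field; by rewrite !gt_eqF.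
Qed.

Lemma sq_inf w : sq None (Some w) = 2 / (1 + cabs w ^+ 2).
Proof.
case: w => c d; rewrite /sq /dot /= cabs_sqr; have h := stereo_den_gt0 c d.
by rewrite !addrA; field; rewrite gt_eqF.
Qed.

Lemma sdist_lt e : 0 < e -> exists2 d, 0 < d & forall z w : Chat, sq z w < d -> @sdist R z w < e.
Proof.
move=> e0; pose e1 := Num.min e pi.
have e10 : 0 < e1 by rewrite lt_min e0 pi_gt0.
have e1pi : e1 <= pi by rewrite ge_min lexx orbT.
exists (1 - cos e1).
  by rewrite subr_gt0 -[ltRHS]cos0 ltr_cos // in_itv /= ?lexx ?pi_ge0 // ltW.
move=> z w; rewrite /sq => h; have dw := dot_itv z w.
apply: lt_le_trans (_ : e1 <= e); last by rewrite ge_min lexx.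
by rewrite -ltr_cos ?in_itv /= ?acos_ge0 ?acos_lepi ?(ltW e10) //
  acosK ?in_itv //; lra.
Qed.

Lemma sq_lt d : 0 < d -> exists2 e, 0 < e & forall z w : Chat, @sdist R z w < e -> sq z w < d.
Proof.
move=> d0; pose d1 := Num.min d 1.
have d10 : 0 < d1 by rewrite lt_min d0 ltr01.
have d11 : d1 <= 1 by rewrite ge_min lexx orbT.
have itv : -1 <= 1 - d1 <= 1 by apply/andP; split; lra.
exists (acos (1 - d1)); first by rewrite acos_gt0 //; apply/andP; split; lra.
move=> z w; have dw := dot_itv z w; rewrite /sdist => h.
apply: lt_le_trans (_ : d1 <= d); last by rewrite ge_min lexx.
have : cos (acos (1 - d1)) < cos (acos (dot (stereo z) (stereo w))).
  by rewrite ltr_cos // in_itv /= acos_ge0 ?acos_lepi.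
by rewrite !acosK ?in_itv // /sq; lra.
Qed.

Lemma sdist_finite (A r : R) : 0 < r -> exists2 e, 0 < e & forall z (v : Chat),
  cabs z <= A -> sdist (Some z) v < e -> exists2 u, v = Some u & cabs (u - z) < r.
Proof.
(* An upper bound for (1 + |z| ^ 2) (1 + |u| ^ 2) / |u - z| ^ 2 when |u - z| >= r, so that [sq] is
   at least 2 / D there. *)
move=> r0; pose D := (1 + A ^+ 2) * (1 / r ^+ 2 + (`|A| / r + 1) ^+ 2).
have A1 : 1 <= 1 + A ^+ 2 by rewrite lerDl sqr_ge0.
have D1 : 1 <= 1 / r ^+ 2 + (`|A| / r + 1) ^+ 2.
  rewrite -[leLHS]add0r lerD ?divr_ge0 ?sqr_ge0 // exprn_ege1 //.
  by rewrite lerDr divr_ge0 // ltW.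
have D0 : 0 < D by rewrite mulr_gt0 //; lra.
have [e e0 he] := sq_lt (divr_gt0 (ltac:(lra) : 0 < 2) D0).
exists e => // z v zA /he {he}.
have zz : cabs z <= `|A| by apply: (le_trans zA); exact: ler_norm.
have z2 : 1 + cabs z ^+ 2 <= 1 + A ^+ 2.
  by rewrite lerD2l -[A ^+ 2]real_normK ?num_real // lerXn2r ?nnegrE ?cabs_ge0.
have z1 : 0 < 1 + cabs z ^+ 2 by rewrite ltr_pwDl // sqr_ge0.
case: v => [u|]; last first.
  rewrite sqC sq_inf ltr_pM2l // ltf_pV2 ?posrE // /D.
  rewrite ltNge => /negP[]; apply: (le_trans z2).
  by rewrite ler_peMr //; lra.
rewrite sq_fin => h; exists u => //; rewrite ltNge; apply/negP => ru.
have u1 : 0 < 1 + cabs u ^+ 2 by rewrite ltr_pwDl // sqr_ge0.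
set t := cabs (u - z) in ru.
have t0 : 0 < t by apply: lt_le_trans ru.
have hu : 1 + cabs u ^+ 2 <= t ^+ 2 * (1 / r ^+ 2 + (`|A| / r + 1) ^+ 2).
  rewrite mulrDr; apply: lerD.
    by rewrite mul1r ler_pdivlMr ?exprn_gt0 // mul1r lerXn2r ?nnegrE // ltW.
  rewrite -exprMn lerXn2r ?nnegrE ?cabs_ge0 //.
    by rewrite mulr_ge0 ?(ltW t0) // addr_ge0 // divr_ge0 // ltW.
  have := cabs_ub u z; rewrite -/t mulrDr mulr1.
  have : `|A| <= t * (`|A| / r).
    by rewrite mulrA ler_pdivlMr // mulrC ler_wpM2r.
  lra.
move: h; rewrite (cabsB z u) -/t ltr_pdivrMr ?mulr_gt0 // mulrAC ltr_pdivlMr //.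
rewrite -!mulrA ltr_pM2l // ltNge => /negP; apply.
apply: (@le_trans _ _ ((1 + A ^+ 2) * (t ^+ 2 * (1 / r ^+ 2 + (`|A| / r + 1) ^+ 2)))).
  by rewrite ler_pM // ltW.
by rewrite /D le_eqVlt; apply/orP; left; apply/eqP; ring.
Qed.

Lemma sdist_small e : 0 < e -> exists2 r, 0 < r & forall z u,
  cabs (z - u) < r -> @sdist R (Some z) (Some u) < e.
Proof.
move=> /sdist_lt[d d0 hd]; exists (Num.min 1 (d / 2)).
  by rewrite lt_min ltr01 divr_gt0.
move=> z u; rewrite lt_min => /andP[h1 h2]; apply: hd; rewrite sq_fin.
have z1 : 1 <= 1 + cabs z ^+ 2 by rewrite lerDl sqr_ge0.
have u1 : 1 <= 1 + cabs u ^+ 2 by rewrite lerDl sqr_ge0.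
rewrite ltr_pdivrMr; last by rewrite mulr_gt0 //; lra.
have : d <= d * ((1 + cabs z ^+ 2) * (1 + cabs u ^+ 2)).
  by rewrite ler_peMr ?(ltW d0) // -[leLHS]mulr1 ler_pM.
have : cabs (z - u) ^+ 2 <= cabs (z - u) by rewrite expr2 ler_piMl ?cabs_ge0 // ltW.
lra.
Qed.

Lemma sdist_inf e : 0 < e -> exists2 r, 0 < r & forall u, r < cabs u -> @sdist R None (Some u) < e.
Proof.
move=> /sdist_lt[d d0 hd]; exists (1 + 2 / d); first by rewrite addr_gt0 // divr_gt0.
move=> u ru; apply: hd; rewrite sq_inf.
have u1 : 1 < cabs u by apply: le_lt_trans ru; rewrite lerDl divr_ge0 // ltW.
rewrite ltr_pdivrMr ?ltr_pwDl ?sqr_ge0 // mulrC -ltr_pdivrMr //.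
have : cabs u < cabs u ^+ 2 by rewrite expr2 ltr_pMl //; lra.
lra.
Qed.

Lemma sdist_near_inf rho : exists2 e, 0 < e & forall v : Chat, sdist None v < e ->
  forall u, v = Some u -> rho < cabs u.
Proof.
have r1 : 0 < 1 + rho ^+ 2 by rewrite ltr_pwDl // sqr_ge0.
have [e e0 he] := sq_lt (divr_gt0 (ltac:(lra) : 0 < 2) r1).
exists e => // v /he h u vu; move: h; rewrite vu sq_inf ltr_pM2l //.
have u1 : 0 < 1 + cabs u ^+ 2 by rewrite ltr_pwDl // sqr_ge0.
rewrite ltf_pV2 ?posrE // ltrD2l => h; rewrite ltNge; apply/negP => ur.
have rho0 : 0 <= rho by apply: le_trans ur; exact: cabs_ge0.
have : cabs u ^+ 2 <= rho ^+ 2 by rewrite lerXn2r ?nnegrE ?cabs_ge0.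
lra.
Qed.

(* The inverse of the Moebius map g |-> 1 / (g - a). *)
Definition moebius a (u : C) : Chat := if u == 0 then None else Some (a + u^-1).

Lemma moebius_continuous a e : 0 < e -> exists2 d, 0 < d & forall u v,
  cabs (u - v) <= d -> sdist (moebius a u) (moebius a v) < e.
Proof.
move=> /sdist_lt[d d0 hd]; pose k := 1 + cabs a ^+ 2.
have k1 : 1 <= k by rewrite lerDl sqr_ge0.
have k0 : 0 < k by lra.
(* Without k, the left side is |u| ^ 2 + |a u + 1| ^ 2, which is at least 1 / k by Cauchy-Schwarz
   since 1 = (a u + 1) - a u. It absorbs the singularity of 1 / u. *)
have hk u : u != 0 -> cabs u ^+ 2 * (1 + cabs (a + u^-1) ^+ 2) * k >= 1.
  move=> u0; have -> : cabs u ^+ 2 * (1 + cabs (a + u^-1) ^+ 2) =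
    cabs u ^+ 2 + cabs (a * u + 1) ^+ 2.
    rewrite mulrDr mulr1 -exprMn -cabsM; congr (_ + cabs _ ^+ 2); by field.
  have h : 1 <= cabs (a * u + 1) + cabs a * cabs u.
    by rewrite -cabsM -[leLHS]cabs1; have := cabsD (a * u + 1) (- (a * u)); rewrite cabsN [a * u + 1]addrC addrK.
  rewrite /k; move: h (cabs_ge0 (a * u + 1)) (cabs_ge0 u) (cabs_ge0 a).
  move: (cabs (a * u + 1)) (cabs a) (cabs u) => x y t h x0 t0 y0.
  have : 1 <= (x + y * t) ^+ 2 by rewrite exprn_ege1.
  have := sqr_ge0 (t - x * y); rewrite !expr2; lra.
exists (Num.min 1 (d / (4 * k ^+ 2))); first by rewrite lt_min ltr01 divr_gt0 // mulr_gt0 // exprn_gt0.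
have dd : d / 2 < d by rewrite ltr_pdivrMr //; lra.
have inf u : cabs u <= Num.min 1 (d / (4 * k ^+ 2)) -> u != 0 -> sq None (Some (a + u^-1)) < d.
  rewrite le_min => /andP[h1 h2] u0; rewrite sq_inf; apply: le_lt_trans dd.
  have D0 : 0 < 1 + cabs (a + u^-1) ^+ 2 by rewrite ltr_pwDl // sqr_ge0.
  rewrite ler_pdivrMr //; have := hk u u0.
  rewrite ler_pdivlMr ?mulr_gt0 ?exprn_gt0 // in h2.
  have u2 : cabs u ^+ 2 <= cabs u by rewrite expr2 ler_piMl ?cabs_ge0.
  have k2 : k <= k ^+ 2 by rewrite expr2 ler_peMl // ltW.
  have h3 : cabs u * (4 * k) <= d by apply: le_trans h2; rewrite ler_wpM2l ?cabs_ge0 // ler_wpM2l.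
  have h4 : cabs u ^+ 2 * (4 * k) <= d by apply: le_trans h3; rewrite ler_wpM2r // mulr_ge0 // ltW.
  have := ler_wpM2r (ltW D0) h4; move: (1 + _) => D; lra.
move=> u v uv; rewrite /moebius; apply: hd.
case: (eqVneq u 0) => [u0|u0]; case: (eqVneq v 0) => [v0|v0].
- by rewrite /sq dot_stereo subrr.
- by apply: inf => //; move: uv; rewrite u0 sub0r cabsN.
- by rewrite sqC; apply: inf => //; move: uv; rewrite v0 subr0.
rewrite sq_fin; apply: le_lt_trans dd.
have D0 : 0 < 1 + cabs (a + u^-1) ^+ 2 by rewrite ltr_pwDl // sqr_ge0.
have D0' : 0 < 1 + cabs (a + v^-1) ^+ 2 by rewrite ltr_pwDl // sqr_ge0.
rewrite ler_pdivrMr ?mulr_gt0 //.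
have -> : a + u^-1 - (a + v^-1) = - (u - v) * (u^-1 * v^-1) by field; rewrite u0 v0.
rewrite cabsM cabsN cabsM !cabsV.
have := hk u u0; have := hk v v0.
have cu : 0 < cabs u by rewrite cabs_gt0.
have cv : 0 < cabs v by rewrite cabs_gt0.
move: uv; rewrite le_min => /andP[h1 h2].
rewrite ler_pdivlMr ?mulr_gt0 ?exprn_gt0 // in h2.
have u2 : cabs (u - v) ^+ 2 <= cabs (u - v) by rewrite expr2 ler_piMl ?cabs_ge0.
have h3 : cabs (u - v) ^+ 2 * (4 * k ^+ 2) <= d.
  by apply: le_trans h2; rewrite ler_wpM2r // mulr_ge0 // exprn_ge0 // ltW.
move: (1 + cabs (a + u^-1) ^+ 2) (1 + cabs (a + v^-1) ^+ 2) D0 D0' => D D' D0 D0' hv hu.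
have hh : 1 <= (cabs u ^+ 2 * D * k) * (cabs v ^+ 2 * D' * k).
  by rewrite -[leLHS]mulr1 ler_pM.
rewrite !exprMn !exprVn.
have -> : 2 * (cabs (u - v) ^+ 2 * ((cabs u ^+ 2)^-1 * (cabs v ^+ 2)^-1)) =
   2 * cabs (u - v) ^+ 2 / (cabs u ^+ 2 * cabs v ^+ 2) by field; rewrite !gt_eqF.
rewrite ler_pdivrMr ?mulr_gt0 ?exprn_gt0 //.
apply: (@le_trans _ _ (2 * cabs (u - v) ^+ 2 * ((cabs u ^+ 2 * D * k) * (cabs v ^+ 2 * D' * k)))).
  by rewrite ler_peMr // mulr_ge0 // sqr_ge0.
have E0 : 0 <= D * D' * (cabs u ^+ 2 * cabs v ^+ 2).
  by rewrite !mulr_ge0 ?sqr_ge0 // ltW.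
have := ler_wpM2r E0 h3; lra.
Qed.

Lemma ball_sphere (z : Chat) e : ball z e = [set w | sdist z w < e].
Proof. exact: (@ballEmdist R Chat z e). Qed.

Lemma nbhs_fin z (U : set Chat) :
  nbhs (Some z : Chat) U <-> exists2 r, 0 < r & forall u, cabs (u - z) < r -> U (Some u).
Proof.
split=> [/nbhs_ballP[e /= e0 he]|[r r0 hr]].
  have [r r0 hr] := sdist_small e0; exists r => // u uz; apply: he.
  by rewrite ball_sphere /=; apply: hr; rewrite cabsB.
have [e e0 he] := sdist_finite (cabs z) r0.
apply/nbhs_ballP; exists e => //= v; rewrite ball_sphere /= => h.
by have [u -> uz] := he z v (lexx _) h; apply: hr.
Qed.

Lemma nbhs_inf (U : set Chat) :
  nbhs (None : Chat) U <-> U None /\ exists2 r, 0 < r & forall u, r < cabs u -> U (Some u).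
Proof.
split=> [h|[UN [r r0 hr]]].
  split; first exact: (nbhs_singleton h).
  move: h => /nbhs_ballP[e /= e0 he]; have [r r0 hr] := sdist_inf e0.
  by exists r => // u ur; apply: he; rewrite ball_sphere /=; apply: hr.
have [e e0 he] := sdist_near_inf r.
apply/nbhs_ballP; exists e => //= -[u|//]; rewrite ball_sphere /= => h.
by apply: hr; apply: he h _ erefl.
Qed.

Lemma open_fin (X : C -> Prop) : eopen X -> open [set z : Chat | exists2 u, z = Some u & X u].
Proof.
move=> Xo; rewrite openE => _ [u -> Xu]; apply/nbhs_fin.
by have [e e0 he] := Xo u Xu; exists e => // w /he; exists w.
Qed.

Lemma closure_fin (A : set Chat) z : closure A (Some z) <->
  forall e, 0 < e -> exists2 u, A (Some u) & cabs (u - z) < e.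
Proof.
split=> [h e e0|h U /nbhs_fin[r r0 hr]].
  have [|w [Aw [u wu uz]]] := h [set w | exists2 u, w = Some u & cabs (u - z) < e].
    by apply/nbhs_fin; exists e => // u uz; exists u.
  by exists u => //; rewrite -wu.
by have [u Au uz] := h r r0; exists (Some u); split=> //; apply: hr.
Qed.

Lemma compact_square z r : compact [set w : Chat | exists2 u, w = Some u &
  `|complex.Re u - complex.Re z| <= r /\ `|complex.Im u - complex.Im z| <= r].
Proof.
pose a := complex.Re z; pose b := complex.Im z.
have cpt : compact (`[a - r, a + r]%classic `*` `[b - r, b + r]%classic : set (R * R)).
  by apply: compact_setX; apply: segment_compact.
pose F (p : R * R) : Chat := Some (p.1 +i* p.2).
have cF : continuous F.
  move=> [x y] U /nbhs_fin[e e0 he].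
  exists (ball x (e / 2), ball y (e / 2)).
    by split; apply: nbhsx_ballx; rewrite divr_gt0.
  move=> [x' y'] [/= h1 h2]; apply: he; apply: (le_lt_trans (cabs_ReIm _)) => /=.
  by move: h1 h2; rewrite /ball /= distrC (distrC y); lra.
have := continuous_compact (continuous_subspaceT cF) cpt.
congr compact; apply/seteqP; split=> w.
  move=> [[x y] [/=]]; rewrite !in_itv /= => /andP[h1 h2] /andP[h3 h4] <-.
  by exists (x +i* y) => //=; rewrite !ler_norml; split; apply/andP; split; rewrite -/a -/b; lra.
move=> [[x y] -> /= []]; rewrite !ler_norml => /andP[h1 h2] /andP[h3 h4].
by exists (x, y) => //=; rewrite !in_itv /= /a /b; split; apply/andP; split; lra.
Qed.

Lemma uniform_cvgP (A : set Chat) (f : nat -> Chat -> Chat) (g : Chat -> Chat) :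
  {uniform A, f @ \oo --> g} <-> forall e, 0 < e -> exists N, forall n, (N <= n)%N ->
    forall z : Chat, A z -> sdist (g z) (f n z) < e.
Proof.
split=> [h e e0|h U /uniform_nbhs[E []]].
  2: rewrite -entourage_ballE => -[e /= e0 he] hE.
  have : nbhs (g : {uniform` A -> Chat}) [set h | forall y : Chat, A y -> ball (g y) e (h y)].
    apply/uniform_nbhs; exists [set xy | ball xy.1 e xy.2]; split=> //.
    by rewrite -entourage_ballE; exists e.
  by move=> /h[N _ hN]; exists N => n /hN /= hn z Az; have := hn z Az; rewrite ball_sphere.
have [N hN] := h e e0; exists N => // n /hN hn; apply: hE => z Az; apply: he => /=.
by rewrite ball_sphere; exact: hn.
Qed.

Lemma is_derive_hornerC (p : {poly C}) c :
  is_derive (c : C^o) (1 : C^o) ((fun z => p.[z]) : C^o -> C^o) p^`().[c].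
Proof.
elim/poly_ind: p => [|p a IH].
  rewrite deriv0 horner0; have -> : (fun z => (0 : {poly C}).[z]) = cst 0.
    by apply/funext => z; rewrite horner0.
  exact: is_derive_cst.
have -> : (fun z => (p * 'X + a%:P).[z]) = (fun z => p.[z]) * id + cst a.
  by apply/funext => z; rewrite hornerMXaddC.
have h := is_deriveD (is_deriveM IH (is_derive_id (c : C^o) (1 : C^o))) (is_derive_cst (a : C^o) (c : C^o) (1 : C^o)).
apply: is_derive_eq h _.
rewrite derivD derivM derivX derivC !hornerE /=.
rewrite -[_%:A]/(p.[c] * 1) -[c *: _]/(c * _) mulr1 addrC; congr (_ + _).
exact: mulrC.
Qed.

Lemma critical_pointE (p : {poly C}) c :
  critical_point (omap (fun z => p.[z])) (Some c : Chat) <-> p^`().[c] = 0.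
Proof.
have h := is_derive_hornerC p c.
split=> [h0|h0]; last by have := is_derive_eq h h0.
by rewrite -(@derive_val _ _ _ _ _ _ _ h); exact: (@derive_val _ _ _ _ _ _ _ h0).
Qed.

End Sphere.

(** * Fatou and Julia sets of the semigroup *)

Section Semigroup.
Variable R : realType.
Local Notation C := R[i].
Local Notation Chat := (sphere R).
Variables (m : nat) (P : 'I_m -> {poly C}).
Implicit Types (w v s : seq 'I_m) (z u p c a : C) (K : C -> Prop).

Definition wmap w : Chat -> Chat := omap (we P w).

Definition sgp : set (Chat -> Chat) :=
  generated (range (fun j => omap (fun z => (P j).[z]) : Chat -> Chat)).

Lemma wmap_cat w v : wmap (w ++ v) = wmap v \o wmap w.
Proof. by apply/funext => -[z|//]; rewrite /wmap /= we_cat. Qed.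

Lemma sgpP (f : Chat -> Chat) : sgp f <-> exists2 w, w != [::] & f = wmap w.
Proof.
split.
  move=> /(_ [set g | exists2 w, w != [::] & g = wmap w]); apply; split.
    move=> g h [w w0 ->] [v v0 ->]; exists (v ++ w); last by rewrite wmap_cat.
    by case: (v) v0.
  by move=> _ [j _ <-]; exists [:: j] => //; apply/funext => -[].
move=> [w + ->] A [Acomp Agen]; elim: w => // j w IH _.
have Aj : A (wmap [:: j]).
  by apply: Agen; exists j => //; apply/funext => -[].
case: w IH => [//|k w] IH; rewrite -cat1s wmap_cat; apply: Acomp => //.
exact: IH.
Qed.

Lemma word_subseq (w : nat -> seq 'I_m) :
  (exists v, exists2 k : nat -> nat, {homo k : i j / (i < j)%N} & forall n, w (k n) = v) \/
  (exists2 k : nat -> nat, {homo k : i j / (i < j)%N} & forall n, (n <= size (w (k n)))%N).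
Proof.
have [h|/existsNP[i /existsNP[N hN]]] :=
    pselect (forall i N, exists2 n, (N <= n)%N & (i <= size (w n))%N).
  by right; exact: (@increasing_choice (fun i n => i <= size (w n))%N).
left; pose code n : i.-bseq 'I_m := insub_bseq i (w n).
have [t ht] : exists t, forall M, exists2 n, (M <= n)%N & code n = t.
  apply: contrapT => /forallNP no.
  have {}no t : exists M, forall n, (M <= n)%N -> code n <> t.
    apply: contrapT => no'; apply: (no t) => M; apply: contrapT => h; apply: no'.
    by exists M => n Mn hn; apply: h; exists n.
  have [M hM] := choice no.
  pose M0 := (\max_t M t)%N; have [] := hM (code M0) M0 _ erefl.
  exact: leq_bigmax.
exists t; have [|k kmono hk] := @increasing_choice (fun _ n => (N <= n)%N /\ code n = t).
  move=> _ M; have [n nM <-] := ht (maxn M N); exists n.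
    by apply: leq_trans nM; rewrite leq_maxl.
  by split=> //; apply: leq_trans nM; rewrite leq_maxr.
exists k => // n; have [kN <-] := hk n.
rewrite /code /insub_bseq insubdK //; apply: ltnW.
by rewrite ltnNge; apply/negP => ik; apply: hN; exists (k n).
Qed.

(** A sequence without a constant subsequence has one with lengths tending to infinity, because only
    finitely many words have bounded length. So only long words need to be treated. *)
Lemma normal_intro (U : set Chat) :
  (forall w : nat -> seq 'I_m, (forall n, (n <= size (w n))%N) -> exists k : nat -> nat, exists g,
     {homo k : i j / (i < j)%N} /\ forall e : R, 0 < e -> exists N, forall n, (N <= n)%N ->
       forall z : Chat, U z -> sdist (g z) (wmap (w (k n)) z) < e) ->
  normal_on U sgp.
Proof.
move=> h f fG.
have /choice[w hw] : forall n, exists w, w != [::] /\ f n = wmap w.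
  by move=> n; have /sgpP[w w0 wE] := fG n; exists w.
have cvg_of k (g : Chat -> Chat) : (forall e : R, 0 < e -> exists N, forall n, (N <= n)%N ->
       forall z : Chat, U z -> sdist (g z) (wmap (w (k n)) z) < e) ->
    {family compactly_in U, (f \o k) @ \oo --> g}.
  move=> hk; apply/fam_cvgP => A [AU _]; apply/uniform_cvgP => e /hk[N hN].
  by exists N => n /hN hn z /AU /hn; have [_ <-] := hw (k n).
have [[v [k kmono hk]]|[k kmono hk]] := word_subseq w.
  exists k, (wmap v); split=> //; apply: cvg_of => e e0; exists 0%N => n _ z _.
  by rewrite hk sdistxx.
have [k' [g [k'mono hk']]] := h (w \o k) hk.
exists (k \o k'), g; split=> [i j ij|]; first by apply/kmono/k'mono.
exact: cvg_of.
Qed.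

(** Failure of stability gives words w_n and points x_n, z_n tending to p with |w_n(x_n)| <= rho and
    |w_n(z_n)| > 2 rho. A uniform limit on a compact square about p forces these images together on
    the sphere. *)
Lemma Fatou_stable (rho : R) p : 0 < rho -> Fatou sgp (Some p) -> stable_at P rho p.
Proof.
move=> rho0 [U [Uo Up Unorm]].
have /nbhs_fin[r r0 hr] : nbhs (Some p : Chat) U by apply: open_nbhs_nbhs.
apply: contrapT => nst.
(* The bound rho / 4 excludes the empty word, which is not in the semigroup; r / 4 keeps the points
   in the square. *)
pose d n := Num.min (Num.min (r / 4) (rho / 4)) n.+1%:R^-1 : R.
have d0 n : 0 < d n by rewrite !lt_min !divr_gt0 // invr_gt0 ltr0Sn.
have h n : exists t : seq 'I_m * (C * C), [/\ cabs (t.2.1 - p) < d n, cabs (t.2.2 - p) < d n,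
    cabs (we P t.1 t.2.1) <= rho & 2 * rho < cabs (we P t.1 t.2.2)].
  apply: contrapT => /forallNP no; apply: nst; exists (d n) => // w x z h1 h2 h3.
  by rewrite leNgt; apply/negP => lt; apply: (no (w, (x, z))).
have [t ht] := choice h.
pose w n := (t n).1; pose x n := (t n).2.1; pose z n := (t n).2.2.
have xp n : cabs (x n - p) < d n by have [] := ht n.
have zp n : cabs (z n - p) < d n by have [] := ht n.
have wx n : cabs (we P (w n) (x n)) <= rho by have [] := ht n.
have wz n : 2 * rho < cabs (we P (w n) (z n)) by have [] := ht n.
have w0 n : w n != [::].
  apply/eqP => wn; have := wx n; have := wz n; rewrite wn /=.
  have := xp n; have := zp n; rewrite !lt_min => /andP[/andP[_ h1] _] /andP[/andP[_ h2] _].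
  by have := cabs_tri p (z n) (x n); have := cabs_ub (z n) (x n); rewrite (cabsB p (x n)); lra.
have [|k [g [kmono kcvg]]] := Unorm (fun n => wmap (w n)).
  by move=> n; apply/sgpP; exists (w n).
pose S : set Chat := [set v : Chat | exists2 u, v = Some u &
  `|complex.Re u - complex.Re p| <= r / 4 /\ `|complex.Im u - complex.Im p| <= r / 4].
have SU : compactly_in U S.
  split; last exact: compact_square.
  move=> _ [u -> [h1 h2]]; apply: hr; apply: (le_lt_trans (cabs_ReIm _)).
  by rewrite !raddfB /=; lra.
have Sin u : cabs (u - p) < r / 4 -> S (Some u).
  move=> up; exists u => //; rewrite -!raddfB.
  by split; [apply: (le_trans (cabs_Re _))|apply: (le_trans (cabs_Im _))]; exact: ltW.
have r40 : 0 < r / 4 by rewrite divr_gt0.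
have dr n u : cabs (u - p) < d n -> cabs (u - p) < r / 4.
  by rewrite !lt_min => /andP[/andP[]].
move: kcvg => /fam_cvgP /(_ S SU) /uniform_cvgP kcvg.
have [e1 e10 he1] := sdist_finite rho rho0.
pose e := e1 / 8; have e0 : 0 < e by rewrite divr_gt0.
have [N hN] := kcvg e e0.
have [r' r'0 hr'] := sdist_small e0.
have [dl dl0 hdl] := poly_cont (wp P (w (k N))) p r'0.
(* The limit g inherits approximate continuity at p from the single map of index N. The two errors 3
   e and the two errors e of the final comparison make up e1 = 8 e. *)
have near u : cabs (u - p) < r / 4 -> cabs (u - p) < dl ->
    sdist (g (Some p)) (g (Some u)) < 3 * e.
  move=> ur /hdl; rewrite !wpE cabsB => /hr' h1.
  have h2 := hN N (leqnn _) _ (Sin u ur).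
  have h3 := hN N (leqnn _) _ (Sin p (ltac:(by rewrite subrr cabs0))).
  have := @sdist_triangle R (wmap (w (k N)) (Some p)) (g (Some p)) (g (Some u)).
  have := @sdist_triangle R (wmap (w (k N)) (Some u)) (wmap (w (k N)) (Some p)) (g (Some u)).
  by move: h1 h2 h3; rewrite /comp /= (sdist_sym (g (Some u))); lra.
have [M hM] := inv_natS_lt dl0.
pose n := maxn N M; have nN : (N <= n)%N by rewrite leq_maxl.
have kn i : (i <= k i)%N.
  elim: i => // i IH; apply: (leq_ltn_trans IH); exact: kmono.
have dn u : cabs (u - p) < d (k n) -> cabs (u - p) < dl.
  rewrite lt_min => /andP[_ h1]; apply: (lt_trans h1); apply: hM.
  by apply: leq_trans (kn n); rewrite leq_maxr.
have h1 := near _ (dr _ _ (xp (k n))) (dn _ (xp (k n))).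
have h2 := near _ (dr _ _ (zp (k n))) (dn _ (zp (k n))).
have h3 := hN n nN _ (Sin _ (dr _ _ (xp (k n)))).
have h4 := hN n nN _ (Sin _ (dr _ _ (zp (k n)))).
have : sdist (Some (we P (w (k n)) (x (k n)))) (Some (we P (w (k n)) (z (k n)))) < e1.
  pose X : Chat := wmap (w (k n)) (Some (x (k n))).
  pose Z : Chat := wmap (w (k n)) (Some (z (k n))).
  pose gx := g (Some (x (k n))); pose gz := g (Some (z (k n))); pose gp := g (Some p).
  have h1' : sdist gp gx < 3 * e := h1.
  have h2' : sdist gp gz < 3 * e := h2.
  have h3' : sdist gx X < e := h3.
  have h4' : sdist gz Z < e := h4.
  have h5 := @sdist_triangle R gx X Z; have h6 := @sdist_triangle R gp gx Z.
  have h7 := @sdist_triangle R gz gp Z.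
  have : sdist X Z < e1; last by [].
  by rewrite (sdist_sym gx X) in h3'; rewrite (sdist_sym gp gx) in h1'; rewrite /e in h1' h2' h3' h4' *; lra.
move=> /(he1 _ _ (wx (k n)))[u [<-] uz].
have := wz (k n); have := wx (k n).
have := cabs_ub (we P (w (k n)) (z (k n))) (we P (w (k n)) (x (k n))); lra.
Qed.

Hypothesis P2 : forall j, (2 < size (P j))%N.

Lemma Fatou_inf : Fatou sgp None.
Proof.
have [T T0 hT] := escape_exists P2; have hrho := hT T (lexx _).
pose U : set Chat := [set z | forall u, z = Some u -> T < cabs u].
exists U; split=> //.
  rewrite openE => -[u|] Uu; last first.
    by apply/nbhs_inf; split=> //; exists T => // v vT _ [<-].
  apply/nbhs_fin; have := Uu u erefl; rewrite -subr_gt0 => uT.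
  exists (cabs u - T) => // v vu _ [<-].
  by have := cabs_ub u v; rewrite (cabsB u v); lra.
apply: normal_intro => w hw; exists id, (fun=> None); split=> // e e0.
have [r r0 hr] := sdist_inf e0.
exists (Num.truncn (r / T)).+1 => n nN [u|] Uu; last by rewrite sdistxx.
apply: hr; have uT := Uu u erefl.
apply: lt_le_trans (we_escape_size hrho (w n) (ltW uT)).
have : r < n%:R * T.
  rewrite -ltr_pdivrMr //; apply: (lt_le_trans (truncnS_gt _)).
  by rewrite ler_nat.
have : n%:R <= 2 ^+ size (w n) :> R.
  rewrite -natrX ler_nat; apply: (leq_trans (hw n)); exact: ltnW (ltn_expl _ _).
have : (0 : R) <= n%:R by [].
nra.
Qed.

(** Up to sign, the difference quotient of 1 / (f - a) at v is q / ((f - a) (f(v) - a)), with q that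
    of f. The maximum principle for q / (f - a) on a disc about v gives the bound. *)
Lemma inverse_lip (f : {poly C}) a z (r eta : R) : 0 < r -> 0 < eta ->
  (forall u, cabs (u - z) <= r -> eta <= cabs (f.[u] - a)) ->
  forall u v : C, cabs (u - z) <= r / 4 -> cabs (v - z) <= r / 4 ->
    cabs ((f.[u] - a)^-1 - (f.[v] - a)^-1) <= 4 / (eta * r) * cabs (u - v).
Proof.
move=> r0 eta0 hf u v uz vz.
have [q hq _] := poly_quot f v.
have fE y : f.[y] - f.[v] = q.[y] * (y - v).
  by rewrite {1}hq hornerD hornerM hornerXsubC hornerC addrK.
have r20 : 0 < r / 2 by rewrite divr_gt0.
have disc y : cabs (y - v) <= r / 2 -> cabs (y - z) <= r.
  by move=> yv; have := cabs_tri v y z; lra.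
have fa y : cabs (y - v) <= r / 2 -> 0 < cabs (f.[y] - a).
  by move=> /disc /hf; exact: lt_le_trans.
have fv : eta <= cabs (f.[v] - a) by apply: hf; lra.
have fv0 : 0 < cabs (f.[v] - a) by exact: lt_le_trans fv.
have gE y : (f - a%:P).[y] = f.[y] - a by rewrite hornerD hornerN hornerC.
have key : cabs q.[u] <= 4 / (eta * r) * cabs (f.[v] - a) * cabs (f - a%:P).[u].
  apply: (@max_disc_rat _ q (f - a%:P) v (r / 2)).
  - by rewrite mulr_ge0 ?cabs_ge0 // divr_ge0 // ltW // mulr_gt0.
  - by move=> y /fa; rewrite gE cabs_gt0.
  - move=> y yv; have yv' : cabs (y - v) <= r / 2 by rewrite yv.
    have fy := hf y (disc y yv'); rewrite gE.
    have := cabs_tri a f.[y] f.[v]; rewrite (cabsB a) fE cabsM yv => h.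
    have : 4 / (eta * r) * cabs (f.[v] - a) * cabs (f.[y] - a) * (eta * r) =
        4 * (cabs (f.[v] - a) * cabs (f.[y] - a)) by field; rewrite !gt_eqF.
    move=> h2; rewrite -(@ler_pM2r _ (eta * r)) ?mulr_gt0 // h2.
    have h3 : cabs (f.[y] - a) * eta <= cabs (f.[v] - a) * cabs (f.[y] - a).
      by rewrite mulrC ler_wpM2r ?cabs_ge0.
    have h4 : cabs (f.[v] - a) * eta <= cabs (f.[v] - a) * cabs (f.[y] - a).
      by rewrite ler_wpM2l ?cabs_ge0.
    by have := ler_wpM2l (ltW eta0) h; lra.
  - by have := cabs_tri z u v; rewrite (cabsB z); lra.
have fu0 : 0 < cabs (f.[u] - a).
  by apply: fa; have := cabs_tri z u v; rewrite (cabsB z); lra.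
have nu : f.[u] - a != 0 by rewrite -cabs_gt0.
have nv : f.[v] - a != 0 by rewrite -cabs_gt0.
have -> : (f.[u] - a)^-1 - (f.[v] - a)^-1 = - (q.[u] * (u - v)) / ((f.[u] - a) * (f.[v] - a)).
  by rewrite -fE; field; rewrite nu nv.
rewrite cabsM cabsV cabsN !cabsM ler_pdivrMr ?mulr_gt0 // gE in key *.
by have := ler_wpM2r (cabs_ge0 (u - v)) key; lra.
Qed.

Lemma trapped_open K n z : eopen K -> (forall w, size w = n -> K (we P w z)) ->
  exists2 d, 0 < d & forall u, cabs (u - z) < d -> forall w, size w = n -> K (we P w u).
Proof.
move=> Ko hn.
have [d d0 hd] : exists2 d, 0 < d & forall w, (size w <= n)%N -> size w = n ->
    forall u, cabs (u - z) < d -> K (we P w u).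
  apply: words_uniform => [w e e' ee' h wn u uz|w].
    by apply: h => //; exact: lt_le_trans ee'.
  have [wn|wn] := pselect (size w = n); last by exists 1.
  have [e e0 he] := Ko _ (hn w wn); have [d d0 hd] := poly_cont (wp P w) z e0.
  by exists d => // _ u /hd; rewrite !wpE => /he.
by exists d => // u uz w wn; apply: hd => //; rewrite wn.
Qed.

Section TrapFatou.
Variables (K : C -> Prop) (eta : R).
Hypothesis tK : trap P K eta.

(** Near z, a word with more than n letters enters K and then applies another letter, so its values
    stay eta away from a. [ascoli] applies to 1 / (w - a), and [moebius] carries the limit back to
    the sphere. *)
Lemma trapped_Fatou z a n : ~ K a -> (forall w, size w = n -> K (we P w z)) ->
  Fatou sgp (Some z).
Proof.
have [eta0 Ko ha hb] := tK; move=> nKa hn.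
have [d d0 hd] := trapped_open Ko hn.
pose r := d / 2; have r0 : 0 < r by rewrite divr_gt0.
have away w u : (n < size w)%N -> cabs (u - z) <= r -> eta <= cabs (we P w u - a).
  move=> wn ur; rewrite leNgt; apply/negP => lt; apply: nKa.
  have Kt : K (we P (take n w) u).
    by apply: hd; rewrite ?size_takel // ?(ltnW wn) // /r in ur *; lra.
  have dn : drop n w != [::] by rewrite -size_eq0 size_drop subn_eq0 -ltnNge.
  apply: (trap_word tK dn Kt); rewrite -we_cat cat_take_drop cabsB //.
pose U : set Chat := [set y | exists2 u, y = Some u & cabs (u - z) < r / 4].
have r40 : 0 < r / 4 by rewrite divr_gt0.
exists U; split.
- apply: open_fin => u uz; exists (r / 4 - cabs (u - z)); first by rewrite subr_gt0.
  by move=> v vu; have := cabs_tri u v z; lra.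
- by exists z; rewrite // subrr cabs0.
apply: normal_intro => w hw.
pose w' i := w (i + n.+1)%N.
have w'n i : (n < size (w' i))%N.
  by apply: leq_trans (hw _); rewrite leq_addl.
pose f i y : C := (we P (w' i) (z + y) - a)^-1.
have zyz y : z + y - z = y by rewrite [z + y]addrC addrK.
have [||i y yr|i x y xr yr|k kmono [v hv]] := @ascoli R f (r / 4) eta^-1 (4 / (eta * r)).
- exact: ltW.
- by rewrite divr_ge0 // ltW // mulr_gt0.
- rewrite /f cabsV lef_pV2 ?posrE //; first by apply: away => //; rewrite zyz; lra.
  by apply: (lt_le_trans eta0); apply: away => //; rewrite zyz; lra.
- have := @inverse_lip (wp P (w' i)) a z r eta r0 eta0 _ (z + x) (z + y).
  have -> : z + x - (z + y) = x - y by ring.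
  rewrite !zyz /f !wpE; apply => // u ur.
  by rewrite wpE; exact: away.
exists (fun i => k i + n.+1)%N, (fun y => if y is Some u then moebius a (v (u - z)) else None).
split=> [i j ij|e e0]; first by rewrite ltn_add2r; exact: kmono.
have [dl dl0 hdl] := moebius_continuous a e0.
have [N hN] := hv dl dl0; exists N => i iN _ [u -> uz].
have h := hN i iN (u - z) (ltW uz).
have -> : wmap (w (k i + n.+1)%N) (Some u) = moebius a (f (k i) (u - z)).
  have nz : we P (w' (k i)) u - a != 0.
    by rewrite -cabs_gt0; apply: (lt_le_trans eta0); apply: away => //; lra.
  rewrite /moebius /f [z + (u - z)]addrC subrK invr_eq0 (negbTE nz) invrK.
  by rewrite addrC subrK.
by apply: hdl; rewrite cabsB.
Qed.

End TrapFatou.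

Lemma wmap_critical w c : critical_point (wmap w) (Some c : Chat) <-> (wp P w)^`().[c] = 0.
Proof.
have -> : wmap w = omap (fun z => (wp P w).[z]).
  by apply/funext => -[z|//]; rewrite /wmap /= wpE.
exact: critical_pointE.
Qed.

Lemma postcriticalP p : postcritical sgp (Some p) <-> post P p.
Proof.
split=> [/closure_fin h e e0|h].
  have [u [g /sgpP[w w0 ->] [[c|] hc /= wu]] up] := h e e0; last by [].
  exists w, c; split=> //; first exact/wmap_critical.
  by case: wu => ->.
apply/closure_fin => e e0; have [w [c [w0 wc wp']]] := h e e0.
exists (we P w c) => //; exists (wmap w); first by apply/sgpP; exists w.
by exists (Some c) => //; exact/wmap_critical.
Qed.

Definition outer_trap_exists := exists K eta, [/\ trap P K eta,
  exists r, forall z, r <= cabs z -> K z & exists a, ~ K a].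

Definition bounded_trap_exists := exists K eta,
  trap P K eta /\ exists B, forall z, K z -> cabs z <= B.

Lemma trap_hyperbolic K eta a : trap P K eta -> ~ K a -> hyperbolic sgp.
Proof.
move=> tK nKa [p|] /=; last by move=> _; exact: Fatou_inf.
move=> /postcriticalP /(trap_post tK) Kp.
by apply: (trapped_Fatou tK nKa (n := 0%N)) => w /size0nil ->.
Qed.

Lemma bounded_not B K : (forall z, K z -> cabs z <= B) -> exists a, ~ K a.
Proof.
move=> hB; exists (`|B| + 1)%:C => /hB.
by rewrite cabsR ger0_norm ?addr_ge0 //; have := ler_norm B; lra.
Qed.

Lemma hyperbolicP : (0 < m)%N -> hyperbolic sgp <-> outer_trap_exists.
Proof.
move=> m0; split=> [hyp|[K [eta [tK _ [a nKa]]]]]; last exact: trap_hyperbolic tK nKa.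
have [T T0 hT] := escape_exists P2.
apply: (outer_trap P2 (hT T (lexx _)) _ (Ordinal m0)) => p pp.
by apply: Fatou_stable => //; apply: hyp; exact/postcriticalP.
Qed.

Lemma bounded_post : bounded_set (Some @^-1` finite_postcritical sgp : set C^o) <->
  exists B, forall p, post P p -> cabs p <= B.
Proof.
split=> [[M [Mr hM]]|[B hB]].
  exists (complex.Re (M + 1)) => p pp.
  have := hM (M + 1); rewrite ltrDl ltr01 => /(_ isT p) h.
  have {}h : `|p| <= M + 1.
    by apply: h; split => //; exact/postcriticalP.
  by move: h; rewrite cabsE; case: (M + 1) => x y; rewrite lecE /= => /andP[].
exists B%:C; split; first by rewrite realE -[0]/(0%:C) !lecR le_total.
move=> M BM p [/postcriticalP /hB pB _].
suff : `|p : C| <= M by [].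
by rewrite cabsE; apply: le_trans (ltW BM); rewrite lecR.
Qed.

Lemma pcb_hyperbolicP : (0 < m)%N -> hyperbolic sgp /\ pcb_class sgp <-> bounded_trap_exists.
Proof.
move=> m0; split=> [[hyp [_ _ /bounded_post[B hB]]]|[K [eta [tK [B hB]]]]].
  have [T T0 hT] := escape_exists P2.
  apply: (bounded_trap P2 (hT T (lexx _)) _ (Ordinal m0) hB) => p pp.
  by apply: Fatou_stable => //; apply: hyp; exact/postcriticalP.
have [a nKa] := bounded_not hB.
split; first exact: trap_hyperbolic tK nKa.
split.
- exists (range (fun j => omap (fun z => (P j).[z]) : Chat -> Chat)); split=> //.
    by exists (omap (fun z => (P (Ordinal m0)).[z])); exists (Ordinal m0).
  move=> _ [j _ <-]; have [n hn] := size_P P2 j; exists n.+2 => //.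
  by exists (P j).
- move=> _ /sgpP[w w0 ->]; have [n hn] := size_wp3 P2 w0; exists n.+2 => //.
  by exists (wp P w) => //; apply/funext => -[z|//]; rewrite /wmap /= wpE.
- by apply/bounded_post; exists B => p /(trap_post tK) /hB.
Qed.

Lemma Julia_trap K eta r a z : trap P K eta -> (forall z, r <= cabs z -> K z) -> ~ K a ->
  Julia sgp (Some z) <-> forall n, exists2 w, size w = n & ~ K (we P w z).
Proof.
move=> tK Kr nKa; split=> [nF n|h Fz].
  apply: contrapT => no; apply: nF; apply: (trapped_Fatou tK nKa (n := n)) => w wn.
  by apply: contrapT => nK; apply: no; exists w.
have [T T0 hT] := escape_exists P2; pose rho := Num.max T r.
have rho0 : 0 < rho by rewrite lt_max T0.
have hrho : escape_radius P rho by apply: hT; rewrite le_max lexx.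
have Krho y : rho <= cabs y -> K y by rewrite ge_max => /andP[_ /Kr].
have Kst y : K y -> stable_at P rho y.
  move=> Ky; apply: Fatou_stable => //; apply: (trapped_Fatou tK nKa (n := 0%N)).
  by move=> w /size0nil ->.
have [n hn] := stable_trapped P2 tK hrho Krho Kst (Fatou_stable rho0 Fz).
by have [w wn] := h n; apply; exact: hn.
Qed.

Lemma Julia_inf : ~ Julia sgp None.
Proof. by apply; exact: Fatou_inf. Qed.

End Semigroup.

(** * Perturbation *)

Section Perturbation.
Variable R : realType.
Local Notation C := R[i].
Local Notation Chat := (sphere R).
Implicit Types (z u x y c a b : C) (p q : {poly C}) (e d r rho : R).

Definition pclose p q e := forall z, @sdist R (Some p.[z]) (Some q.[z]) < e.

Lemma pclose_le p q e e' : e <= e' -> pclose p q e -> pclose p q e'.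
Proof. by move=> ee h z; exact: lt_le_trans ee. Qed.

Lemma size_derivC p n : size p = n.+2 -> size p^`() = n.+1.
Proof.
move=> hp; apply/eqP; rewrite eqn_leq; apply/andP; split.
  by apply/leq_sizeP => j nj; rewrite coef_deriv nth_default ?mul0rn // hp.
rewrite ltnNge; apply/negP => /leq_sizeP /(_ n (leqnn _)) /eqP.
rewrite coef_deriv mulrn_eq0 /= -[n.+1]/(n.+2.-1) -hp -lead_coefE lead_coef_eq0.
by rewrite -size_poly_eq0 hp.
Qed.

(* By Gauss-Lucas the critical points of q stay bounded, whatever its degree. *)
Lemma critical_perturb p (mu : R) : (2 < size p)%N -> 0 < mu ->
  exists2 e, 0 < e & forall q, (2 < size q)%N -> pclose p q e ->
    forall c', q^`().[c'] = 0 -> exists2 c, p^`().[c] = 0 & cabs (q.[c'] - p.[c]) < mu.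
Proof.
case hp: (size p) => [|[|[|n]]] // _ mu0.
have [T T0 hT] := @escape_exists R 1 (fun=> p) (fun=> ltac:(by rewrite hp)).
have [rho0 hesc] := hT T (lexx _).
have hpT z : T <= cabs z -> 2 * cabs z <= cabs p.[z] by exact: (hesc ord0).
have [M M0 hM] := poly_bound p (T + 1).
have [L L0 hL] := poly_lip p (T + 1).
have hp' := size_derivC hp.
pose l := cabs (lead_coef p^`()).
have l0 : 0 < l by rewrite cabs_gt0 lead_coef_eq0 -size_poly_eq0 hp'.
pose d := Num.min 1 (mu / 2 / L).
have d0 : 0 < d by rewrite lt_min ltr01 !divr_gt0.
pose e1 := Num.min (mu / 2) (l * d ^+ n.+1 / 3).
have e10 : 0 < e1 by rewrite lt_min !divr_gt0 // mulr_gt0 // exprn_gt0.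
have [e e0 he] := sdist_finite M e10.
have [e' e'0 he'] := sdist_finite 0 T0.
exists (Num.min e e'); first by rewrite lt_min e0.
move=> q hq pq c' qc'.
have c'T : cabs c' < T.
  case hq': (size q) hq => [|[|k]] // _.
  apply: (gauss_lucas hq') => [z /rootP qz|]; last exact/rootP.
  (* A root z of q beyond T would put p(z), of modulus at least 2 T, spherically close to 0. *)
  rewrite ltNge; apply/negP => Tz; have := pq z; rewrite lt_min => /andP[_].
  rewrite qz sdist_sym => /(he' _ _ _)[|u [<-]]; first by rewrite cabs0.
  by rewrite subr0; have := hpT z Tz; lra.
have near z : cabs z <= T + 1 -> cabs (q.[z] - p.[z]) < e1.
  move=> zT; have := pq z; rewrite lt_min => /andP[h _].
  by have [u [<-]] := he _ _ (hM z zT) h.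
have pc' : cabs p^`().[c'] <= 2 * e1 / 1.
  have -> : p^`().[c'] = - (q - p)^`().[c'].
    by rewrite derivB hornerD hornerN qc' sub0r opprK.
  rewrite cabsN; apply: cauchy_deriv => // z zc'.
  by rewrite hornerD hornerN ltW // near //; have := cabs_ub z c'; lra.
have e1l : e1 <= l * d ^+ n.+1 / 3 by rewrite ge_min lexx orbT.
have ld0 : 0 < l * d ^+ n.+1 by rewrite mulr_gt0 // exprn_gt0.
have [|c /rootP pc cc'] := near_root hp' (ltW d0) (_ : cabs p^`().[c'] < l * d ^+ n.+1).
  by rewrite divr1 in pc'; lra.
exists c => //; move: cc'; rewrite lt_min => /andP[h1 h2].
have c'1 : cabs c' <= T + 1 by lra.
have c1 : cabs c <= T + 1 by have := cabs_ub c c'; rewrite (cabsB c); lra.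
have := near c' c'1; have := hL c' c c'1 c1.
have : L * cabs (c' - c) < mu / 2 by rewrite mulrC -ltr_pdivlMr.
have e1m : e1 <= mu / 2 by rewrite ge_min lexx.
have := cabs_tri p.[c'] q.[c'] p.[c]; lra.
Qed.

Section Tuples.
Variable m : nat.
Implicit Types (P : 'I_m -> {poly C}) (w v s : seq 'I_m) (K U V : C -> Prop).

Definition tclose P P' e := forall j, pclose (P j) (P' j) e.

Lemma tclose_le P P' e e' : e <= e' -> tclose P P' e -> tclose P P' e'.
Proof. by move=> ee h j; exact: pclose_le (h j). Qed.

(** Spherical closeness controls the plane distance only at bounded values. Large values are
    harmless if K contains a neighborhood of infinity, and do not occur on K if K is bounded. *)
Lemma trap_perturb P K (eta : R) : (forall j, (2 < size (P j))%N) -> trap P K eta ->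
  (exists r, forall z, r <= cabs z -> K z) \/ (exists B, forall z, K z -> cabs z <= B) ->
  exists2 e, 0 < e & forall P', (forall j, (2 < size (P' j))%N) -> tclose P P' e ->
    trap P' K (eta / 2).
Proof.
move=> P2 [eta0 Ko ha hb] hK; have eta20 : 0 < eta / 2 by rewrite divr_gt0.
have [e1 e10 he1] : exists2 e, 0 < e & forall y y', sdist (Some y) (Some y') < e ->
    (forall u, cabs (u - y) < eta -> K u) -> forall u, cabs (u - y') < eta / 2 -> K u.
  case: hK => [[r hr]|[B hB]].
    have [e e0 he] := sdist_finite (r + eta) eta20.
    exists e => // y y' yy' hy u uy'; have [h|h] := leP (cabs y') (r + eta).
      have [v [<-] hv] := he y' (Some y) h (ltac:(by rewrite sdist_sym)).
      by apply: hy; have := cabs_tri y' u y; rewrite (cabsB y' y); lra.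
    by apply: hr; have := cabs_ub y' u; rewrite (cabsB y' u); lra.
  have [e e0 he] := sdist_finite B eta20.
  exists e => // y y' yy' hy u uy'.
  have Ky : K y by apply: hy; rewrite subrr cabs0.
  have [v [<-] hv] := he y (Some y') (hB y Ky) yy'.
  by apply: hy; have := cabs_tri y' u y; lra.
have [e2 e20 he2] : exists2 e, 0 < e & forall j, forall q, (2 < size q)%N -> pclose (P j) q e ->
    forall c', q^`().[c'] = 0 -> exists2 c, (P j)^`().[c] = 0 & cabs (q.[c'] - (P j).[c]) < eta / 2.
  apply: fin_uniform => [j e e' ee' h q q2 qe|j]; last exact: critical_perturb.
  by apply: h => //; exact: pclose_le qe.
exists (Num.min e1 e2); first by rewrite lt_min e10.
move=> P' P'2 PP'; split=> //.
- move=> j z Kz; apply: he1 (ha j z Kz).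
  by have := PP' j z; rewrite lt_min => /andP[].
- move=> j c' hc' u uc'.
  have [|c hc cc'] := he2 j (P' j) (P'2 j) _ c' hc'.
    by apply: pclose_le (PP' j); rewrite ge_min lexx orbT.
  by apply: (hb j c hc); have := cabs_tri (P' j).[c'] u (P j).[c]; lra.
Qed.

Lemma words_close P N (B mu : R) : 0 < mu -> exists2 e, 0 < e & forall P', tclose P P' e ->
  forall w z, (size w <= N)%N -> cabs z <= B -> cabs (we P' w z - we P w z) < mu.
Proof.
elim: N B mu => [|N IH] B mu mu0.
  exists 1 => // P' _ w z; rewrite leqn0 => /nilP -> _.
  by rewrite /= subrr cabs0.
have mu20 : 0 < mu / 2 by rewrite divr_gt0.
have [M M0 hM] : exists2 M, 0 <= M & forall j z, cabs z <= B -> cabs (P j).[z] <= M.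
  have /choice[F hF] : forall j, exists M, 0 <= M /\ forall z, cabs z <= B -> cabs (P j).[z] <= M.
    by move=> j; have [M M0 hM] := poly_bound (P j) B; exists M.
  exists (\sum_j F j); first by apply: sumr_ge0 => j _; have [] := hF j.
  move=> j z zB; have [_ h] := hF j; apply: (le_trans (h z zB)).
  by rewrite (bigD1 j) //= lerDl sumr_ge0 // => k _; have [] := hF k.
have [d d0 hd] := words_lip P N (M + 1) mu20.
have d10 : 0 < Num.min d 1 by rewrite lt_min d0 ltr01.
have [e1 e10 he1] := IH (M + 1) _ mu20.
have [e2 e20 he2] := sdist_finite M d10.
exists (Num.min e1 e2); first by rewrite lt_min e10.
move=> P' PP' [|j w] z wN zB; first by rewrite /= subrr cabs0.
rewrite /= -!/(we _ w _).
have zM := hM j z zB.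
have := PP' j z; rewrite lt_min => /andP[_ h].
have [u [<-] hu] := he2 _ _ zM h; move: hu; rewrite lt_min => /andP[h1 h2].
have z'M : cabs (P' j).[z] <= M + 1 by have := cabs_ub (P' j).[z] (P j).[z]; lra.
have h3 := hd w (P' j).[z] (P j).[z] wN z'M (ltac:(lra)) h1.
have PP1 : tclose P P' e1 by apply: tclose_le PP'; rewrite ge_min lexx.
have h4 := he1 P' PP1 w (P' j).[z] wN z'M.
have := cabs_tri (we P w (P' j).[z]) (we P' w (P' j).[z]) (we P w (P j).[z]); lra.
Qed.

Definition untrapped P K z := forall n, exists2 w, size w = n & ~ K (we P w z).

Lemma untrapped_outer P K eta r z : trap P K eta -> (forall z, r <= cabs z -> K z) ->
  untrapped P K z -> cabs z < r.
Proof.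
move=> tK Kr h; have [w _ nK] := h 0%N.
by rewrite ltNge; apply/negP => /Kr /(trap_we tK w) /nK.
Qed.

(** If n letters always brought c into K, they would do so for nearby u k with k >= n, although all
    prefixes of the k-letter word keep u k outside K. *)
Lemma untrapped_closed P K eta r (u : nat -> C) : trap P K eta ->
  (forall z, r <= cabs z -> K z) ->
  (forall n, exists2 w, size w = n & ~ K (we P w (u n))) ->
  exists2 c, untrapped P K c & forall e, 0 < e -> forall N, exists2 n, (N <= n)%N & cabs (u n - c) < e.
Proof.
move=> tK Kr hu; have [_ Ko _ _] := tK.
have ur n : cabs (u n) <= r.
  have [w _ nK] := hu n; rewrite leNgt; apply/negP => lt; apply: nK.
  by apply: (trap_we tK); apply: Kr; exact: ltW.
have [c hc] := cluster_pt ur; exists c => // n.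
apply: contrapT => no.
have hn w : size w = n -> K (we P w c).
  by move=> wn; apply: contrapT => nK; apply: no; exists w.
have [d d0 hd] := trapped_open Ko hn.
have [k kn uk] := hc d d0 n; have [w wk nK] := hu k.
apply: (trap_prefix tK (k := n) nK); apply: hd => //.
by rewrite size_takel // wk.
Qed.

Lemma untrapped_exists P K eta r b : (forall j, (2 < size (P j))%N) -> (0 < m)%N ->
  trap P K eta -> (forall z, r <= cabs z -> K z) -> ~ K b -> exists z, untrapped P K z.
Proof.
move=> P2 m0 tK Kr nKb; pose j := Ordinal m0.
have h n : exists z, we P (nseq n j) z = b.
  have [k hk] := size_wp P2 (nseq n j).
  have /closed_rootP[z] : size (wp P (nseq n j) - b%:P) != 1%N by rewrite (size_subC b hk).
  rewrite rootE hornerD hornerN hornerC subr_eq0 wpE => /eqP hz.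
  by exists z.
have [u hu] := choice h.
have [|c hc _] := @untrapped_closed P K eta r u tK Kr; last by exists c.
by move=> n; exists (nseq n j); rewrite ?size_nseq // hu.
Qed.

Lemma untrapped_preimage P K eta w z : trap P K eta -> untrapped P K (we P w z) ->
  untrapped P K z.
Proof.
move=> tK h n; have [v vn nK] := h n; rewrite -we_cat in nK.
exists (take n (w ++ v)); last exact: (trap_prefix tK).
by rewrite size_takel // size_cat vn leq_addl.
Qed.

Definition disconnects P K := exists U V, [/\ eopen U, eopen V, forall z, ~ (U z /\ V z),
  forall z, untrapped P K z -> U z \/ V z &
  (exists2 z, untrapped P K z & U z) /\ (exists2 z, untrapped P K z & V z)].

(** A proper nonempty clopen part of J and its complement in J are at positive distance g by
    compactness, and their g / 2-neighborhoods are disjoint open sets of the plane. *)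
Lemma disconnectedP P K eta r a : (forall j, (2 < size (P j))%N) -> trap P K eta ->
  (forall z, r <= cabs z -> K z) -> ~ K a ->
  ~ connected (Julia (sgp P)) <-> disconnects P K.
Proof.
move=> P2 tK Kr nKa.
have JE z : Julia (sgp P) (Some z) <-> untrapped P K z by exact: (Julia_trap _ _ tK Kr nKa).
split=> [|[U [V [Uo Vo UV JUV [[x Jx Ux] [y Jy Vy]]]]] cJ]; last first.
  pose B : set Chat := Julia (sgp P) `&` [set v | exists2 u, v = Some u & U u].
  have : B = Julia (sgp P).
    apply: cJ; first by exists (Some x); split; [apply/JE|exists x].
      by exists [set v | exists2 u, v = Some u & U u] => //; exact: open_fin.
    exists (~` [set v | exists2 u, v = Some u & V u]).
      by apply: open_closedC; exact: open_fin.
    apply/seteqP; split=> v [Jv].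
      by case=> u vu Uu; split=> // -[u2]; rewrite vu => -[<-] Vu; exact: (UV u).
    case: v Jv => [u|/(Julia_inf P2)//] Ju nV; split=> //; exists u => //.
    by have [//|Vu] := JUV u ((JE u).1 Ju); case: nV; exists u.
  move=> /seteqP[_ /(_ (Some y))]; case; first exact/JE.
  by move=> _ [_ [<-] Uy]; exact: (UV y).
move=> ncJ.
have [B [Bne [D1 D1o BD1] [D2 D2c BD2] nB]] : exists B : set Chat, [/\ B !=set0,
    exists2 D, open D & B = Julia (sgp P) `&` D,
    exists2 D, closed D & B = Julia (sgp P) `&` D & B <> Julia (sgp P)].
  apply: contrapT => /forallNP no; apply: ncJ => B Bne Bo Bc.
  by apply: contrapT => nB; apply: (no B).
pose A1 z := B (Some z); pose A2 z := untrapped P K z /\ ~ B (Some z).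
have BJ (v : Chat) : B v -> Julia (sgp P) v by rewrite BD1 => -[].
have A1J z : A1 z -> untrapped P K z by move=> /BJ /JE.
have [g g0 hg] : exists2 g, 0 < g & forall x y, A1 x -> A2 y -> g <= cabs (x - y).
  apply: contrapT => no.
  have h n : exists xy : C * C, [/\ A1 xy.1, A2 xy.2 & cabs (xy.1 - xy.2) < n.+1%:R^-1].
    apply: contrapT => /forallNP hn; apply: no; exists n.+1%:R^-1.
      by rewrite invr_gt0 ltr0Sn.
    move=> x y Ax Ay; rewrite leNgt; apply/negP => lt; exact: (hn (x, y)).
  have [xy hxy] := choice h.
  have [|c Jc hc] := @untrapped_closed P K eta r (fun n => (xy n).1) tK Kr.
    by move=> n; have [/A1J] := hxy n.
  have Jc' : Julia (sgp P) (Some c) by exact/JE.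
  have [Bc|nBc] := pselect (B (Some c)).
    have /nbhs_fin[e e0 he] : nbhs (Some c : Chat) D1.
      by apply: open_nbhs_nbhs; split=> //; move: Bc; rewrite BD1 => -[].
    have e20 : 0 < e / 2 by rewrite divr_gt0.
    have [N hN] := inv_natS_lt e20; have [n nN hn] := hc _ e20 N.
    have [_ [Jy nBy] dxy] := hxy n; apply: nBy; rewrite BD1; split; first exact/JE.
    apply: he; have := hN n nN; have := cabs_tri (xy n).1 (xy n).2 c.
    by rewrite (cabsB (xy n).2 (xy n).1); move: dxy; move: (n.+1%:R^-1) => i; lra.
  have : ~ D2 (Some c) by move=> D2c'; apply: nBc; rewrite BD2.
  move=> nD2; have /nbhs_fin[e e0 he] : nbhs (Some c : Chat) (~` D2).
    by apply: open_nbhs_nbhs; split=> //; exact: closed_openC.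
  have [n _ hn] := hc e e0 0%N; have [Bx _ _] := hxy n.
  by apply: (he _ hn); move: Bx; rewrite /A1 BD2 => -[].
pose nb (A : C -> Prop) z := exists2 x, A x & cabs (z - x) < g / 2.
have nbo A : eopen (nb A).
  move=> z [x Ax zx]; exists (g / 2 - cabs (z - x)); first by rewrite subr_gt0.
  by move=> w wz; exists x => //; have := cabs_tri z w x; lra.
have g20 : 0 < g / 2 by rewrite divr_gt0.
have self (A : C -> Prop) z : A z -> nb A z by exists z; rewrite // subrr cabs0.
exists (nb A1), (nb A2); split=> //.
- move=> z [[x Ax zx] [y Ay zy]]; have := hg x y Ax Ay.
  by have := cabs_tri z x y; rewrite (cabsB x z); lra.
- move=> z Jz; have [Bz|nBz] := pselect (B (Some z)); first by left; exact: self.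
  by right; apply: self.
split.
  have [[x|] Bx] := Bne; last by have := Julia_inf P2 (BJ _ Bx).
  by exists x; [exact: A1J|exact: self].
have [y Jy nBy] : exists2 y, Julia (sgp P) y & ~ B y.
  apply: contrapT => no; apply: nB; apply/seteqP; split=> [v /BJ //|v Jv].
  by apply: contrapT => nBv; apply: no; exists v.
case: y Jy nBy => [y|/(Julia_inf P2)//] Jy nBy.
have Jy' : untrapped P K y by exact/JE.
by exists y => //; apply: self; split.
Qed.

(** * Components of an open set by chains of discs *)

Section Component.
Variable O : C -> Prop.

(* The points joined to y by a finite chain of overlapping discs contained in O. *)
Definition comp y z := forall S : C -> Prop, S y ->
  (forall c rho, (forall u, cabs (u - c) < rho -> O u) ->
     (exists2 x, cabs (x - c) < rho & S x) -> forall u, cabs (u - c) < rho -> S u) -> S z.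

Lemma comp_refl y : comp y y. Proof. by move=> S. Qed.

Lemma comp_disc y c rho x u : (forall u, cabs (u - c) < rho -> O u) -> comp y x ->
  cabs (x - c) < rho -> cabs (u - c) < rho -> comp y u.
Proof.
by move=> hO yx xc uc S Sy hS; apply: (hS c rho hO) uc; exists x => //; exact: yx.
Qed.

Lemma comp_trans x y z : comp x y -> comp y z -> comp x z.
Proof. by move=> xy yz S Sx hS; apply: yz => //; exact: xy. Qed.

Lemma comp_sub y z : O y -> comp y z -> O z.
Proof. by move=> Oy; apply => // c rho hO _. Qed.

Hypothesis Oo : eopen O.

Lemma comp_open y : O y -> eopen (comp y).
Proof.
move=> Oy z yz; have [e e0 he] := Oo (comp_sub Oy yz); exists e => // u uz.
by apply: (comp_disc he yz) => //; rewrite subrr cabs0.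
Qed.

Lemma comp_boundary y z : (forall e, 0 < e -> exists2 x, comp y x & cabs (x - z) < e) ->
  ~ comp y z -> ~ O z.
Proof.
move=> hz nz Oz; apply: nz; have [e e0 he] := Oo Oz; have [x yx xz] := hz e e0.
by apply: (comp_disc he yx) => //; rewrite subrr cabs0.
Qed.

(** The image of Om is open, and closed relative to O because f sends the boundary of Om outside O;
    so it contains every component of O that it meets. *)
Lemma comp_surjective (f : {poly C}) n (Om : C -> Prop) B x0 : size f = n.+2 -> eopen Om ->
  (forall z, Om z -> cabs z <= B) ->
  (forall z, (forall e, 0 < e -> exists2 x, Om x & cabs (x - z) < e) -> ~ Om z -> ~ O f.[z]) ->
  Om x0 -> forall b, comp f.[x0] b -> exists2 z, Om z & f.[z] = b.
Proof.
move=> hf Omo OmB Ombd Omx0 b hb.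
apply: (hb (fun b => exists2 z, Om z & f.[z] = b)); first by exists x0.
move=> c rho hO [v vc [x Omx fx]] u uc.
pose bd := Num.max (cabs (v - c)) (cabs (u - c)).
have bdr : bd < rho by rewrite gt_max vc.
apply: (@seg_connect R (fun y => cabs (y - c) <= bd) (fun y => exists2 z, Om z & f.[z] = y) v).
- by move=> t t01; apply: seg_convex => //; rewrite le_max lexx ?orbT.
- by exists x.
- move=> y _ [z Omz fz]; have [e e0 he] := Omo z Omz.
  have l0 : 0 < cabs (lead_coef f) by rewrite cabs_gt0 lead_coef_eq0 -size_poly_eq0 hf.
  exists (cabs (lead_coef f) * e ^+ n.+1); first by rewrite mulr_gt0 // exprn_gt0.
  move=> y' _ y'y.
  have := @near_root R (f - y'%:P) n.+1 z e (size_subC y' hf) (ltW e0).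
  rewrite lead_coefDl ?hf ?size_polyN ?size_polyC; last by case: (y' != 0).
  rewrite hornerD hornerN hornerC fz (cabsB y) => /(_ y'y)[z' /rootP].
  rewrite hornerD hornerN hornerC => /eqP; rewrite subr_eq0 => /eqP fz' zz'.
  by exists z' => //; apply: he; rewrite cabsB.
move=> y yc hy.
have hn k : exists z, Om z /\ cabs (f.[z] - y) < k.+1%:R^-1.
  have [|y' [_ [z Omz <-]] h] := hy k.+1%:R^-1; first by rewrite invr_gt0 ltr0Sn.
  by exists z.
have [zz hzz] := choice hn.
have [z hz] := @cluster_pt R zz B (fun k => OmB _ (hzz k).1).
have fz : f.[z] = y.
  apply/eqP; rewrite -subr_eq0 -cabs_eq0; apply: contraT => ne.
  have ne0 : 0 < cabs (f.[z] - y) / 2 by rewrite divr_gt0 // lt_def ne cabs_ge0.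
  have [d d0 hd] := poly_cont f z ne0; have [N hN] := inv_natS_lt ne0.
  have [k kN hk] := hz d d0 N; have := hd _ hk; have [_] := hzz k; have := hN k kN.
  have := cabs_tri f.[zz k] f.[z] y; rewrite (cabsB f.[z] f.[zz k]).
  by move: (k.+1%:R^-1) => i; lra.
exists z => //; apply: contrapT => nOm; apply: (Ombd z) => //.
  by move=> e /hz /(_ 0%N)[k _ hk]; exists (zz k) => //; have [] := hzz k.
by rewrite fz; apply: hO; exact: le_lt_trans bdr.
Qed.

End Component.

(** That U and V still cover is upper semicontinuity. That the new Julia set meets both is the real
    content; it is proved in [main] for one of them and applied twice. *)
Lemma separated_perturb P K eta r : (forall j, (2 < size (P j))%N) -> trap P K eta ->
  (forall z, r <= cabs z -> K z) -> disconnects P K ->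
  exists2 e, 0 < e & forall P', (forall j, (2 < size (P' j))%N) -> tclose P P' e ->
    disconnects P' K.
Proof.
move=> P2 tK Kr [U [V [Uo Vo UV JUV [hU hV]]]]; have [eta0 Ko ha _] := tK.
have [e1 e10 he1] := trap_perturb P2 tK (or_introl (ex_intro _ r Kr)).
have [n hn] : exists n, forall z, (exists2 w, size w = n & ~ K (we P w z)) -> U z \/ V z.
  apply: contrapT => /forallNP no.
  have h k : exists z, ~ (U z \/ V z) /\ exists2 w, size w = k & ~ K (we P w z).
    apply: contrapT => /forallNP hk; apply: (no k) => z hz.
    by apply: contrapT => nz; apply: (hk z).
  have [u hu] := choice h.
  have [|c Jc hc] := @untrapped_closed P K eta r u tK Kr; first by move=> k; have [] := hu k.
  have [Uc|Vc] := JUV c Jc.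
    have [e e0 he] := Uo c Uc; have [k _ hk] := hc e e0 0%N.
    by have [nU _] := hu k; apply: nU; left; exact: he.
  have [e e0 he] := Vo c Vc; have [k _ hk] := hc e e0 0%N.
  by have [nU _] := hu k; apply: nU; right; exact: he.
(* The extra letter pays for the perturbation: once n letters lead into K, one more leads into K
   with margin eta. *)
have [e2 e20 he2] := words_close P n.+1 r eta0.
have cover P' : (forall j, (2 < size (P' j))%N) -> tclose P P' (Num.min e1 e2) ->
    forall z, (exists2 w, size w = n.+1 & ~ K (we P' w z)) -> U z \/ V z.
  move=> P'2 PP' z [w wn nK]; apply: hn.
  have tK' : trap P' K (eta / 2).
    by apply: he1 => //; apply: tclose_le PP'; rewrite ge_min lexx.
  have zr : cabs z <= r.
    rewrite leNgt; apply/negP => lt; apply: nK; apply: (trap_we tK'); exact/Kr/ltW.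
  exists (take n w); first by rewrite size_takel // wn.
  move=> Kt; apply: nK.
  have dn : drop n w != [::] by rewrite -size_eq0 size_drop wn subSnn.
  apply: (trap_word tK dn Kt); rewrite -we_cat cat_take_drop.
  by apply: he2 => //; [apply: tclose_le PP'; rewrite ge_min lexx orbT|rewrite wn].
(* By the pigeonhole principle some orbit in the Julia set nearly returns to the
   component Q of the complement of the trap, so that, for the perturbed maps, some
   word maps a part of Q onto Q; backward orbits of this word accumulate at a point
   of the Julia set in Q, which is pulled back into U1. *)
have main (U1 V1 : C -> Prop) : eopen U1 -> eopen V1 -> (forall z, ~ (U1 z /\ V1 z)) ->
    (forall P', (forall j, (2 < size (P' j))%N) -> tclose P P' (Num.min e1 e2) ->
      forall z, (exists2 w, size w = n.+1 & ~ K (we P' w z)) -> U1 z \/ V1 z) ->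
    (exists2 z, untrapped P K z & U1 z) ->
    exists2 e, 0 < e & forall P', (forall j, (2 < size (P' j))%N) -> tclose P P' e ->
      exists2 z, untrapped P' K z & U1 z.
  move=> U1o V1o UV1 cover1 [a Ja Ua].
  have r0 : 0 <= r by apply: le_trans (ltW (untrapped_outer tK Kr Ja)); exact: cabs_ge0.
  have [d1 d10 hd1] := words_lip P 1 (r + 1) eta0.
  pose d := Num.min d1 1; have d0 : 0 < d by rewrite lt_min d10 ltr01.
  have awayK y j : ~ K (P j).[y] -> forall u, cabs (u - y) < d -> ~ K u.
    move=> nK u; rewrite lt_min => /andP[uy1 uy2] Ku; apply: (nK).
    have yr : cabs y < r.
      by rewrite ltNge; apply/negP => /Kr /(trap_we tK [:: j]) /nK.
    have ur : cabs u <= r + 1 by have := cabs_ub u y; lra.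
    have yr1 : cabs y <= r + 1 by lra.
    by apply: (ha j u Ku); apply: (hd1 [:: j] y u) => //; rewrite cabsB.
  (* The interior of the complement of K. A point outside O is a limit of points of K, so a single
     letter already maps it into K. *)
  pose O z := exists2 e, 0 < e & forall u, cabs (u - z) < e -> ~ K u.
  have Oo : eopen O.
    move=> z [e e0 he]; exists (e / 2); first by rewrite divr_gt0.
    move=> w wz; exists (e / 2); first by rewrite divr_gt0.
    by move=> u uw; apply: he; have := cabs_tri w u z; lra.
  have OK z : O z -> ~ K z by move=> [e e0]; apply; rewrite subrr cabs0.
  have discO y e : (forall u, cabs (u - y) < e -> ~ K u) -> forall u, cabs (u - y) < e -> O u.
    move=> h u uy; exists (e - cabs (u - y)); first by rewrite subr_gt0.
    by move=> x xu; apply: h; have := cabs_tri u x y; lra.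
  have [T [code codeP]] := finite_code r d0.
  (* The first n.+1 letters serve to trap the boundary of U1; the next positions give #|T|.+1 orbit
     points for the pigeonhole; one letter is left after the last of them, so that [awayK] applies
     to it too. *)
  have [w wsize nKw] := Ja (n.+1 + #|T|.+1)%N.
  pose y k := we P (take (n.+1 + k)%N w) a.
  have yaway k : (k <= #|T|)%N -> forall u, cabs (u - y k) < d -> ~ K u.
    move=> kT; have lt : (n.+1 + k < size w)%N by rewrite wsize ltn_add2l ltnS.
    have [j jE] : exists j, take (n.+1 + k).+1 w = rcons (take (n.+1 + k) w) j.
      have [j0 _] : exists j0 : 'I_m, True by case: (w) lt => // j0; exists j0.
      by exists (nth j0 w (n.+1 + k)); rewrite (take_nth j0).
    apply: (@awayK _ j); have := trap_prefix tK (k := (n.+1 + k).+1) nKw.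
    by rewrite jE -cats1 we_cat.
  have ynK k : (k <= #|T|)%N -> ~ K (y k).
    by move=> kT; apply: (yaway k kT); rewrite subrr cabs0.
  have yr k : (k <= #|T|)%N -> cabs (y k) <= r.
    by move=> kT; rewrite leNgt; apply/negP => /ltW /Kr /(ynK k kT).
  have [k [l [/andP[kl lT] ekl]]] := code_collision (fun k => code (y k)).
  have kT : (k <= #|T|)%N by exact: leq_trans (ltnW kl) lT.
  have ykl := codeP _ _ (yr k kT) (yr l lT) ekl.
  pose f := take (n.+1 + k) w; pose s := drop (n.+1 + k) (take (n.+1 + l) w).
  have fsE : take (n.+1 + l) w = f ++ s.
    by rewrite -[LHS](cat_take_drop (n.+1 + k)) take_takel // leq_add2l ltnW.
  have lw : (n.+1 + l <= size w)%N by rewrite wsize leq_add2l ltnW.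
  have s0 : s != [::].
    by rewrite -size_eq0 size_drop size_takel // subn_eq0 -ltnNge ltn_add2l.
  have fsize : size f = (n.+1 + k)%N.
    by rewrite size_takel // (leq_trans _ lw) // leq_add2l ltnW.
  pose mu := d - cabs (y k - y l); have mu0 : 0 < mu by rewrite subr_gt0.
  have [e3 e30 he3] := words_close P (n.+1 + l) (cabs a) mu0.
  exists (Num.min (Num.min e1 e2) e3); first by rewrite !lt_min e10 e20.
  move=> P' P'2 PP'.
  have PP1 : tclose P P' e1 by apply: tclose_le PP'; rewrite !ge_min lexx.
  have PP2 : tclose P P' (Num.min e1 e2) by apply: tclose_le PP'; rewrite ge_min lexx.
  have PP3 : tclose P P' e3 by apply: tclose_le PP'; rewrite ge_min lexx orbT.
  have tK' := he1 P' P'2 PP1.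
  pose x0 := we P' f a; pose x1 := we P' s x0.
  have hx0 : cabs (x0 - y k) < d.
    have : cabs (x0 - y k) < mu by apply: he3 => //; rewrite fsize leq_add2l ltnW.
    by have := cabs_ge0 (y k - y l); rewrite /mu; lra.
  have hx1 : cabs (x1 - y k) < d.
    have : cabs (x1 - y l) < mu.
      by rewrite /x1 /x0 -we_cat -fsE; apply: he3 => //; rewrite size_takel.
    by have := cabs_tri (y l) x1 (y k); rewrite (cabsB (y l)) /mu; lra.
  have dO := discO _ _ (yaway k kT).
  have Ox0 := dO _ hx0.
  have x10 : comp O x1 x0 by apply: (comp_disc dO (@comp_refl O x1)).
  pose Q := comp O x0.
  have Qo : eopen Q by exact: comp_open.
  have QnK z : Q z -> ~ K z by move=> /(comp_sub Ox0) /OK.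
  have Qr z : Q z -> cabs z <= r by move=> /QnK nK; rewrite leNgt; apply/negP => /ltW /Kr.
  have clK v z : v != [::] -> ~ O z -> K (we P' v z).
    move=> v0 nO; have [eta'0 _ _ _] := tK'.
    have [d2 d20 hd2] := poly_cont (wp P' v) z eta'0.
    have [u uz Ku] : exists2 u, cabs (u - z) < d2 & K u.
      apply: contrapT => no; apply: nO; exists d2 => // u uz Ku; apply: no.
      by exists u.
    apply: (trap_word tK' v0 Ku); rewrite cabsB -!wpE; exact: hd2.
  have Qbd z : (forall e, 0 < e -> exists2 x, Q x & cabs (x - z) < e) -> ~ Q z ->
      K (we P' s z).
    by move=> hz nQ; apply: clK => //; exact: comp_boundary hz nQ.
  have [ns hns] := size_wp P'2 s.
  have back b : Q b -> exists2 z, Q z & we P' s z = b.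
    move=> Qb.
    have [|||z Qz hz] := @comp_surjective O (wp P' s) ns Q r x0 hns Qo Qr _ _ b.
    - by move=> z hz nQ; rewrite wpE => /OK; apply; exact: Qbd.
    - exact: comp_refl.
    - by rewrite wpE; exact: comp_trans x10 Qb.
    by exists z => //; rewrite -wpE.
  have /choice[g hg] : forall b, exists z, Q b -> Q z /\ we P' s z = b.
    move=> b; have [/back[z Qz zb]|nQ] := pselect (Q b); first by exists z.
    by exists b.
  (* A backward orbit of s inside Q. Since i copies of s send [zz j] to [zz (j - i)], outside K, a
     cluster point b is never trapped along powers of s. *)
  pose zz k := iter k g x0.
  have Qzz i : Q (zz i) by elim: i => [|i /hg[]//]; exact: comp_refl.
  pose ss i := flatten (nseq i s).
  have ssS i z : we P' (ss i.+1) z = we P' (ss i) (we P' s z) by rewrite /ss /= we_cat.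
  have zzE i j : we P' (ss i) (zz (j + i)%N) = zz j.
    elim: i j => [|i IH] j; first by rewrite addn0.
    by rewrite ssS addnS /=; have [_ ->] := hg _ (Qzz (j + i)%N).
  have [b hb] := @cluster_pt R zz r (fun i => Qr _ (Qzz i)).
  have nKb i : ~ K (we P' (ss i) b).
    move=> Kb; have [e e0 he] := Ko _ Kb.
    have [d2 d20 hd2] := poly_cont (wp P' (ss i)) b e0.
    have [j ij hj] := hb d2 d20 i.
    apply: (QnK (zz (j - i)%N)) => //.
    rewrite -(zzE i) subnK //; apply: he; rewrite -!wpE; exact: hd2.
  have Jb : untrapped P' K b.
    move=> i; exists (take i (ss i)); last exact: (trap_prefix tK' (nKb i)).
    rewrite size_takel // /ss size_flatten /shape map_nseq sumn_nseq mulnC leq_pmulr //.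
    by rewrite lt0n size_eq0.
  have Qb : Q b.
    apply: contrapT => nQ; apply: (nKb 1%N); rewrite /ss /= cats0; apply: Qbd => //.
    by move=> e e0; have [j _ hj] := hb e e0 0%N; exists (zz j).
  have [nf hnf] := size_wp P'2 f.
  (* A boundary point of Om has modulus at least r or lies in neither U1 nor V1; in the second case
     the first n.+1 letters of f trap it. So f maps Om onto Q, and b has a preimage in U1. *)
  pose Om z := U1 z /\ cabs z < r + 1.
  have [|||||z [Uz _] fz] := @comp_surjective O (wp P' f) nf Om (r + 1) a hnf _ _ _ _ b.
  - move=> z [/U1o[e e0 he] zr]; exists (Num.min e (r + 1 - cabs z)).
      by rewrite lt_min e0 subr_gt0.
    move=> u; rewrite lt_min => /andP[uz1 uz2]; split; first exact: he.
    by have := cabs_ub u z; lra.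
  - by move=> z [_ /ltW].
  - move=> z hz nOm; rewrite wpE => /OK; apply.
    have [zr|zr] := leP r (cabs z); first by apply: (trap_we tK'); exact: Kr.
    have nU : ~ U1 z by move=> Uz; apply: nOm; split=> //; lra.
    have nV : ~ V1 z.
      move=> /V1o[e e0 he]; have [x [Ux _] xz] := hz e e0.
      by apply: (UV1 x); split=> //; exact: he.
    rewrite -(cat_take_drop n.+1 f) we_cat; apply: (trap_we tK').
    apply: contrapT => nK; have [] // := cover1 P' P'2 PP2 z.
    by exists (take n.+1 f) => //; rewrite size_takel // fsize leq_addr.
  - by split=> //; have := untrapped_outer tK Kr Ja; lra.
  - by rewrite wpE.
  rewrite wpE in fz; exists z => //.
  by apply: (untrapped_preimage (w := f) tK'); rewrite fz.
have [e3 e30 he3] := main U V Uo Vo UV cover hU.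
have [||e4 e40 he4] := main V U Vo Uo _ _ hV.
- by move=> z [Vz Uz]; apply: (UV z).
- by move=> P' P'2 PP' z /(cover P' P'2 PP')[]; [right|left].
exists (Num.min (Num.min e1 e2) (Num.min e3 e4)).
  by rewrite !lt_min e10 e20 e30 e40.
move=> P' P'2 PP'; exists U, V; split=> //.
- move=> z Jz; apply: (cover P') (Jz n.+1) => //.
  by apply: tclose_le PP'; rewrite ge_min lexx.
- split; [apply: he3|apply: he4] => //; apply: tclose_le PP'.
    by rewrite !ge_min lexx !orbT.
  by rewrite !ge_min lexx !orbT.
Qed.

End Tuples.
End Perturbation.

(** * Openness *)

Section Openness.
Variable R : realType.
Local Notation C := R[i].
Local Notation Chat := (sphere R).
Variable m : nat.
Implicit Types (h : PolyGe2_tuple R m) (P : 'I_m -> {poly C}).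

Definition represents P h := (forall j, (2 < size (P j))%N) /\
  forall j, (set_val (h j) : Chat -> Chat) = omap (fun z => (P j).[z]).

Lemma represented h : exists P, represents P h.
Proof.
have /choice[P hP] : forall j, exists p : {poly C}, (2 < size p)%N /\
    (set_val (h j) : Chat -> Chat) = omap (fun z => p.[z]).
  move=> j; have [d d2 [p hp pE]] := set_valP (h j).
  by exists p; split; rewrite // hp.
by exists P; split=> j; have [] := hP j.
Qed.

Lemma semigroup_ofE P h : represents P h -> semigroup_of h = sgp P.
Proof.
move=> [_ hE].
have E : (fun j => set_val (h j) : Chat -> Chat) = (fun j => omap (fun z => (P j).[z])).
  by apply: funext => j; exact: hE.
by rewrite /semigroup_of /sgp E.
Qed.

Lemma open_tuple (X : set (PolyGe2_tuple R m)) :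
  (forall h P, X h -> represents P h -> exists2 e, 0 < e & forall h' P',
     represents P' h' -> tclose P P' e -> X h') -> open X.
Proof.
move=> hX; rewrite openE => h Xh; have [P hP] := represented h.
have [e e0 he] := hX h P Xh hP.
have near : nbhs h [set h' : PolyGe2_tuple R m | forall j : 'I_m, forall z : Chat,
    sdist ((set_val (h j) : Chat -> Chat) z) ((set_val (h' j) : Chat -> Chat) z) < e].
  apply: (@filter_forall _ 'I_m (fun j (h' : PolyGe2_tuple R m) => forall z : Chat,
    sdist ((set_val (h j) : Chat -> Chat) z) ((set_val (h' j) : Chat -> Chat) z) < e)
    (nbhs h)) => j.
  have c2 : nbhs (h j : PolyGe2 R) [set f : PolyGe2 R | forall z : Chat,
      sdist ((set_val (h j) : Chat -> Chat) z) ((set_val f : Chat -> Chat) z) < e].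
    apply: (@initial_continuous _ _ (set_val : PolyGe2 R -> {uniform Chat -> Chat}) (h j)
      [set f : {uniform Chat -> Chat} | forall z : Chat,
        sdist ((set_val (h j) : Chat -> Chat) z) (f z) < e]).
    apply/uniform_nbhs; exists [set xy | ball xy.1 e xy.2]; split.
      by rewrite -entourage_ballE; exists e.
    by move=> f hf z; have := hf z I; rewrite /= ball_sphere.
  exact: (@proj_continuous 'I_m (fun=> PolyGe2 R : topologicalType) j h _ c2).
apply: filterS near => h' hh'; have [P' hP'] := represented h'.
apply: (he h' P') => // j z; have := hh' j (Some z).
by have [_ ->] := hP; have [_ ->] := hP'.
Qed.

Lemma HypP P h : (0 < m)%N -> represents P h -> Hyp R m h <-> outer_trap_exists P.
Proof.
move=> m0 hP; rewrite /Hyp /= (semigroup_ofE hP); apply: hyperbolicP => //.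
by case: hP.
Qed.

Lemma HypBddP P h : (0 < m)%N -> represents P h ->
  (Hyp R m `&` Bdd R m) h <-> bounded_trap_exists P.
Proof.
move=> m0 hP; rewrite /Hyp /Bdd /setI /= (semigroup_ofE hP); apply: pcb_hyperbolicP => //.
by case: hP.
Qed.

Hypothesis m0 : (0 < m)%N.

Lemma open_Hyp : open (Hyp R m).
Proof.
apply: open_tuple => h P /(HypP m0) hH hP.
have [K [eta [tK [r hr] [a na]]]] := hH P hP.
have [e e0 he] := trap_perturb hP.1 tK (or_introl (ex_intro _ r hr)).
exists e => // h' P' hP' PP'; apply/(HypP m0 hP'); exists K, (eta / 2).
by split; [apply: he => //; case: hP'|exists r|exists a].
Qed.

Lemma open_HypBdd : open (Hyp R m `&` Bdd R m).
Proof.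
apply: open_tuple => h P hH hP.
have [K [eta [tK [B hB]]]] := (HypBddP m0 hP).1 hH.
have [e e0 he] := trap_perturb hP.1 tK (or_intror (ex_intro _ B hB)).
exists e => // h' P' hP' PP'; apply/(HypBddP m0 hP'); exists K, (eta / 2).
by split; [apply: he => //; case: hP'|exists B].
Qed.

Lemma open_HypDisc : open (Hyp R m `&` Disc R m).
Proof.
apply: open_tuple => h P [hH hD] hP.
have [K [eta [tK [r hr] [a na]]]] := (HypP m0 hP).1 hH.
have [e1 e10 he1] := trap_perturb hP.1 tK (or_introl (ex_intro _ r hr)).
move: hD; rewrite /Disc /= (semigroup_ofE hP) => /(disconnectedP hP.1 tK hr na) sepK.
have [e2 e20 he2] := separated_perturb hP.1 tK hr sepK.
exists (Num.min e1 e2); first by rewrite lt_min e10.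
move=> h' P' hP' PP'.
have tK' : trap P' K (eta / 2).
  by apply: he1; [case: hP'|apply: tclose_le PP'; rewrite ge_min lexx].
split; first by apply/(HypP m0 hP'); exists K, (eta / 2); split=> //; [exists r|exists a].
rewrite /Disc /= (semigroup_ofE hP'); apply/(disconnectedP hP'.1 tK' hr na).
by apply: he2; [case: hP'|apply: tclose_le PP'; rewrite ge_min lexx orbT].
Qed.

Lemma open_HypBddDisc : open (Hyp R m `&` Bdd R m `&` Disc R m).
Proof.
have -> : Hyp R m `&` Bdd R m `&` Disc R m =
    (Hyp R m `&` Bdd R m) `&` (Hyp R m `&` Disc R m).
  by apply/seteqP; split=> h [[h1 h2]]; [move=> h3|move=> [_ h3]].
by apply: openI; [exact: open_HypBdd|exact: open_HypDisc].
Qed.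

End Openness.

(** * Surjectivity of the first projection *)

Section Surjectivity.
Variable R : realType.
Local Notation C := R[i].
Local Notation Chat := (sphere R).
Implicit Types (p : {poly C}) (z u b c : C).

(** For d >= 2 and l > 0 its only finite critical point b is fixed, so adding such a map creates no
    critical value besides b. *)
Definition power_map b (l : R) d : {poly C} := l%:C *: ('X - b%:P) ^+ d + b%:P.

Lemma power_mapE b l d z : (power_map b l d).[z] - b = l%:C * (z - b) ^+ d.
Proof.
by rewrite /power_map hornerD hornerZ horner_exp hornerXsubC hornerC addrK.
Qed.

Lemma cabs_power_map b l d z : 0 <= l ->
  cabs ((power_map b l d).[z] - b) = l * cabs (z - b) ^+ d.
Proof. by move=> l0; rewrite power_mapE cabs_scal // cabsX. Qed.

Lemma realC_neq0 (l : R) : 0 < l -> l%:C != 0 :> C.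
Proof. by move=> l0; rewrite -cabs_gt0 cabsR gtr0_norm. Qed.

Lemma size_power_map b l d : 0 < l -> (0 < d)%N -> size (power_map b l d) = d.+1.
Proof.
move=> /realC_neq0 l0 d0.
have hs : size (l%:C *: ('X - b%:P) ^+ d) = d.+1 by rewrite size_scale // size_exp_XsubC.
by rewrite /power_map size_polyDl hs // size_polyC; case: (b != 0).
Qed.

Lemma deriv_power_map b l d c : 0 < l -> (1 < d)%N -> (power_map b l d)^`().[c] = 0 -> c = b.
Proof.
move=> /realC_neq0 l0 d1 /eqP.
rewrite /power_map derivD derivC addr0 derivZ deriv_exp derivXsubC mul1r hornerZ hornerMn.
rewrite horner_exp hornerXsubC mulf_eq0 (negbTE l0) /= mulrn_eq0 expf_eq0 subr_eq0.
by case: d d1 => [|[|d]] //= _ /eqP.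
Qed.

Lemma growth_at p b n : size p = n.+2 -> exists2 c, 0 < c & exists2 T : R, 1 <= T &
  forall z, T <= cabs (z - b) -> c * cabs (z - b) ^+ n.+1 <= cabs (p.[z] - b).
Proof.
move=> hp; have hq : size (p \Po ('X + b%:P) - b%:P) = n.+2.
  by apply: size_subC; rewrite size_comp_poly2 ?size_XaddC.
have [c c0 [T T1 hT]] := poly_growth hq; exists c => //; exists T => // z /hT.
by rewrite hornerD hornerN hornerC horner_comp hornerD hornerX hornerC subrK.
Qed.

Lemma PolyGe2_of p : (2 < size p)%N -> exists g : PolyGe2 R,
  (set_val g : Chat -> Chat) = omap (fun z => p.[z]).
Proof.
move=> p2.
have hg : (@polymap_deg_ge2 R : set {uniform Chat -> Chat}) (omap (fun z => p.[z])).
  by case hp: (size p) p2 => [|[|[|n]]] // _; exists n.+2 => //; exists p.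
by exists (exist (fun g => g \in (@polymap_deg_ge2 R : set {uniform Chat -> Chat})) _
  (mem_set hg)).
Qed.

Section Tuple.
Variables (m : nat) (m_gt0 : (0 < m)%N).
Implicit Types (h : PolyGe2_tuple R m) (P Q : 'I_m -> {poly C}) (d : 'I_m -> nat)
  (K : C -> Prop).
Let i0 := ord_first m_gt0.

Lemma tuple_of Q (f : PolyGe2 R) : (forall j, (2 < size (Q j))%N) ->
  (set_val f : Chat -> Chat) = omap (fun z => (Q i0).[z]) ->
  exists2 h, represents Q h & h i0 = f.
Proof.
move=> Q2 fE.
have /choice[g hg] : forall j, exists g : PolyGe2 R,
    (set_val g : Chat -> Chat) = omap (fun z => (Q j).[z]).
  by move=> j; exact: PolyGe2_of.
exists (fun j => if j == i0 then f else g j); last by rewrite eqxx.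
by split=> // j; case: eqVneq => [->|].
Qed.

Lemma singleton_HypBdd h : (Hyp R m `&` Bdd R m) h ->
  (Hyp R 1 `&` Bdd R 1) (singleton_tuple (h i0)).
Proof.
move=> hH; have [P hP] := represented h; have [P2 hE] := hP.
have [K [eta [[eta0 Ko ha hb] [B hB]]]] := (HypBddP m_gt0 hP).1 hH.
have hP1 : represents (fun=> P i0) (singleton_tuple (h i0)) by split=> j; rewrite ?P2 ?hE.
by apply: (HypBddP (ltn0Sn 0) hP1).2; exists K, eta; split; [split=> // j; [exact: ha|exact: hb]|exists B].
Qed.

(** The point b is a critical value of p, so the trap contains the eta-disc about it. *)
Lemma target_trap (f : PolyGe2 R) n : (2 <= n)%N -> (Hyp R 1 `&` Bdd R 1) (singleton_tuple f) ->
  Ydeg R n f -> exists p, [/\ size p = n.+1,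
    (set_val f : Chat -> Chat) = omap (fun z => p.[z]) &
    exists K eta b, [/\ trap (fun _ : 'I_1 => p) K eta, forall u, cabs (u - b) < eta -> K u &
      exists2 B, 1 <= B & forall z, K z -> cabs (z - b) <= B]].
Proof.
move=> n2 fH [p hp fE]; exists p; split=> //.
have hP : represents (fun _ : 'I_1 => p) (singleton_tuple f) by split=> // j; rewrite hp.
have [K [eta [tK [B hB]]]] := (HypBddP (ltn0Sn 0) hP).1 fH.
have [eta0 _ _ hb] := tK; case: n n2 hp => [|[|n]] // _ hp.
have /closed_rootP[c /rootP hc] : size p^`() != 1%N by rewrite (size_derivC hp).
exists K, eta, p.[c]; split=> //; first by move=> u; exact: (hb ord0 c hc).
exists (`|B| + cabs p.[c] + 1); first by rewrite lerDr addr_ge0 ?cabs_ge0.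
move=> z /hB zB; have := cabsD z (- p.[c]); rewrite cabsN.
by have := ler_norm B; lra.
Qed.

Lemma extended_trap p K (eta B : R) b Q d (l : 'I_m -> R) :
  trap (fun _ : 'I_1 => p) K eta -> (forall u, cabs (u - b) < eta -> K u) ->
  (forall z, K z -> cabs (z - b) <= B) -> 1 <= B -> (forall j, (2 <= d j)%N) ->
  Q i0 = p -> (forall j, j != i0 -> Q j = power_map b (l j) (d j)) ->
  (forall j, 0 < l j) -> (forall j, l j * B ^+ d j <= eta / 2) ->
  trap Q K (eta / 2).
Proof.
move=> [eta0 Ko ha hb] Kb KB B1 d2 Q0 Qj l0 lB.
split=> //; first by rewrite divr_gt0.
- move=> j z Kz u uz; have [ji|ji] := eqVneq j i0.
    by apply: (ha ord0 z Kz); rewrite ji Q0 in uz; lra.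
  apply: Kb; rewrite Qj // in uz.
  have h1 : cabs ((power_map b (l j) (d j)).[z] - b) <= eta / 2.
    rewrite cabs_power_map; last exact: ltW.
    apply: le_trans (lB j); rewrite ler_wpM2l ?(ltW (l0 j)) //.
    by rewrite lerXn2r ?nnegrE ?cabs_ge0 ?KB //; lra.
  have := cabs_tri (power_map b (l j) (d j)).[z] u b; lra.
- move=> j c; have [->|ji] := eqVneq j i0.
    by rewrite Q0 => hc u uc; apply: (hb ord0 c hc); lra.
  rewrite Qj // => /deriv_power_map ->; rewrite ?l0 ?d2 // => u uc.
  apply: Kb; have h1 : cabs ((power_map b (l j) (d j)).[b] - b) = 0.
    by rewrite cabs_power_map ?ltW // subrr cabs0 expr0n; case: (d j) (d2 j) => // k _; rewrite mulr0.
  have := cabs_tri (power_map b (l j) (d j)).[b] u b; lra.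
Qed.

Lemma small_factor (B eta : R) d : 1 <= B -> 0 < eta ->
  exists2 e, 0 < e & forall j : 'I_m, forall l, l <= e -> l * B ^+ d j <= eta / 2.
Proof.
move=> B1 eta0; have B0 : 0 < B by lra.
apply: fin_uniform => [j e e' ee' h l le|j]; first by apply: h; exact: le_trans ee'.
exists (eta / 2 / B ^+ d j); first by rewrite !divr_gt0 // exprn_gt0.
by move=> l; rewrite ler_pdivlMr // exprn_gt0.
Qed.

Lemma surjection_HypBdd d : (forall j, (2 <= d j)%N) ->
  surjection (Hyp R m `&` Bdd R m `&` Yprod R d)
    (@singleton_tuple R @^-1` (Hyp R 1 `&` Bdd R 1) `&` Ydeg R (d i0)) (pi1 m_gt0).
Proof.
move=> d2; split.
  by move=> h [hH hY]; split; [exact: singleton_HypBdd|exact: hY].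
move=> f [fH fY].
have [p [hp fE [K [eta [b [tK Kb [B B1 KB]]]]]]] := target_trap (d2 i0) fH fY.
have [eta0 _ _ _] := tK.
have [l l0 hl] := small_factor d B1 eta0.
pose Q j := if j == i0 then p else power_map b l (d j).
have Qs j : size (Q j) = (d j).+1.
  rewrite /Q; case: eqVneq => [->|_] //.
  by rewrite size_power_map // (leq_trans _ (d2 j)).
have Q0 : Q i0 = p by rewrite /Q eqxx.
have [h hQ hf] := @tuple_of Q f (fun j => ltac:(by rewrite Qs ltnS d2)) (ltac:(by rewrite Q0)).
have tQ : trap Q K (eta / 2).
  apply: (@extended_trap p K eta B b Q d (fun=> l)) => //.
    by move=> j ji; rewrite /Q (negbTE ji).
  by move=> j; exact: hl.
exists h => //; split.
  apply: (HypBddP m_gt0 hQ).2; exists K, (eta / 2); split=> //.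
  exists (B + cabs b) => z /KB; have := cabs_ub z b; lra.
by move=> j; exists (Q j) => //; case: hQ.
Qed.

(** The criterion for disconnectedness requires a trap containing a neighborhood of infinity. A
    point beyond 2 r is sent beyond 4 r, which leaves a margin of 2 r. *)
Lemma widened_trap Q K (eta r : R) b : trap Q K eta -> eta <= 2 * r ->
  (forall j z, 2 * r < cabs (z - b) -> 2 * cabs (z - b) <= cabs ((Q j).[z] - b)) ->
  trap Q (fun z => K z \/ 2 * r < cabs (z - b)) eta.
Proof.
move=> [eta0 Ko ha hb] etar hQ; split=> //.
- move=> z [/Ko[e e0 he]|zr]; first by exists e => // w /he; left.
  exists (cabs (z - b) - 2 * r); first by rewrite subr_gt0.
  by move=> w wz; right; have := cabs_tri w z b; rewrite (cabsB z w); lra.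
- move=> j z [Kz|zr] u uz; first by left; exact: ha uz.
  right; have := hQ j z zr.
  by have := cabs_tri u (Q j).[z] b; rewrite (cabsB (Q j).[z] u); lra.
- by move=> j z hz u uz; left; exact: hb hz u uz.
Qed.

(* The circle of center b and radius T is mapped into the trap by every map. *)
Lemma annulus_separated Q K (eta r T : R) b (A : pred 'I_m) j1 :
  (forall j, (2 < size (Q j))%N) ->
  trap Q (fun z => K z \/ 2 * r < cabs (z - b)) eta ->
  (exists a, ~ (K a \/ 2 * r < cabs (a - b))) ->
  A i0 -> ~~ A j1 ->
  (forall j z, A j -> T <= cabs (z - b) -> 2 * r < cabs ((Q j).[z] - b)) ->
  (forall j z, ~~ A j -> cabs (z - b) <= T -> K (Q j).[z]) ->
  disconnects Q (fun z => K z \/ 2 * r < cabs (z - b)).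
Proof.
move=> Q2; set K' := fun z => _ => tK [a na] A0 A1 hin hout.
pose s := 2 * `|r| + cabs b + 1.
have Ks z : s <= cabs z -> K' z.
  move=> zs; right; have := cabs_lb z b; have := ler_norm r; rewrite /s in zs; lra.
have nT z : untrapped Q K' z -> cabs (z - b) != T.
  move=> Jz; apply/eqP => zT; have [w w1 nK] := Jz 1%N; apply: nK.
  case: w w1 => [|j []] // _ /=; have [Aj|Aj] := boolP (A j).
    by right; apply: hin => //; rewrite zT.
  by left; apply: hout => //; rewrite zT.
have [y Jy] := untrapped_exists Q2 m_gt0 tK Ks na.
have nKy : ~ K' y by have [w /size0nil ->] := Jy 0%N.
(* An untrapped point has untrapped preimages under every generator: those under [i0] lie inside the
   circle, those under [j1] outside. *)
have pre j : exists2 z, untrapped Q K' z & (Q j).[z] = y.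
  have [n hn] := size_P Q2 j.
  have /closed_rootP[z] : size (Q j - y%:P) != 1%N by rewrite (size_subC y hn).
  rewrite rootE hornerD hornerN hornerC subr_eq0 => /eqP hz; exists z => //.
  by apply: (@untrapped_preimage _ _ Q K' eta [:: j] z tK); rewrite /= hz.
exists (fun z => cabs (z - b) < T), (fun z => T < cabs (z - b)); split.
- move=> z zT; exists (T - cabs (z - b)); first by rewrite subr_gt0.
  by move=> w wz; have := cabs_tri z w b; lra.
- move=> z zT; exists (cabs (z - b) - T); first by rewrite subr_gt0.
  by move=> w wz; have := cabs_tri w z b; rewrite (cabsB z w); lra.
- by move=> z [h1 h2]; lra.
- by move=> z /nT; rewrite neq_lt => /orP.
split.
  have [z Jz zy] := pre i0; exists z => //; rewrite ltNge; apply/negP => zT.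
  by apply: nKy; right; rewrite -zy; exact: hin.
have [z Jz zy] := pre j1; exists z => //; rewrite ltNge; apply/negP => zT.
by apply: nKy; left; rewrite -zy; exact: hout.
Qed.

Lemma power_ge (x y : R) n k : 1 <= x -> x <= y -> (n <= k)%N -> x ^+ n <= y ^+ k.
Proof.
move=> x1 xy nk; have y1 : 1 <= y by exact: le_trans xy.
apply: (@le_trans _ _ (y ^+ n)); first by rewrite lerXn2r ?nnegrE //; lra.
by rewrite ler_weXn2l.
Qed.

(* With r = x^5 and T = x^3 or x^2, the maps of A send the circle of radius T beyond
   the distance 2 x^5 and the others, normalized to fix the circle of radius x^5, send
   it within 1 / x of b; this is where (d_1, d_j) <> (2, 2) is used for j outside A. *)
Lemma surjection_HypBddDisc d : (forall j, (2 <= d j)%N) -> d <> (fun=> 2%N) -> (1 < m)%N ->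
  surjection (Hyp R m `&` Bdd R m `&` Disc R m `&` Yprod R d)
    (@singleton_tuple R @^-1` (Hyp R 1 `&` Bdd R 1) `&` Ydeg R (d i0)) (pi1 m_gt0).
Proof.
move=> d2 dn2 m1; split.
  by move=> h [[hH _] hY]; split; [exact: singleton_HypBdd|exact: hY].
move=> f [fH fY].
have [p [hp fE [K [eta [b [tK Kb [B B1 KB]]]]]]] := target_trap (d2 i0) fH fY.
have [eta0 Ko _ _] := tK.
have [l l0 hl] := small_factor d B1 eta0.
pose q := d i0 == 2%N.
(* The maps to be sent outward on the circle: the first one and, if it is quadratic, all quadratic
   ones. That some map is left over follows from d not being constantly 2, or from m > 1 if d i0 >
   2. *)
pose A : pred 'I_m := fun j => (j == i0) || (q && (d j == 2%N)).
have A0 : A i0 by rewrite /A eqxx.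
have [j1 A1] : exists j1, ~~ A j1.
  have [q2|q2] := boolP q.
    have [j dj] : exists j, d j != 2%N.
      apply: contrapT => no; apply: dn2; apply: funext => j; apply/eqP.
      by apply: contrapT => /negP h; apply: no; exists j.
    exists j; rewrite /A q2 /= (negbTE dj) orbF.
    by apply: contraNneq dj => ->.
  exists (Ordinal m1); rewrite /A (negbTE q2) orbF.
  by apply/eqP => /(congr1 (@nat_of_ord _)).
(* Degrees in A are at least dA, the others at least 5 - dA, and tt = 5 - dA. Since tt dA = 6, T ^
   dA = x ^ 6 = x r, and r (T / r) ^ (5 - dA) = 1 / x in both cases. *)
pose tt := if q then 3%N else 2%N; pose dA := if q then 2%N else 3%N.
have dAE j : A j -> (dA <= d j)%N.
  rewrite /A /dA /q => /orP[/eqP ->|/andP[-> /eqP ->]] //.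
  by case: eqVneq (d2 i0) => // ne; rewrite [(2 <= _)%N]leq_eqVlt eq_sym (negbTE ne).
have dBE j : ~~ A j -> (5 - dA <= d j)%N.
  rewrite /A /dA negb_or => /andP[_]; case: (q) => //=.
  by move=> ne; have := d2 j; rewrite [(2 <= _)%N]leq_eqVlt eq_sym (negbTE ne).
have [n hn] : exists n, d i0 = n.+1 by case: (d i0) (d2 i0) => // n _; exists n.
have hp' : size p = n.+2 by rewrite hp hn.
have [c0 c00 [T0 T01 hT0]] := growth_at b hp'.
pose c := Num.min c0 l; have cc : 0 < c by rewrite lt_min c00.
(* Each summand secures one of the lower bounds on x listed next. *)
pose x := T0 + 3 / c + 3 / eta + B + 1 / l + eta.
have [hx1 hx2 hx3] : [/\ 0 < 3 / c, 0 < 3 / eta & 0 < 1 / l] by rewrite !divr_gt0.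
have xT0 : T0 <= x by rewrite /x; lra.
have x1 : 1 <= x by lra.
have x0 : 0 < x by lra.
have xc : 3 <= c * x by rewrite mulrC -ler_pdivrMr // /x; lra.
have xe : 3 <= eta * x by rewrite mulrC -ler_pdivrMr // /x; lra.
have xl : 1 <= l * x by rewrite mulrC -ler_pdivrMr // /x; lra.
have xB : B <= x by rewrite /x; lra.
have xeta : eta <= x by rewrite /x; lra.
clearbody x; pose r := x ^+ 5; have r0 : 0 < r by rewrite exprn_gt0.
have xr : x <= r by rewrite /r -[leLHS]expr1; apply: ler_weXn2l.
pose T := x ^+ tt.
have xT : x <= T by rewrite /T -[leLHS]expr1; apply: ler_weXn2l => //; rewrite /tt; case: (q).
have TdA : T ^+ dA = x * r by rewrite /T /r /tt /dA; case: (q); rewrite -exprM -exprS.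
have Tr : T / r <= 1.
  by rewrite ler_pdivrMr // mul1r /T /r; apply: ler_weXn2l => //; rewrite /tt; case: (q).
have rTr : r * (T / r) ^+ (5 - dA) = x^-1.
  rewrite /T /r /tt /dA; case: (q) => /=; rewrite expr_div_n -!exprM; field;
    by rewrite ?expf_neq0 ?gt_eqF.
clearbody r T.
pose lam j := if A j then l else (r ^+ (d j).-1)^-1.
have lam0 j : 0 < lam j by rewrite /lam; case: (A j); rewrite ?invr_gt0 ?exprn_gt0.
have laml j : lam j <= l.
  rewrite /lam; case: (A j) => //; rewrite -[l]invrK lef_pV2 ?posrE ?invr_gt0 ?exprn_gt0 //.
  apply: (@le_trans _ _ x); first by rewrite -[l^-1]mul1r ler_pdivrMr // mulrC.
  apply: (le_trans xr); rewrite -[leLHS]expr1; apply: ler_weXn2l; first exact: le_trans xr.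
  by have := d2 j; case: (d j) => [|[|k]].
pose Q j := if j == i0 then p else power_map b (lam j) (d j).
have Qs j : size (Q j) = (d j).+1.
  rewrite /Q; case: eqVneq => [->|_] //.
  by rewrite size_power_map // (leq_trans _ (d2 j)).
have Q2 j : (2 < size (Q j))%N by rewrite Qs ltnS d2.
have Q0 : Q i0 = p by rewrite /Q eqxx.
have [h hQ hf] := @tuple_of Q f Q2 (ltac:(by rewrite Q0)).
have tQ : trap Q K (eta / 2).
  apply: (@extended_trap p K eta B b Q d lam) => //.
    by move=> j ji; rewrite /Q (negbTE ji).
  by move=> j; exact: hl.
have growA j z : A j -> T0 <= cabs (z - b) -> c * cabs (z - b) ^+ d j <= cabs ((Q j).[z] - b).
  move=> Aj zT; rewrite /Q; case: eqVneq => [ji|ji].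
    rewrite ji hn; apply: le_trans (hT0 z zT).
    by rewrite ler_wpM2r ?exprn_ge0 ?cabs_ge0 // ge_min lexx.
  rewrite cabs_power_map; last exact: ltW.
  rewrite /lam Aj.
  by rewrite ler_wpM2r ?exprn_ge0 ?cabs_ge0 // ge_min lexx orbT.
have normB j z : ~~ A j -> cabs ((Q j).[z] - b) = r * (cabs (z - b) / r) ^+ d j.
  move=> Aj; rewrite /Q; case: eqVneq => [ji|_]; first by rewrite ji A0 in Aj.
  rewrite cabs_power_map ?ltW // /lam (negbTE Aj) expr_div_n.
  have := d2 j; case: (d j) => // k _; rewrite /= [r ^+ k.+1]exprS.
  by field; rewrite expf_neq0 ?gt_eqF.
pose K' z := K z \/ 2 * r < cabs (z - b).
have tK' : trap Q K' (eta / 2).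
  apply: widened_trap => // [|j z zr]; first by clear - eta0 xeta xr; lra.
  have [Aj|Aj] := boolP (A j).
    have xz : x <= cabs (z - b) by clear - zr xr r0; lra.
    apply: le_trans (growA j z Aj (le_trans xT0 xz)).
    have z1 : 1 <= cabs (z - b) := le_trans x1 xz.
    have : cabs (z - b) ^+ 2 <= cabs (z - b) ^+ d j by apply: ler_weXn2l.
    have h1 : c * x <= c * cabs (z - b) by rewrite ler_pM2l.
    rewrite expr2 => h2; have := ler_wpM2l (ltW cc) h2.
    have := ler_wpM2r (cabs_ge0 (z - b)) h1.
    have := ler_wpM2r (cabs_ge0 (z - b)) xc; have := cabs_ge0 (z - b).
    by clear; lra.
  rewrite normB //.
  have t2 : 2 <= cabs (z - b) / r by rewrite ler_pdivlMr // ltW.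
  have -> : cabs (z - b) = r * (cabs (z - b) / r) by field; rewrite gt_eqF.
  have -> : r * (cabs (z - b) / r) / r = cabs (z - b) / r by field; rewrite gt_eqF.
  move: (cabs (z - b) / r) t2 => t t2; have t1 : 1 <= t by rewrite (le_trans _ t2) // ler1n.
  rewrite mulrCA ler_pM2l //; apply: (@le_trans _ _ (t ^+ 2)); last exact: ler_weXn2l.
  by rewrite expr2 ler_wpM2r // (le_trans _ t1).
have [a na] : exists a, ~ K' a.
  exists (b + (2 * r)%:C) => -[/KB|]; rewrite [b + _]addrC addrK cabsR gtr0_norm ?mulr_gt0 //.
    by clear - xB xr r0; lra.
  by rewrite ltxx.
have Kr z : 2 * r + cabs b + 1 <= cabs z -> K' z.
  by move=> zr; right; have := cabs_lb z b; clear - zr; lra.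
have sepQ : disconnects Q K'.
  apply: (@annulus_separated Q K (eta / 2) r T b A j1) => //; first by exists a.
  - move=> j z Aj zT; have xz := le_trans xT zT.
    apply: lt_le_trans (growA j z Aj (le_trans xT0 xz)).
    have : T ^+ dA <= cabs (z - b) ^+ d j by apply: power_ge (dAE j Aj) => //; exact: le_trans xT.
    rewrite TdA.
    have : 2 * r < c * (x * r) by rewrite [c * (x * r)]mulrA ltr_pM2r //; clear - xc; lra.
    by move=> h1 /(ler_wpM2l (ltW cc)); exact: lt_le_trans.
  - move=> j z Aj zT; apply: Kb; rewrite normB //.
    have tr : cabs (z - b) / r <= T / r by rewrite ler_pM2r ?invr_gt0.
    have t0 : 0 <= cabs (z - b) / r by rewrite divr_ge0 ?cabs_ge0 // ltW.
    have h1 : (cabs (z - b) / r) ^+ d j <= (T / r) ^+ (5 - dA).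
      apply: (@le_trans _ _ ((T / r) ^+ d j)); first by rewrite lerXn2r ?nnegrE // (le_trans t0).
      by apply: ler_wiXn2l => //; [rewrite (le_trans t0)|exact: dBE].
    apply: (@le_lt_trans _ _ x^-1); first by rewrite -rTr ler_pM2l.
    by rewrite -[x^-1]mul1r ltr_pdivrMr //; clear - xe; lra.
exists h => //; split; last by move=> j; exists (Q j) => //; case: hQ.
split.
  apply: (HypBddP m_gt0 hQ).2; exists K, (eta / 2); split=> //.
  exists (B + cabs b) => z /KB; have := cabs_ub z b; clear; lra.
by rewrite /Disc /= (semigroup_ofE hQ); apply/(disconnectedP Q2 tK' Kr na).
Qed.

End Tuple.
End Surjectivity.

Theorem theorem2p45 (R : realType) (m : nat) (m_gt0 : (0 < m)%N) :
  [/\ open (Hyp R m), open (Hyp R m `&` Bdd R m), open (Hyp R m `&` Disc R m) &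
      open (Hyp R m `&` Bdd R m `&` Disc R m)] /\
  (forall d : 'I_m -> nat, (forall j, (2 <= d j)%N) ->
     surjection (Hyp R m `&` Bdd R m `&` Yprod R d)
       (@singleton_tuple R @^-1` (Hyp R 1 `&` Bdd R 1)
          `&` Ydeg R (d (ord_first m_gt0)))
       (pi1 m_gt0)) /\
  (forall d : 'I_m -> nat, (forall j, (2 <= d j)%N) -> d <> (fun=> 2%N) ->
     (1 < m)%N ->
     surjection (Hyp R m `&` Bdd R m `&` Disc R m `&` Yprod R d)
       (@singleton_tuple R @^-1` (Hyp R 1 `&` Bdd R 1)
          `&` Ydeg R (d (ord_first m_gt0)))
       (pi1 m_gt0)).
Proof.
split; last by split; [exact: surjection_HypBdd|exact: surjection_HypBddDisc].
split; [exact: open_Hyp|exact: open_HypBdd|exact: open_HypDisc|exact: open_HypBddDisc].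
Qed.
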